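(* Let $\mathcal C$ be a spherical fusion category with spherical dimension function $d$, let $I\colon\mathcal C\to Z(\mathcal C)$ be the adjoint of the forgetful functor, and let $\{e_X\}_{X\in\mathrm{Irr}(\mathcal C)}$ be the basis of $\mathrm{End}_{Z(\mathcal C)}(I(\mathbb 1))$ described in the context. Then the assignment $e_X\mapsto d_X[X]$ gives an isomorphism $$(\mathrm{End}_{Z(\mathcal C)}(I(\mathbb 1)),\circ,\ast)\cong(K_0(\mathcal C),\cdot,\ast_d),$$ i.e. a linear isomorphism carrying composition $\circ$ to $\cdot$ and the convolution product $\ast$ to $\ast_d$.
   Context: Fusion categories are over $\mathbb C$. $\mathrm{Irr}(\mathcal C)$ is a set of representatives of simple objects, $d_X$ the spherical (categorical) dimension, $N^Z_{XY}=\dim_{\mathbb C}\mathcal C(X\otimes Y,Z)$. $K_0(\mathcal C)=\mathbb C[\mathrm{Irr}(\mathcal C)]$ with $[X]\cdot[Y]=\sum_{Z}N^Z_{XY}[Z]$ and $[X]\ast_d[Y]=\frac{\delta_{X,Y}}{d_X}[X]$. Objects of the Drinfeld center $Z(\mathcal C)$ are pairs $(Y,\phi_Y)$ with half-braiding $\phi_{Y,W}\colon Y\otimes W\to W\otimes Y$. Fix square roots $\sqrt{d_X}$ for $X\in\mathrm{Irr}(\mathcal C)$. The object $I(\mathbb 1)=\bigoplus_{X\in\mathrm{Irr}(\mathcal C)}X\otimes\bar X$ has the half-braiding with $W$ whose component $Y\otimes\bar Y\otimes W\to W\otimes Z\otimes\bar Z$ is $\sqrt{d_Y}\sqrt{d_Z}\sum_i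 i\otimes i^\bullet$, where $\{i\}$ is a basis of $\mathcal C(Y,W\otimes Z)$ and $\{i^\bullet\}\subseteq\mathcal C(\bar Y\otimes W,\bar Z)$ the dual basis for the pairing $\mathrm{ev}_{\bar Z\otimes Z}\circ(j^\bullet\otimes 1_Z)\circ(1_{\bar Y}\otimes i)\circ\mathrm{coev}_{\bar Y\otimes Y}=\delta_{i,j}$. Here evaluations and coevaluations are those of the spherical structure. $I(\mathbb 1)$ is a special Frobenius algebra in $Z(\mathcal C)$: multiplication $m$ is $\bigoplus_X\frac1{\sqrt{d_X}}\,1_X\otimes\mathrm{ev}_{\bar X\otimes X}\otimes1_{\bar X}\colon X\otimes\bar X\otimes X\otimes\bar X\to X\otimes\bar X$; unit $\bigoplus_X\sqrt{d_X}\,\mathrm{coev}_{X\otimes\bar X}$; comultiplication $\Delta=\bigoplus_X\frac1{\sqrt{d_X}}\,1_X\otimes\mathrm{coev}_{\bar X\otimes X}\otimes1_{\bar X}$; counit $\bigoplus_X\sqrt{d_X}\,\mathrm{ev}_{X\otimes\bar X}$. The convolution product on $\mathrm{End}_{Z(\mathcal C)}(I(\mathbb 1))$ is $a\ast b:=m\circ(a\otimes b)\circ\Delta$, and $\circ$ is composition. For $Y\in\mathrm{Irr}(\mathcal C)$, $e_Y\in\mathrm{End}_{Z(\mathcal C)}(I(\mathbb 1))$ is the morphism whose component $X\otimes\bar X\to Z\otimes\bar Z$ is $$d_Y\sqrt{d_X}\sqrt{d_Z}\sum_i(1_Z\otimes i)\circ(i^\bullet\otimes1_{\bar X}),$$ where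 $\{i\}$ is a basis of $\mathcal C(Y\otimes\bar X,\bar Z)$ and $\{i^\bullet\}\subseteq\mathcal C(X,Z\otimes Y)$ the dual basis for the pairing $\mathrm{ev}_{Z\otimes\bar Z}\circ(1_Z\otimes i)\circ(j^\bullet\otimes1_{\bar X})\circ\mathrm{coev}_{X\otimes\bar X}=\delta_{i,j}$. The $e_Y$ form a basis of $\mathrm{End}_{Z(\mathcal C)}(I(\mathbb 1))$. *)

(* Defs.v *)
From HB Require Import structures.
From mathcomp Require Import all_boot all_order all_algebra.
From mathcomp Require Import boolp classical_sets reals.
From mathcomp Require Export complex.

Set Implicit Arguments.
Unset Strict Implicit.
Unset Printing Implicit Defensive.

Import GRing.Theory.
Local Open Scope ring_scope.

Declare Scope cat_scope.
Delimit Scope cat_scope with cat.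

Reserved Notation "g ∘ f" (at level 40, left associativity).
Reserved Notation "X ⊗ Y" (at level 34, right associativity).
Reserved Notation "f ⊠ g" (at level 34, right associativity).

Local Open Scope cat_scope.

(* Hom spaces are finite dimensional by typing. *)
Record linear_category (k : fieldType) := LinearCategory {
  ob :> Type;
  mor : ob -> ob -> vectType k;
  idmor : forall X, mor X X;
  mcomp : forall X Y Z, mor Y Z -> mor X Y -> mor X Z;
  compA : forall W X Y Z (h : mor Y Z) (g : mor X Y) (f : mor W X),
    mcomp h (mcomp g f) = mcomp (mcomp h g) f;
  comp1m : forall X Y (f : mor X Y), mcomp (idmor Y) f = f;
  compm1 : forall X Y (f : mor X Y), mcomp f (idmor X) = f;
  comp_linear_r : forall X Y Z (g : mor Y Z), linear (@mcomp X Y Z g);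
  comp_linear_l : forall X Y Z (f : mor X Y),
    linear (fun g : mor Y Z => mcomp g f)
}.

Arguments mor {k l} _ _.
Arguments idmor {k l} X.
Arguments mcomp {k l X Y Z} _ _.

Notation "g ∘ f" := (mcomp g f) : cat_scope.

Section LinearCategoryTheory.
Variables (k : fieldType) (C : linear_category k).
Implicit Types (A X Y Z : C).

Definition is_iso X Y (f : mor X Y) : Prop :=
  exists g : mor Y X, g ∘ f = idmor X /\ f ∘ g = idmor Y.

Definition isomorphic X Y : Prop := exists f : mor X Y, is_iso f.

Definition is_mono X Y (f : mor X Y) : Prop :=
  forall A (g h : mor A X), f ∘ g = f ∘ h -> g = h.

Definition is_epi X Y (f : mor X Y) : Prop :=
  forall A (g h : mor Y A), g ∘ f = h ∘ f -> g = h.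

Definition is_kernel K X Y (i : mor K X) (f : mor X Y) : Prop :=
  f ∘ i = 0 /\
  forall A (g : mor A X), f ∘ g = 0 -> exists! h : mor A K, i ∘ h = g.

Definition is_cokernel X Y Q (f : mor X Y) (p : mor Y Q) : Prop :=
  p ∘ f = 0 /\
  forall A (g : mor Y A), g ∘ f = 0 -> exists! h : mor Q A, h ∘ p = g.

Record biproduct (I : finType) (F : I -> C) (B : C) := Biproduct {
  bp_inj : forall i, mor (F i) B;
  bp_proj : forall i, mor B (F i);
  proj_inj : forall i, bp_proj i ∘ bp_inj i = idmor (F i);
  proj_inj0 : forall i j, i != j -> bp_proj j ∘ bp_inj i = 0;
  sum_inj_proj : \sum_i bp_inj i ∘ bp_proj i = idmor B
}.

(* [I := void] yields a zero object. *)
Record is_abelian : Prop := IsAbelian {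
  ab_biproduct : forall (I : finType) (F : I -> C),
    exists B, inhabited (biproduct F B);
  ab_kernel : forall X Y (f : mor X Y), exists K (i : mor K X), is_kernel i f;
  ab_cokernel : forall X Y (f : mor X Y),
    exists Q (p : mor Y Q), is_cokernel f p;
  ab_monic : forall X Y (i : mor X Y),
    is_mono i -> exists Z (f : mor Y Z), is_kernel i f;
  ab_epic : forall X Y (p : mor X Y),
    is_epi p -> exists Z (f : mor Z X), is_cokernel f p
}.

(* Nonzero, with no subobject other than 0 and itself. *)
Definition simple_ob X : Prop :=
  idmor X <> 0 /\ forall A (i : mor A X), is_mono i -> i = 0 \/ is_iso i.

Definition is_semisimple : Prop :=
  forall X, exists (I : finType) (F : I -> C),
    (forall i, simple_ob (F i)) /\ inhabited (biproduct F X).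

Definition finitely_many_simples : Prop :=
  exists (I : finType) (F : I -> C),
    forall X, simple_ob X -> exists i, isomorphic X (F i).

Record simple_representatives (I : finType) (S : I -> C) : Prop :=
  SimpleRepresentatives {
    sr_simple : forall i, simple_ob (S i);
    sr_inj : forall i j, isomorphic (S i) (S j) -> i = j;
    sr_complete : forall X, simple_ob X -> exists i, isomorphic X (S i)
  }.

End LinearCategoryTheory.

Arguments bp_inj {k C I F B} _ i.
Arguments bp_proj {k C I F B} _ i.

(* [ass], [lu], [ru] are the associator and the unitors, [assi], [lui],
   [rui] their inverses. *)
Record monoidal_category (k : fieldType) := MonoidalCategory {
  mon_cat :> linear_category k;
  tens : mon_cat -> mon_cat -> mon_cat;
  tensm : forall X X' Y Y' : mon_cat,
    mor X X' -> mor Y Y' -> mor (tens X Y) (tens X' Y');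
  unit_ob : mon_cat;
  ass : forall X Y Z, mor (tens (tens X Y) Z) (tens X (tens Y Z));
  assi : forall X Y Z, mor (tens X (tens Y Z)) (tens (tens X Y) Z);
  lu : forall X, mor (tens unit_ob X) X;
  lui : forall X, mor X (tens unit_ob X);
  ru : forall X, mor (tens X unit_ob) X;
  rui : forall X, mor X (tens X unit_ob);
  tensm1 : forall X Y, tensm (idmor X) (idmor Y) = idmor (tens X Y);
  tensm_comp : forall X X' X'' Y Y' Y'' (f' : mor X' X'') (f : mor X X')
      (g' : mor Y' Y'') (g : mor Y Y'),
    tensm (f' ∘ f) (g' ∘ g) = tensm f' g' ∘ tensm f g;
  tensm_linear_r : forall X X' Y Y' (f : mor X X'), linear (@tensm X X' Y Y' f);
  tensm_linear_l : forall X X' Y Y' (g : mor Y Y'),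
    linear (fun f : mor X X' => tensm f g);
  assK : forall X Y Z, assi X Y Z ∘ ass X Y Z = idmor _;
  assiK : forall X Y Z, ass X Y Z ∘ assi X Y Z = idmor _;
  luK : forall X, lui X ∘ lu X = idmor _;
  luiK : forall X, lu X ∘ lui X = idmor _;
  ruK : forall X, rui X ∘ ru X = idmor _;
  ruiK : forall X, ru X ∘ rui X = idmor _;
  ass_nat : forall X X' Y Y' Z Z' (f : mor X X') (g : mor Y Y') (h : mor Z Z'),
    ass X' Y' Z' ∘ tensm (tensm f g) h = tensm f (tensm g h) ∘ ass X Y Z;
  lu_nat : forall X X' (f : mor X X'),
    lu X' ∘ tensm (idmor unit_ob) f = f ∘ lu X;
  ru_nat : forall X X' (f : mor X X'),
    ru X' ∘ tensm f (idmor unit_ob) = f ∘ ru X;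
  pentagon : forall W X Y Z,
    ass W X (tens Y Z) ∘ ass (tens W X) Y Z =
    tensm (idmor W) (ass X Y Z) ∘ ass W (tens X Y) Z
      ∘ tensm (ass W X Y) (idmor Z);
  triangle : forall X Y,
    tensm (idmor X) (lu Y) ∘ ass X unit_ob Y = tensm (ru X) (idmor Y)
}.

Arguments unit_ob {k m}.
Arguments tens {k m} X Y.
Arguments tensm {k m X X' Y Y'} f g.
Arguments ass {k m} X Y Z.
Arguments assi {k m} X Y Z.
Arguments lu {k m} X.
Arguments lui {k m} X.
Arguments ru {k m} X.
Arguments rui {k m} X.

Notation "X ⊗ Y" := (tens X Y) : cat_scope.
Notation "f ⊠ g" := (tensm f g) : cat_scope.

(* A pivotal structure, given as two-sided duals: [ev], [coev] make [dual X] a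
   left dual of [X] and [ev'], [coev'] make it a right dual, and the resulting
   left and right dual functors coincide as monoidal functors ([piv_map] on
   morphisms; [piv_tens], [piv_one]: each equation inside the [exists]
   determines [t], resp. [u], as the structure isomorphism of the left, resp.
   right, dual functor). *)
Record pivotal_category (k : fieldType) := PivotalCategory {
  piv_cat :> monoidal_category k;
  dual : piv_cat -> piv_cat;
  ev : forall X, mor (dual X ⊗ X) unit_ob;
  coev : forall X, mor unit_ob (X ⊗ dual X);
  ev' : forall X, mor (X ⊗ dual X) unit_ob;
  coev' : forall X, mor unit_ob (dual X ⊗ X);
  zigzag : forall X,
    ru X ∘ (idmor X ⊠ ev X) ∘ ass X (dual X) X ∘ (coev X ⊠ idmor X) ∘ lui X
    = idmor X;
  zigzag_dual : forall X,
    lu (dual X) ∘ (ev X ⊠ idmor (dual X)) ∘ assi (dual X) X (dual X)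
      ∘ (idmor (dual X) ⊠ coev X) ∘ rui (dual X) = idmor (dual X);
  zigzag' : forall X,
    lu X ∘ (ev' X ⊠ idmor X) ∘ assi X (dual X) X ∘ (idmor X ⊠ coev' X) ∘ rui X
    = idmor X;
  zigzag'_dual : forall X,
    ru (dual X) ∘ (idmor (dual X) ⊠ ev' X) ∘ ass (dual X) X (dual X)
      ∘ (coev' X ⊠ idmor (dual X)) ∘ lui (dual X) = idmor (dual X);
  piv_map : forall X Y (f : mor X Y),
    lu (dual X) ∘ (ev Y ⊠ idmor (dual X)) ∘ assi (dual Y) Y (dual X)
      ∘ (idmor (dual Y) ⊠ (f ⊠ idmor (dual X)))
      ∘ (idmor (dual Y) ⊠ coev X) ∘ rui (dual Y)
    = ru (dual X) ∘ (idmor (dual X) ⊠ ev' Y)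
      ∘ (idmor (dual X) ⊠ (f ⊠ idmor (dual Y)))
      ∘ ass (dual X) X (dual Y) ∘ (coev' X ⊠ idmor (dual Y)) ∘ lui (dual Y);
  piv_tens : forall X Y, exists t : mor (dual Y ⊗ dual X) (dual (X ⊗ Y)),
    ev (X ⊗ Y) ∘ (t ⊠ idmor (X ⊗ Y))
    = ev Y ∘ (idmor (dual Y) ⊠ (lu Y ∘ (ev X ⊠ idmor Y) ∘ assi (dual X) X Y))
      ∘ ass (dual Y) (dual X) (X ⊗ Y)
    /\
    ev' (X ⊗ Y) ∘ (idmor (X ⊗ Y) ⊠ t)
    = ev' X ∘ ((ru X ∘ (idmor X ⊠ ev' Y) ∘ ass X Y (dual Y)) ⊠ idmor (dual X))
      ∘ assi (X ⊗ Y) (dual Y) (dual X);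
  piv_one : exists u : mor unit_ob (dual unit_ob),
    ev unit_ob ∘ (u ⊠ idmor unit_ob) = lu unit_ob /\
    ev' unit_ob ∘ (idmor unit_ob ⊠ u) = lu unit_ob
}.

Arguments dual {k p} X.
Arguments ev {k p} X.
Arguments coev {k p} X.
Arguments ev' {k p} X.
Arguments coev' {k p} X.

Definition is_spherical (k : fieldType) (C : pivotal_category k) : Prop :=
  forall (X : C) (f : mor X X),
    ev' X ∘ (f ⊠ idmor (dual X)) ∘ coev X = ev X ∘ (idmor (dual X) ⊠ f) ∘ coev' X.

(* Rigidity is part of the pivotal structure. *)
Record spherical_fusion_category (k : fieldType) := SphericalFusionCategory {
  sph_cat :> pivotal_category k;
  sph_spherical : is_spherical sph_cat;
  sph_abelian : is_abelian sph_cat;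
  sph_semisimple : is_semisimple sph_cat;
  sph_finite : finitely_many_simples sph_cat;
  sph_simple_one : simple_ob (unit_ob : sph_cat)
}.

(* The coordinate along the identity; it loses nothing when the unit object is
   simple and k is algebraically closed, since then End(1) = k id. *)
Definition scalar_of (k : fieldType) (C : monoidal_category k)
  (f : mor (unit_ob : C) unit_ob) : k :=
  coord [tuple idmor (unit_ob : C)] ord0 f.

Definition qdim (k : fieldType) (C : pivotal_category k) (X : C) : k :=
  scalar_of (ev' X ∘ coev X).

Section Center.
Variables (k : fieldType) (C : monoidal_category k).

Record is_half_braiding (Y : C) (phi : forall W, mor (Y ⊗ W) (W ⊗ Y)) : Prop :=
  IsHalfBraiding {
    hb_natural : forall W W' (f : mor W W'),
      phi W' ∘ (idmor Y ⊠ f) = (f ⊠ idmor Y) ∘ phi W;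
    hb_iso : forall W, is_iso (phi W);
    hb_tens : forall W W',
      phi (W ⊗ W') = assi W W' Y ∘ (idmor W ⊠ phi W') ∘ ass W Y W'
                     ∘ (phi W ⊠ idmor W') ∘ assi Y W W'
  }.

Record drinfeld_center := Center {
  cob : C;
  hbr : forall W, mor (cob ⊗ W) (W ⊗ cob);
  hbrP : is_half_braiding hbr
}.

Definition central (Y Y' : drinfeld_center) : {pred mor (cob Y) (cob Y')} :=
  fun f => `[< forall W, hbr Y' W ∘ (f ⊠ idmor W) = (idmor W ⊠ f) ∘ hbr Y W >].

Arguments central : clear implicits.

Lemma central_submod_closed (Y Y' : drinfeld_center) :
  submod_closed (central Y Y').
Proof.
have c0 (A B D : C) (g : mor B D) : g ∘ (0 : mor A B) = 0.
  by have := comp_linear_r (X := A) g (-1) 0 0;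
    rewrite scaleN1r oppr0 add0r scaleN1r addNr.
have c0l (A B D : C) (g : mor A B) : (0 : mor B D) ∘ g = 0.
  by have := comp_linear_l (Z := D) g (-1) 0 0;
    rewrite scaleN1r oppr0 add0r scaleN1r addNr.
have t0 (A A' B B' : C) (g : mor A A') : g ⊠ (0 : mor B B') = 0.
  by have := tensm_linear_r (Y := B) (Y' := B') g (-1) 0 0;
    rewrite scaleN1r oppr0 add0r scaleN1r addNr.
have t0l (A A' B B' : C) (g : mor A A') : (0 : mor B B') ⊠ g = 0.
  by have := tensm_linear_l (X := B) (X' := B') g (-1) 0 0;
    rewrite scaleN1r oppr0 add0r scaleN1r addNr.
split; first by apply/asboolP => W; rewrite t0 t0l c0 c0l.
move=> a f g /asboolP cf /asboolP cg; apply/asboolP => W.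
by rewrite tensm_linear_l tensm_linear_r comp_linear_r comp_linear_l cf cg.
Qed.

HB.instance Definition _ (Y Y' : drinfeld_center) :=
  GRing.isSubmodClosed.Build k (mor (cob Y) (cob Y')) (central Y Y')
    (@central_submod_closed Y Y').

Record center_hom (Y Y' : drinfeld_center) := CenterHom {
  chom :> mor (cob Y) (cob Y');
  chomP : chom \in central Y Y'
}.

HB.instance Definition _ (Y Y' : drinfeld_center) := [isSub for @chom Y Y'].
HB.instance Definition _ (Y Y' : drinfeld_center) :=
  [Choice of center_hom Y Y' by <:].
HB.instance Definition _ (Y Y' : drinfeld_center) :=
  [SubChoice_isSubLmodule of center_hom Y Y' by <:].

Lemma central_comp (Y Y' Y'' : drinfeld_center) (g : center_hom Y' Y'')
  (f : center_hom Y Y') : chom g ∘ chom f \in central Y Y''.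
Proof.
apply/asboolP => W; case: g f => [g /asboolP cg] [f /asboolP cf] /=.
have -> : (g ∘ f) ⊠ idmor W = (g ⊠ idmor W) ∘ (f ⊠ idmor W).
  by rewrite -tensm_comp comp1m.
have -> : idmor W ⊠ (g ∘ f) = (idmor W ⊠ g) ∘ (idmor W ⊠ f).
  by rewrite -tensm_comp comp1m.
by rewrite compA cg -compA cf compA.
Qed.

Definition center_comp (Y Y' Y'' : drinfeld_center) (g : center_hom Y' Y'')
  (f : center_hom Y Y') : center_hom Y Y'' := CenterHom (central_comp g f).

End Center.

Definition basis_of_space (k : fieldType) (V : vectType k) :=
  {b : (\dim (fullv : {vspace V})).-tuple V | basis_of fullv b}.

(* The vector [v'] with [beta v' b_j = (i == j)] for all [j]; it is unique
   when [beta] is a perfect pairing. *)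
Definition dual_vector (k : fieldType) (V V' : vectType k)
    (beta : V' -> V -> k) (b : basis_of_space V)
    (i : 'I_(\dim (fullv : {vspace V}))) : V' :=
  xget 0 [set v' : V' | forall j, beta v' (tnth (val b) j) = (i == j)%:R]%classic.

Section Grothendieck.
Variables (k : fieldType) (C : pivotal_category k).
Variables (Irr : finType) (S : Irr -> C).

Definition K0 := {ffun Irr -> k^o}.

Definition K0_class (X : Irr) : K0 := [ffun Z => (Z == X)%:R].

Definition fusion_coef (X Y Z : Irr) : nat :=
  \dim (fullv : {vspace mor (S X ⊗ S Y) (S Z)}).

Definition K0_mul (u v : K0) : K0 :=
  \sum_X \sum_Y (u X * v Y) *: \sum_Z (fusion_coef X Y Z)%:R *: K0_class Z.

Definition K0_conv (u v : K0) : K0 :=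
  \sum_X \sum_Y (u X * v Y) *:
    (if X == Y then (qdim (S X))^-1 *: K0_class X else 0).

End Grothendieck.

Section Induction.
Variables (k : fieldType) (C : pivotal_category k).
Variables (Irr : finType) (S : Irr -> C).
Variables (sq : Irr -> k).

(* [sq X] is the chosen square root of the dimension of [S X], and [I1] is the
   direct sum of the [S X ⊗ dual (S X)]. Sums over a basis of a Hom space paired
   with its dual basis take the basis as an argument; their value does not
   depend on it. Formulas usually written in a strict monoidal category carry
   explicit associators and unitors. *)

Definition XXdual (X : Irr) : C := S X ⊗ dual (S X).

Variables (I1 : C) (B : biproduct XXdual I1).

Definition hb_pairing (W : C) (Y Z : Irr)
    (j' : mor (dual (S Y) ⊗ W) (dual (S Z)))
    (i : mor (S Y) (W ⊗ S Z)) : k :=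
  scalar_of (ev (S Z) ∘ (j' ⊠ idmor (S Z)) ∘ assi (dual (S Y)) W (S Z)
             ∘ (idmor (dual (S Y)) ⊠ i) ∘ coev' (S Y)).

Definition hb_component (W : C) (Y Z : Irr)
    (b : basis_of_space (mor (S Y) (W ⊗ S Z))) :
    mor (XXdual Y ⊗ W) (W ⊗ XXdual Z) :=
  (sq Y * sq Z) *: \sum_i
    (ass W (S Z) (dual (S Z))
     ∘ (tnth (val b) i ⊠ dual_vector (@hb_pairing W Y Z) b i)
     ∘ ass (S Y) (dual (S Y)) W).

Definition I1_braiding
    (bas : forall (W : C) (Y Z : Irr), basis_of_space (mor (S Y) (W ⊗ S Z)))
    (W : C) : mor (I1 ⊗ W) (W ⊗ I1) :=
  \sum_Y \sum_Z
    ((idmor W ⊠ bp_inj B Z) ∘ hb_component (bas W Y Z)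
     ∘ (bp_proj B Y ⊠ idmor W)).

Definition I1_mul : mor (I1 ⊗ I1) I1 :=
  \sum_X (sq X)^-1 *:
    (bp_inj B X
     ∘ (idmor (S X) ⊠ (lu (dual (S X)) ∘ (ev (S X) ⊠ idmor (dual (S X)))
                      ∘ assi (dual (S X)) (S X) (dual (S X))))
     ∘ ass (S X) (dual (S X)) (XXdual X)
     ∘ (bp_proj B X ⊠ bp_proj B X)).

Definition I1_comul : mor I1 (I1 ⊗ I1) :=
  \sum_X (sq X)^-1 *:
    ((bp_inj B X ⊠ bp_inj B X)
     ∘ assi (S X) (dual (S X)) (XXdual X)
     ∘ (idmor (S X) ⊠ (ass (dual (S X)) (S X) (dual (S X))
                      ∘ (coev' (S X) ⊠ idmor (dual (S X))) ∘ lui (dual (S X))))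
     ∘ bp_proj B X).

Definition I1_conv (a b : mor I1 I1) : mor I1 I1 :=
  I1_mul ∘ (a ⊠ b) ∘ I1_comul.

Definition e_pairing (Y X Z : Irr)
    (j' : mor (S X) (S Z ⊗ S Y))
    (i : mor (S Y ⊗ dual (S X)) (dual (S Z))) : k :=
  scalar_of (ev' (S Z) ∘ (idmor (S Z) ⊠ i) ∘ ass (S Z) (S Y) (dual (S X))
             ∘ (j' ⊠ idmor (dual (S X))) ∘ coev (S X)).

Definition e_component (Y X Z : Irr)
    (b : basis_of_space (mor (S Y ⊗ dual (S X)) (dual (S Z)))) :
    mor (XXdual X) (XXdual Z) :=
  (qdim (S Y) * sq X * sq Z) *: \sum_i
    ((idmor (S Z) ⊠ tnth (val b) i) ∘ ass (S Z) (S Y) (dual (S X))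
     ∘ (dual_vector (@e_pairing Y X Z) b i ⊠ idmor (dual (S X)))).

Definition e_mor
    (bas : forall Y X Z : Irr,
       basis_of_space (mor (S Y ⊗ dual (S X)) (dual (S Z))))
    (Y : Irr) : mor I1 I1 :=
  \sum_X \sum_Z (bp_inj B Z ∘ e_component (bas Y X Z) ∘ bp_proj B X).

End Induction.

(* Main.v *)
From HB Require Import structures.
Require Import Defs.
From mathcomp Require Import all_boot all_order all_algebra.
From mathcomp Require Import reals.
From mathcomp Require Import boolp classical_sets ring.
Import Defs.

Set Implicit Arguments.
Unset Strict Implicit.
Unset Printing Implicit Defensive.

Import GRing.Theory.
Local Open Scope ring_scope.
Local Open Scope cat_scope.

(** Every morphism of the statement is a sum over dual bases, that is, the
    value of a bilinear expression on a canonical element. With respect to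
    the pairing of [Hom(X, A)] and [Hom(A, X)] by composition (for [X]
    simple), the component of [e_Y] from [X ⊗ dual X] to [Z ⊗ dual Z] is
    [qdim Y * sq Z / sq X] times the canonical element of
    [Hom(X, Z ⊗ Y)] and [Hom(Z ⊗ Y, X)], with the second factor bent into
    [Y ⊗ dual X -> dual Z]; the component of the half-braiding with [W] is
    [sq Z / sq Y] times the canonical element of [Hom(Y, W ⊗ Z)] and
    [Hom(W ⊗ Z, Y)], with the second factor bent into
    [dual Y ⊗ W -> dual Z] ([e_component_tail], [hb_component_tail]; the two
    pairings of the definitions are traces, so they differ from composition
    by a dimension). The ratios of square roots telescope along a composite.

    Canonical elements are natural and can be computed through an
    intermediate decomposition into simple objects ([csum_nat],
    [csum_decomp]). This gives the axioms of a half-braiding, the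
    invertibility coming from rigidity, and most of the rest. The formula for
    [e_Y] makes sense for any object [O] instead of [Y]; it defines
    [encircle O], which is multiplicative and additive in [O]. Hence composing
    [encircle Y] and [encircle Y'] gives [encircle (Y ⊗ Y')], the sum of the
    [encircle Z] with the fusion coefficients as multiplicities
    ([encircle_comp], [encircle_decomp]). That [encircle O] is a morphism of
    the center compares two ways of factoring through
    [W ⊗ (Z ⊗ O)] ([hb_entry_e_entry]); on each side one vertex has to be
    turned around once, which is possible by pivotality ([Ldual_Rdual]).

    In the convolution product of [e_Y] and [e_Y'] the middle of the diagram
    is a partial trace [Y -> Y']. By Schur's lemma it is zero or a scalar, and
    the scalar is found by closing the diagram and moving one vertex around
    the closed strand ([ptrace_scalar], [trace_cyclic]). The result is that
    the [e_Y] are orthogonal idempotents for the convolution; as they are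
    nonzero, they are independent ([e_conv], [e_free]).

    They span because a morphism [f] of the center is determined by its
    composite with [1 -> 1 ⊗ dual 1 -> I(1)]: the half-braiding with [dual X]
    moves the summand of the unit onto the summand of [X]
    ([central_determined]). As [Hom(1, I(1))] has one coordinate for each
    simple object, there are injective linear maps from [K0] to the
    endomorphisms of [I(1)] and back to [K0], which are therefore bijective.

    Associators are avoided by working with tails. Instead of [f] one uses the
    family of all [f ▷ A], rewritten between objects that are nested to the
    right, such as [X ⊗ (Y ⊗ A)]. Placing morphisms side by side then means
    applying them at different depths, and the only coherence that remains is
    naturality in the tail [A]. *)

(** * Linear maps and linear categories *)

Section LinearMaps.
Variables (k : fieldType) (U V : lmodType k) (f : U -> V).
Hypothesis fl : linear f.

Lemma linear_map0 : f 0 = 0.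
Proof. by have := fl (-1) 0 0; rewrite scaleN1r oppr0 add0r scaleN1r addNr. Qed.

Lemma linear_mapZ a u : f (a *: u) = a *: f u.
Proof. by have := fl a u 0; rewrite linear_map0 !addr0. Qed.

Lemma linear_mapD u v : f (u + v) = f u + f v.
Proof. by have := fl 1 u v; rewrite !scale1r. Qed.

Lemma linear_map_sum (I : finType) (P : pred I) (u : I -> U) :
  f (\sum_(i | P i) u i) = \sum_(i | P i) f (u i).
Proof.
apply: (big_morph f) => [v w|]; last exact: linear_map0.
exact: linear_mapD.
Qed.

End LinearMaps.

Local Notation "X ◁ f" := (idmor X ⊠ f)
  (at level 34, right associativity) : cat_scope.
Local Notation "f ▷ X" := (f ⊠ idmor X)
  (at level 33, left associativity) : cat_scope.

Section LinearComposition.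
Variables (k : fieldType) (C : linear_category k).
Implicit Types X Y Z : C.

Lemma compm0 X Y Z (g : mor Y Z) : g ∘ (0 : mor X Y) = 0.
Proof. exact: linear_map0 (comp_linear_r g). Qed.

Lemma comp0m X Y Z (f : mor X Y) : (0 : mor Y Z) ∘ f = 0.
Proof. exact: linear_map0 (comp_linear_l f). Qed.

Lemma compmD X Y Z (g : mor Y Z) (f f' : mor X Y) :
  g ∘ (f + f') = g ∘ f + g ∘ f'.
Proof. exact: linear_mapD (comp_linear_r g) f f'. Qed.

Lemma compDm X Y Z (g g' : mor Y Z) (f : mor X Y) :
  (g + g') ∘ f = g ∘ f + g' ∘ f.
Proof. exact: linear_mapD (comp_linear_l f) g g'. Qed.

Lemma compmZ X Y Z (g : mor Y Z) a (f : mor X Y) : g ∘ (a *: f) = a *: (g ∘ f).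
Proof. exact: linear_mapZ (comp_linear_r g) a f. Qed.

Lemma compZm X Y Z a (g : mor Y Z) (f : mor X Y) : (a *: g) ∘ f = a *: (g ∘ f).
Proof. exact: linear_mapZ (comp_linear_l f) a g. Qed.

Lemma compmB X Y Z (g : mor Y Z) (f f' : mor X Y) :
  g ∘ (f - f') = g ∘ f - g ∘ f'.
Proof. by rewrite -scaleN1r compmD compmZ scaleN1r. Qed.

Lemma compBm X Y Z (g g' : mor Y Z) (f : mor X Y) :
  (g - g') ∘ f = g ∘ f - g' ∘ f.
Proof. by rewrite -scaleN1r compDm compZm scaleN1r. Qed.

Lemma comp_suml X Y Z (I : finType) (P : pred I) (g : I -> mor Y Z)
  (f : mor X Y) : (\sum_(i | P i) g i) ∘ f = \sum_(i | P i) (g i ∘ f).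
Proof. exact: (linear_map_sum (comp_linear_l f)). Qed.

Lemma comp_sumr X Y Z (I : finType) (P : pred I) (f : I -> mor X Y)
  (g : mor Y Z) : g ∘ (\sum_(i | P i) f i) = \sum_(i | P i) (g ∘ f i).
Proof. exact: (linear_map_sum (comp_linear_r g)). Qed.

(** Composites are kept nested to the right, so that an equation between
    binary composites has to be applied in front of a remaining factor. *)
Lemma comp2_rev X Y Y' Z (a : mor Y Z) (b : mor X Y) (c : mor Y' Z)
  (d : mor X Y') : a ∘ b = c ∘ d ->
  forall W (h : mor W X), a ∘ (b ∘ h) = c ∘ (d ∘ h).
Proof. by move=> e W h; rewrite !compA e. Qed.

Lemma comp2_cancel X Y Z (a : mor Y Z) (b : mor X Y) (c : mor X Z) :
  a ∘ b = c -> forall W (h : mor W X), a ∘ (b ∘ h) = c ∘ h.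
Proof. by move=> e W h; rewrite !compA e. Qed.

Lemma comp2_id X Y (a : mor Y X) (b : mor X Y) :
  a ∘ b = idmor X -> forall W (h : mor W X), a ∘ (b ∘ h) = h.
Proof. by move=> e W h; rewrite !compA e comp1m. Qed.

Lemma split_epi_cancel X Y Z (a : mor X Y) (b : mor Y X) (f g : mor Y Z) :
  a ∘ b = idmor Y -> f ∘ a = g ∘ a -> f = g.
Proof. by move=> e E; rewrite -[f]compm1 -[g]compm1 -e !compA E. Qed.

Lemma split_mono_cancel X Y Z (a : mor X Y) (b : mor Y X) (f g : mor Z X) :
  b ∘ a = idmor X -> a ∘ f = a ∘ g -> f = g.
Proof. by move=> e E; rewrite -[f]comp1m -[g]comp1m -e -!compA E. Qed.

End LinearComposition.

(** * Coherence in monoidal categories *)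

Section Tails.
Variables (k : fieldType) (C : monoidal_category k).
Implicit Types (A B P Q R W X Y Z : C).

Lemma tens0m A A' B B' (g : mor B B') : (0 : mor A A') ⊠ g = 0.
Proof. exact: linear_map0 (tensm_linear_l g). Qed.

Lemma tensm0 A A' B B' (g : mor A A') : g ⊠ (0 : mor B B') = 0.
Proof. exact: linear_map0 (tensm_linear_r g). Qed.

Lemma tensmZ A A' B B' (g : mor A A') a (f : mor B B') :
  g ⊠ (a *: f) = a *: (g ⊠ f).
Proof. exact: linear_mapZ (tensm_linear_r g) a f. Qed.

Lemma tensZm A A' B B' a (g : mor A A') (f : mor B B') :
  (a *: g) ⊠ f = a *: (g ⊠ f).
Proof. exact: linear_mapZ (tensm_linear_l f) a g. Qed.

Lemma tens_suml A A' B B' (I : finType) (P : pred I) (g : I -> mor A A')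
  (f : mor B B') : (\sum_(i | P i) g i) ⊠ f = \sum_(i | P i) (g i ⊠ f).
Proof. exact: (linear_map_sum (tensm_linear_l f)). Qed.

Lemma tens_sumr A A' B B' (I : finType) (P : pred I) (f : I -> mor B B')
  (g : mor A A') : g ⊠ (\sum_(i | P i) f i) = \sum_(i | P i) (g ⊠ f i).
Proof. exact: (linear_map_sum (tensm_linear_r g)). Qed.

Lemma whiskl_comp X A B D (g : mor B D) (f : mor A B) :
  X ◁ (g ∘ f) = (X ◁ g) ∘ (X ◁ f).
Proof. by rewrite -tensm_comp comp1m. Qed.

Lemma whiskr_comp X A B D (g : mor B D) (f : mor A B) :
  (g ∘ f) ▷ X = (g ▷ X) ∘ (f ▷ X).
Proof. by rewrite -tensm_comp comp1m. Qed.

Lemma whisk_exchange A A' B B' (f : mor A A') (g : mor B B') :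
  (f ▷ B') ∘ (A ◁ g) = (A' ◁ g) ∘ (f ▷ B).
Proof. by rewrite -!tensm_comp !(comp1m, compm1). Qed.

Lemma tensm_lr A A' B B' (f : mor A A') (g : mor B B') :
  f ⊠ g = (A' ◁ g) ∘ (f ▷ B).
Proof. by rewrite -tensm_comp !(comp1m, compm1). Qed.

Lemma ass_epi X Y Z A (f g : mor (X ⊗ (Y ⊗ Z)) A) :
  f ∘ ass X Y Z = g ∘ ass X Y Z -> f = g.
Proof.
by move=> e; rewrite -[f]compm1 -[g]compm1 -assiK !compA e.
Qed.

Lemma assi_nat X X' Y Y' Z Z' (f : mor X X') (g : mor Y Y') (h : mor Z Z') :
  assi X' Y' Z' ∘ (f ⊠ (g ⊠ h)) = ((f ⊠ g) ⊠ h) ∘ assi X Y Z.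
Proof.
apply: ass_epi; rewrite -!compA -ass_nat assK compm1.
by rewrite compA assK comp1m.
Qed.

Lemma whisk_unit_inj X Y (f g : mor X Y) :
  unit_ob ◁ f = unit_ob ◁ g -> f = g.
Proof.
move=> e; rewrite -[f]compm1 -[g]compm1 -luiK !compA -!lu_nat.
by rewrite e.
Qed.

Lemma whiskr_unit_inj X Y (f g : mor X Y) :
  f ▷ unit_ob = g ▷ unit_ob -> f = g.
Proof.
move=> e; rewrite -[f]compm1 -[g]compm1 -ruiK !compA -!ru_nat.
by rewrite e.
Qed.

Lemma is_iso_whiskr_unit X Y (f : mor X Y) : is_iso (f ▷ unit_ob) -> is_iso f.
Proof.
move=> [g [gf fg]].
have rui_nat : (f ▷ unit_ob) ∘ rui X = rui Y ∘ f.
  apply: (split_mono_cancel (ruK Y)).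
  by rewrite !compA ru_nat -compA !ruiK comp1m compm1.
exists (ru _ ∘ (g ∘ rui _)); split.
  by rewrite -!compA -rui_nat (comp2_id gf) ruiK.
by rewrite compA -ru_nat -compA (comp2_id fg) ruiK.
Qed.

(** Kelly's consequence of the pentagon and triangle axioms, obtained by
    comparing both sides after tensoring with the unit on the left. *)
Lemma lu_tens X Y : lu (X ⊗ Y) ∘ ass unit_ob X Y = lu X ▷ Y.
Proof.
apply: whisk_unit_inj; set I := unit_ob.
have K : (ass I (I ⊗ X) Y ∘ (ass I I X ▷ Y))
    ∘ ((assi I I X ▷ Y) ∘ assi I (I ⊗ X) Y) = idmor _.
  rewrite -compA (comp2_id (b := assi I I X ▷ Y)) ?assiK //.
  by rewrite -whiskr_comp assiK tensm1.
apply: (split_epi_cancel K); rewrite -/I.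
rewrite whiskl_comp -!compA.
have -> : (I ◁ ass I X Y) ∘ (ass I (I ⊗ X) Y ∘ (ass I I X ▷ Y))
   = ass I I (X ⊗ Y) ∘ ass (I ⊗ I) X Y by rewrite pentagon !compA.
rewrite compA triangle -tensm1 -ass_nat.
rewrite (comp2_rev (esym (ass_nat _ _ _))); congr (_ ∘ _).
by rewrite -whiskr_comp triangle.
Qed.

Lemma lui_tens X Y : assi unit_ob X Y ∘ lui (X ⊗ Y) = lui X ▷ Y.
Proof.
have E : assi unit_ob X Y ∘ lui (X ⊗ Y) ∘ (lu X ▷ Y) = idmor _.
  rewrite -lu_tens -!compA (comp2_id (luK _)) //.
  by rewrite assK.
by rewrite -[LHS]compm1 -tensm1 -(luiK X) whiskr_comp compA E comp1m.
Qed.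

Lemma triangle_i X Y : ass X unit_ob Y ∘ (rui X ▷ Y) = X ◁ lui Y.
Proof.
have E : (X ◁ lu Y) ∘ (ass X unit_ob Y ∘ (rui X ▷ Y)) = idmor _.
  by rewrite compA triangle -whiskr_comp ruiK tensm1.
rewrite -[LHS]comp1m -tensm1 -(luK Y) whiskl_comp -!compA E.
by rewrite compm1.
Qed.

Lemma pentagon_ass W X Y Z :
  (W ◁ ass X Y Z) ∘ (ass W (X ⊗ Y) Z ∘ (ass W X Y ▷ Z)) =
  ass W X (Y ⊗ Z) ∘ ass (W ⊗ X) Y Z.
Proof. by rewrite pentagon !compA. Qed.

Lemma pentagon_assi W X Y Z :
  assi W X (Y ⊗ Z) ∘ ((W ◁ ass X Y Z) ∘ ass W (X ⊗ Y) Z) =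
  ass (W ⊗ X) Y Z ∘ (assi W X Y ▷ Z).
Proof.
have := pentagon_ass W X Y Z.
move=> /(congr1 (fun f => f ∘ (assi W X Y ▷ Z))).
rewrite -!compA -whiskr_comp assiK tensm1 compm1 => ->.
by rewrite compA assK comp1m.
Qed.

End Tails.

Section Whisker.
Variables (k : fieldType) (C : monoidal_category k).
Implicit Types (A B D X Y : C).

Lemma whisk_sq X A B B' D (a : mor B D) (b : mor A B) (c : mor B' D)
    (d : mor A B') :
  a ∘ b = c ∘ d -> (X ◁ a) ∘ (X ◁ b) = (X ◁ c) ∘ (X ◁ d).
Proof. by move=> e; rewrite -!whiskl_comp e. Qed.

Lemma whisk_tri X A B D (a : mor B D) (b : mor A B) (c : mor A D) :
  a ∘ b = c -> (X ◁ a) ∘ (X ◁ b) = X ◁ c.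
Proof. by move=> e; rewrite -!whiskl_comp e. Qed.

Lemma whisk_id X A B (a : mor B A) (b : mor A B) :
  a ∘ b = idmor A -> (X ◁ a) ∘ (X ◁ b) = idmor _.
Proof. by move=> e; rewrite -!whiskl_comp e tensm1. Qed.
End Whisker.

Arguments whisk_sq {k C X A B B' D a b c d}.
Arguments whisk_tri {k C X A B D a b c}.
Arguments whisk_id {k C X A B a b}.

(** * Morphisms with a tail *)

Section TailGenerators.
Variables (k : fieldType) (C : monoidal_category k).
Implicit Types (A B P Q R W X Y Z : C).

(** The families below are locked: reassociating a composite must not split
    them into the composites that define them. *)
Fact tail_key : unit. Proof. by []. Qed.

Definition splitt Y W Z (u : mor Y (W ⊗ Z)) A : mor (Y ⊗ A) (W ⊗ (Z ⊗ A)) :=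
  locked_with tail_key (ass W Z A ∘ (u ▷ A)).

Definition merget P Q R (p : mor (P ⊗ Q) R) A : mor (P ⊗ (Q ⊗ A)) (R ⊗ A) :=
  locked_with tail_key ((p ▷ A) ∘ assi P Q A).

Definition cupt P Q (p : mor (P ⊗ Q) unit_ob) A : mor (P ⊗ (Q ⊗ A)) A :=
  locked_with tail_key (lu A ∘ ((p ▷ A) ∘ assi P Q A)).

Definition capt P Q (c : mor unit_ob (P ⊗ Q)) A : mor A (P ⊗ (Q ⊗ A)) :=
  locked_with tail_key (ass P Q A ∘ ((c ▷ A) ∘ lui A)).

Lemma splittE Y W Z (u : mor Y (W ⊗ Z)) A : splitt u A = ass W Z A ∘ (u ▷ A).
Proof. by rewrite /splitt unlock. Qed.

Lemma mergetE P Q R (p : mor (P ⊗ Q) R) A : merget p A = (p ▷ A) ∘ assi P Q A.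
Proof. by rewrite /merget unlock. Qed.

Lemma cuptE P Q (p : mor (P ⊗ Q) unit_ob) A :
  cupt p A = lu A ∘ ((p ▷ A) ∘ assi P Q A).
Proof. by rewrite /cupt unlock. Qed.

Lemma captE P Q (c : mor unit_ob (P ⊗ Q)) A :
  capt c A = ass P Q A ∘ ((c ▷ A) ∘ lui A).
Proof. by rewrite /capt unlock. Qed.

Lemma lui_nat X X' (f : mor X X') : lui X' ∘ f = (unit_ob ◁ f) ∘ lui X.
Proof.
apply: (split_mono_cancel (luK X')).
rewrite (compA (lu X')) luiK comp1m.
by rewrite (comp2_rev (lu_nat f)) luiK compm1.
Qed.

Lemma splitt_nat Y W Z (u : mor Y (W ⊗ Z)) A B (h : mor A B) :
  (W ◁ (Z ◁ h)) ∘ splitt u A = splitt u B ∘ (Y ◁ h).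
Proof.
rewrite !splittE compA -ass_nat tensm1 -!compA; congr (_ ∘ _).
by rewrite whisk_exchange.
Qed.

Lemma merget_nat P Q R (p : mor (P ⊗ Q) R) A B (h : mor A B) :
  merget p B ∘ (P ◁ (Q ◁ h)) = (R ◁ h) ∘ merget p A.
Proof. by rewrite !mergetE -!compA assi_nat tensm1 !compA whisk_exchange. Qed.

Lemma cup_nat P Q (p : mor (P ⊗ Q) unit_ob) A B (h : mor A B) :
  cupt p B ∘ (P ◁ (Q ◁ h)) = h ∘ cupt p A.
Proof.
rewrite !cuptE -!compA assi_nat tensm1 (comp2_rev (whisk_exchange _ _)).
by rewrite (comp2_rev (lu_nat h)).
Qed.

Lemma cap_nat P Q (c : mor unit_ob (P ⊗ Q)) A B (h : mor A B) :
  (P ◁ (Q ◁ h)) ∘ capt c A = capt c B ∘ h.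
Proof.
rewrite !captE -!compA lui_nat compA -ass_nat tensm1 -!compA; congr (_ ∘ _).
by rewrite !compA whisk_exchange.
Qed.

Lemma cup_strength P Q (p : mor (P ⊗ Q) unit_ob) A B :
  cupt p (A ⊗ B) ∘ ((P ◁ ass Q A B) ∘ ass P (Q ⊗ A) B) = cupt p A ▷ B.
Proof.
rewrite !cuptE -!compA pentagon_assi !whiskr_comp.
rewrite -tensm1 (comp2_rev (esym (ass_nat _ _ _))).
by rewrite compA lu_tens.
Qed.

Lemma cap_strength P Q (c : mor unit_ob (P ⊗ Q)) A B :
  capt c (A ⊗ B) = (P ◁ ass Q A B) ∘ (ass P (Q ⊗ A) B ∘ (capt c A ▷ B)).
Proof.
rewrite !captE !whiskr_comp -lui_tens.
rewrite (compA (ass P (Q ⊗ A) B)) (compA (P ◁ _)) pentagon_ass -!compA.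
rewrite (comp2_rev (ass_nat _ _ _)) tensm1; congr (_ ∘ (_ ∘ _)).
by rewrite compA assiK comp1m.
Qed.

Lemma merget_strength P Q R (p : mor (P ⊗ Q) R) A B :
  merget p (A ⊗ B) ∘ ((P ◁ ass Q A B) ∘ ass P (Q ⊗ A) B)
  = ass R A B ∘ (merget p A ▷ B).
Proof.
rewrite !mergetE -!compA pentagon_assi whiskr_comp.
by rewrite -tensm1 (comp2_rev (esym (ass_nat _ _ _))).
Qed.

Lemma splitt_strength Y W Z (u : mor Y (W ⊗ Z)) A B :
  splitt u (A ⊗ B) ∘ ass Y A B
  = (W ◁ ass Z A B) ∘ (ass W (Z ⊗ A) B ∘ (splitt u A ▷ B)).
Proof.
rewrite !splittE whiskr_comp -!compA -tensm1 -ass_nat.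
by rewrite (compA (ass W (Z ⊗ A) B)) (compA (W ◁ _)) pentagon_ass !compA.
Qed.

(** After [cap_strength] the left side is the zigzag tensored with [A] on the
    right. *)
Lemma zigzag_tail_l P Q (c : mor unit_ob (P ⊗ Q)) (p : mor (Q ⊗ P) unit_ob) :
  ru P ∘ (P ◁ p) ∘ ass P Q P ∘ (c ▷ P) ∘ lui P = idmor P ->
  forall A, (P ◁ cupt p A) ∘ capt c (P ⊗ A) = idmor (P ⊗ A).
Proof.
move=> e A; rewrite cap_strength !cuptE !whiskl_comp -!compA.
rewrite (comp2_cancel (whisk_tri (assK _ _ _))) tensm1 comp1m.
rewrite (comp2_rev (esym (ass_nat _ _ _))) (comp2_cancel (triangle _ _)).
by rewrite -!whiskr_comp !captE !compA e tensm1.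
Qed.

Lemma zigzag_tail_r P Q (c : mor unit_ob (P ⊗ Q)) (p : mor (Q ⊗ P) unit_ob) :
  lu Q ∘ (p ▷ Q) ∘ assi Q P Q ∘ (Q ◁ c) ∘ rui Q = idmor Q ->
  forall A, cupt p (Q ⊗ A) ∘ (Q ◁ capt c A) = idmor (Q ⊗ A).
Proof.
move=> e A.
rewrite !captE !whiskl_comp -triangle_i.
rewrite (comp2_rev (esym (ass_nat _ _ _))).
rewrite (compA (Q ◁ _)) (compA (cupt _ _)) cup_strength.
by rewrite -!whiskr_comp !cuptE !compA e tensm1.
Qed.

Lemma cup_cap P Q (c : mor unit_ob (P ⊗ Q)) (p : mor (P ⊗ Q) unit_ob) a :
  p ∘ c = a *: idmor unit_ob -> forall A, cupt p A ∘ capt c A = a *: idmor A.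
Proof.
move=> e A; rewrite !cuptE !captE -!compA (comp2_id (assK _ _ _)).
rewrite (compA (p ▷ A)) -whiskr_comp e tensZm tensm1 compZm compmZ comp1m.
by rewrite luiK.
Qed.

(** ** Families that come from morphisms *)

Fixpoint act (l : seq C) A : C := if l is X :: l' then X ⊗ act l' A else A.

Fixpoint amap l A A' (h : mor A A') : mor (act l A) (act l A') :=
  if l is X :: l' then X ◁ amap l' h else h.

Fixpoint strength l A B : mor (act l A ⊗ B) (act l (A ⊗ B)) :=
  if l is X :: l' then (X ◁ strength l' A B) ∘ ass X (act l' A) B
  else idmor _.

(** A natural transformation between the functors [A |-> X1 ⊗ (X2 ⊗ (.. ⊗
    A))] need not come from a morphism between tensor products. It does when
    it commutes with tensoring on the right, and this condition, unlike an
    explicit formula with associators, is inherited by composites of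
    diagrams. *)
Definition strong l l' (t : forall A, mor (act l A) (act l' A)) : Prop :=
  (forall A A' (h : mor A A'), t A' ∘ amap l h = amap l' h ∘ t A) /\
  (forall A B, t (A ⊗ B) ∘ strength l A B = strength l' A B ∘ (t A ▷ B)).

Lemma strong_ext l l' (t s : forall A, mor (act l A) (act l' A)) :
  (forall A, t A = s A) -> strong s -> strong t.
Proof. by move=> e [sn ss]; split=> *; rewrite !e. Qed.

Lemma strong_comp l l' l'' (t : forall A, mor (act l' A) (act l'' A))
    (s : forall A, mor (act l A) (act l' A)) :
  strong t -> strong s -> strong (fun A => t A ∘ s A).
Proof.
move=> [tn ts] [sn ss]; split=> [A A' h|A B].
  by rewrite -compA sn !compA tn.
by rewrite whiskr_comp -compA ss !compA ts.
Qed.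

Lemma strong_whisk X l l' (t : forall A, mor (act l A) (act l' A)) :
  strong t -> @strong (X :: l) (X :: l') (fun A => X ◁ t A).
Proof.
move=> [tn ts]; split=> [A A' h|A B] /=.
  by rewrite -!whiskl_comp tn.
by rewrite !compA -whiskl_comp ts whiskl_comp -!compA -ass_nat.
Qed.

Lemma strong_cup P Q (p : mor (P ⊗ Q) unit_ob) m :
  @strong (P :: Q :: m) m (fun A => cupt p (act m A)).
Proof.
split=> [A A' h|A B] /=; first exact: cup_nat.
rewrite whiskl_comp -!compA (comp2_rev (cup_nat _ _)).
by rewrite cup_strength.
Qed.

Lemma strong_cap P Q (c : mor unit_ob (P ⊗ Q)) m :
  @strong m (P :: Q :: m) (fun A => capt c (act m A)).
Proof.
split=> [A A' h|A B] /=; first by rewrite cap_nat.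
by rewrite -cap_nat cap_strength whiskl_comp -!compA.
Qed.

Lemma strong_merget P Q R (p : mor (P ⊗ Q) R) m :
  @strong (P :: Q :: m) (R :: m) (fun A => merget p (act m A)).
Proof.
split=> [A A' h|A B] /=; first exact: merget_nat.
rewrite whiskl_comp -!compA (comp2_rev (merget_nat _ _)).
by rewrite merget_strength.
Qed.

Lemma strong_splitt Y W Z (u : mor Y (W ⊗ Z)) m :
  @strong (Y :: m) (W :: Z :: m) (fun A => splitt u (act m A)).
Proof.
split=> [A A' h|A B] /=; first by rewrite splitt_nat.
rewrite compA -splitt_nat -!compA splitt_strength whiskl_comp -!compA.
by rewrite (compA (W ◁ _)).
Qed.

Lemma strong_whiskr X Y (f : mor X Y) m :
  @strong (X :: m) (Y :: m) (fun A => f ▷ act m A).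
Proof.
split=> [A A' h|A B] /=; first exact: whisk_exchange.
rewrite compA whisk_exchange -!compA; congr (_ ∘ _).
by rewrite ass_nat tensm1.
Qed.

(** The inverse of [f |-> f ▷ A] on strong families: evaluation at the unit. *)
Definition of_tail X Y (t : mor (X ⊗ unit_ob) (Y ⊗ unit_ob)) : mor X Y :=
  locked_with tail_key (ru Y ∘ (t ∘ rui X)).

Definition of_tail2 P Q R (t : mor (P ⊗ (Q ⊗ unit_ob)) (R ⊗ unit_ob)) :
  mor (P ⊗ Q) R := locked_with tail_key (ru R ∘ (t ∘ (P ◁ rui Q))).

Lemma of_tailE X Y (t : forall A, mor (X ⊗ A) (Y ⊗ A)) :
  @strong [:: X] [:: Y] t -> forall A, of_tail (t unit_ob) ▷ A = t A.
Proof.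
move=> [tn ts] A; rewrite /of_tail unlock !whiskr_comp -triangle -!compA.
have /= E := ts unit_ob A; rewrite !tensm1 !comp1m in E.
rewrite (comp2_rev (esym E)) triangle_i.
have /= N := tn _ _ (lu A).
by rewrite (comp2_rev (esym N)) -whiskl_comp luiK tensm1 compm1.
Qed.

Lemma of_tail2E P Q R (t : forall A, mor (P ⊗ (Q ⊗ A)) (R ⊗ A)) :
  @strong [:: P; Q] [:: R] t -> forall A, merget (of_tail2 (t unit_ob)) A = t A.
Proof.
move=> [tn ts] A; rewrite !mergetE /of_tail2 unlock !whiskr_comp -triangle
  -!compA.
have /= E := ts unit_ob A; rewrite !tensm1 !comp1m in E.
rewrite (comp2_rev (esym E)).
have /= N := tn _ _ (lu A).
rewrite -!compA (comp2_rev (ass_nat _ _ _)) assiK compm1.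
by rewrite (comp2_rev (esym N)) -!whiskl_comp triangle_i -!whiskl_comp
  luiK !tensm1 compm1.
Qed.

Lemma merget_inj P Q R (p q : mor (P ⊗ Q) R) :
  merget p unit_ob = merget q unit_ob -> p = q.
Proof.
rewrite !mergetE => e; apply: whiskr_unit_inj.
exact: (split_epi_cancel (assK _ _ _) e).
Qed.

End TailGenerators.

(* Composites are nested to the right and get a last factor [idmor _], so that
   equations in the form of [comp2_rev] apply at every place. *)
Ltac nest := rewrite -[LHS]compm1 -[RHS]compm1 -?compA.

(** * Bending legs with duals *)

Local Notation evt X := (cupt (ev X)).
Local Notation coevt X := (capt (coev X)).
Local Notation evr X := (cupt (ev' X)).
Local Notation coevr X := (capt (coev' X)).

Section Rotations.
Variables (k : fieldType) (C : pivotal_category k).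
Implicit Types (A B P Q R W X Y Z : C).

Lemma snake_l X A : (X ◁ evt X A) ∘ coevt X (X ⊗ A) = idmor _.
Proof. exact: zigzag_tail_l (zigzag X) A. Qed.

Lemma snake_l_dual X A : evt X (dual X ⊗ A) ∘ (dual X ◁ coevt X A) = idmor _.
Proof. exact: zigzag_tail_r (zigzag_dual X) A. Qed.

Lemma snake_r X A : evr X (X ⊗ A) ∘ (X ◁ coevr X A) = idmor _.
Proof. exact: zigzag_tail_r (zigzag' X) A. Qed.

Lemma snake_r_dual X A : (dual X ◁ evr X A) ∘ coevr X (dual X ⊗ A) = idmor _.
Proof. exact: zigzag_tail_l (zigzag'_dual X) A. Qed.

(** The vertex [g : Z ⊗ Y -> X], with the input [Z] turned into an output on
    the left by [coev'] and the output [X] turned into an input on the right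
    by [ev']. *)
Definition bendr Z Y X (g : mor (Z ⊗ Y) X) A :
    mor (Y ⊗ (dual X ⊗ A)) (dual Z ⊗ A) :=
  locked_with tail_key
    ((dual Z ◁ evr X A) ∘ ((dual Z ◁ merget g (dual X ⊗ A)) ∘ coevr Z _)).

(** The vertex [g : W ⊗ Z -> Y], with the input [Z] turned into an output on
    the right by [coev] and the output [Y] turned into an input on the left
    by [ev]. *)
Definition bendl W Z Y (g : mor (W ⊗ Z) Y) A :
    mor (dual Y ⊗ (W ⊗ A)) (dual Z ⊗ A) :=
  locked_with tail_key
    (evt Y _ ∘ ((dual Y ◁ merget g (dual Z ⊗ A)) ∘ (dual Y ◁ (W ◁ coevt Z A)))).

Lemma bendrE Z Y X (g : mor (Z ⊗ Y) X) A :
  bendr g A = (dual Z ◁ evr X A) ∘ ((dual Z ◁ merget g (dual X ⊗ A)) ∘ coevr Z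
    _).
Proof. by rewrite /bendr unlock. Qed.

Lemma bendlE W Z Y (g : mor (W ⊗ Z) Y) A :
  bendl g A =
  evt Y _ ∘ ((dual Y ◁ merget g (dual Z ⊗ A)) ∘ (dual Y ◁ (W ◁ coevt Z A))).
Proof. by rewrite /bendl unlock. Qed.

Lemma bendr_strong Z Y X (g : mor (Z ⊗ Y) X) m :
  @strong k C (Y :: dual X :: m) (dual Z :: m) (fun A => bendr g (act m A)).
Proof.
apply: strong_ext => [A|]; first exact: bendrE.
apply: (@strong_comp k C _ [:: dual Z, X, dual X & m]).
  exact/(@strong_whisk _ _ (dual Z) [:: X, dual X & m])/strong_cup.
apply: (@strong_comp k C _ [:: dual Z, Z, Y, dual X & m]).
  exact/(@strong_whisk _ _ (dual Z) [:: Z, Y, dual X & m])/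
    (strong_merget g (dual X :: m)).
exact: (strong_cap _ (Y :: dual X :: m)).
Qed.

Lemma bendl_strong W Z Y (g : mor (W ⊗ Z) Y) m :
  @strong k C (dual Y :: W :: m) (dual Z :: m) (fun A => bendl g (act m A)).
Proof.
apply: strong_ext => [A|]; first exact: bendlE.
apply: (@strong_comp k C _ [:: dual Y, Y, dual Z & m]).
  exact: (strong_cup _ (dual Z :: m)).
apply: (@strong_comp k C _ [:: dual Y, W, Z, dual Z & m]).
  exact/(@strong_whisk _ _ (dual Y) [:: W, Z, dual Z & m])/
    (strong_merget g (dual Z :: m)).
apply: (@strong_whisk _ _ (dual Y) (W :: m) [:: W, Z, dual Z & m]).
apply: (@strong_whisk _ _ W m [:: Z, dual Z & m]).
exact: strong_cap.
Qed.

Lemma bendr_nat Z Y X (g : mor (Z ⊗ Y) X) A B (h : mor A B) :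
  bendr g B ∘ (Y ◁ (dual X ◁ h)) = (dual Z ◁ h) ∘ bendr g A.
Proof. by have [n _] := bendr_strong g [::]; exact: n. Qed.

Lemma bendl_nat W Z Y (g : mor (W ⊗ Z) Y) A B (h : mor A B) :
  bendl g B ∘ (dual Y ◁ (W ◁ h)) = (dual Z ◁ h) ∘ bendl g A.
Proof. by have [n _] := bendl_strong g [::]; exact: n. Qed.

(** The bent leg [Z] is straightened again by the zigzag of [Z]. *)
Lemma bendr_ev Z Y X (g : mor (Z ⊗ Y) X) A :
  evr Z A ∘ (Z ◁ bendr g A) = evr X A ∘ merget g (dual X ⊗ A).
Proof.
rewrite bendrE !whiskl_comp; nest.
by rewrite !(comp2_rev (cup_nat _ _)) (comp2_id (snake_r _ _)).
Qed.

Lemma bendr_coev Z Y X (g : mor (Z ⊗ Y) X) A :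
  bendr g (X ⊗ A) ∘ (Y ◁ coevr X A) = (dual Z ◁ merget g A) ∘ coevr Z (Y ⊗ A).
Proof.
rewrite bendrE -!compA -cap_nat.
nest; rewrite (comp2_rev (whisk_sq (merget_nat _ _))).
by rewrite (comp2_id (whisk_id (snake_r _ _))).
Qed.

Lemma bendl_ev W Z Y (g : mor (W ⊗ Z) Y) A :
  evt Z A ∘ bendl g (Z ⊗ A) = evt Y A ∘ (dual Y ◁ merget g A).
Proof.
rewrite bendlE; nest; rewrite -(comp2_rev (cup_nat _ _)).
rewrite -(comp2_rev (whisk_sq (merget_nat _ _))).
by rewrite (comp2_id (whisk_id (whisk_id (snake_l _ _)))).
Qed.

Lemma bendl_coev W Z Y (g : mor (W ⊗ Z) Y) A :
  (Y ◁ bendl g A) ∘ coevt Y (W ⊗ A) = merget g (dual Z ⊗ A) ∘ (W ◁ coevt Z A).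
Proof.
rewrite bendlE !whiskl_comp; nest.
rewrite !(comp2_rev (cap_nat _ _)) (comp2_id (snake_l _ _)).
by [].
Qed.

(** The inverse bending, as a morphism of the category. *)
Definition unbendr Z Y X (p : mor (Y ⊗ dual X) (dual Z)) : mor (Z ⊗ Y) X :=
  of_tail2 (evr Z (X ⊗ unit_ob) ∘ ((Z ◁ merget p (X ⊗ unit_ob))
    ∘ (Z ◁ (Y ◁ coevr X unit_ob)))).

Definition unbendl W Z Y (p : mor (dual Y ⊗ W) (dual Z)) : mor (W ⊗ Z) Y :=
  of_tail2 ((Y ◁ evt Z unit_ob) ∘ ((Y ◁ merget p (Z ⊗ unit_ob))
    ∘ coevt Y (W ⊗ (Z ⊗ unit_ob)))).

Lemma unbendrE Z Y X (p : mor (Y ⊗ dual X) (dual Z)) A :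
  merget (unbendr p) A =
  evr Z (X ⊗ A) ∘ ((Z ◁ merget p (X ⊗ A)) ∘ (Z ◁ (Y ◁ coevr X A))).
Proof.
move: A; apply: of_tail2E.
apply: (@strong_comp k C _ [:: Z; dual Z; X]).
  exact: (strong_cup _ [:: X]).
apply: (@strong_comp k C _ [:: Z; Y; dual X; X]).
  exact/(@strong_whisk _ _ Z [:: Y; dual X; X])/(strong_merget p [:: X]).
apply: (@strong_whisk _ _ Z [:: Y] [:: Y; dual X; X]).
apply: (@strong_whisk _ _ Y [::] [:: dual X; X]).
exact: (strong_cap _ [::]).
Qed.

Lemma unbendlE W Z Y (p : mor (dual Y ⊗ W) (dual Z)) A :
  merget (unbendl p) A =
  (Y ◁ evt Z A) ∘ ((Y ◁ merget p (Z ⊗ A)) ∘ coevt Y (W ⊗ (Z ⊗ A))).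
Proof.
move: A; apply: of_tail2E.
apply: (@strong_comp k C _ [:: Y; dual Z; Z]).
  exact/(@strong_whisk _ _ Y [:: dual Z; Z] [::])/(strong_cup _ [::]).
apply: (@strong_comp k C _ [:: Y; dual Y; W; Z]).
  exact/(@strong_whisk _ _ Y [:: dual Y; W; Z])/(strong_merget p [:: Z]).
exact: (strong_cap _ [:: W; Z]).
Qed.

Lemma bendr_unbendr Z Y X (p : mor (Y ⊗ dual X) (dual Z)) A :
  bendr (unbendr p) A = merget p A.
Proof.
rewrite bendrE unbendrE !whiskl_comp; nest.
rewrite -(comp2_rev (whisk_sq (cup_nat _ _))).
rewrite -(comp2_rev (whisk_sq (whisk_sq (merget_nat _ _)))).
rewrite (comp2_id (whisk_id (whisk_id (whisk_id (snake_r_dual _ _))))).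
by rewrite (comp2_rev (cap_nat _ _)) (comp2_id (snake_r_dual _ _)).
Qed.

Lemma bendl_unbendl W Z Y (p : mor (dual Y ⊗ W) (dual Z)) A :
  bendl (unbendl p) A = merget p A.
Proof.
rewrite bendlE unbendlE !whiskl_comp; nest.
rewrite -(comp2_rev (whisk_sq (cap_nat _ _))).
rewrite !(comp2_rev (cup_nat _ _)) (comp2_id (snake_l_dual _ _)).
rewrite (comp2_rev (merget_nat _ _)).
by rewrite (comp2_id (snake_l_dual _ _)).
Qed.

Definition bendr_mor Z Y X (g : mor (Z ⊗ Y) X) : mor (Y ⊗ dual X) (dual Z) :=
  of_tail2 (bendr g unit_ob).

Definition bendl_mor W Z Y (g : mor (W ⊗ Z) Y) : mor (dual Y ⊗ W) (dual Z) :=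
  of_tail2 (bendl g unit_ob).

Lemma bendr_morE Z Y X (g : mor (Z ⊗ Y) X) A : merget (bendr_mor g) A = bendr g
  A.
Proof. by move: A; apply: of_tail2E; exact: bendr_strong. Qed.

Lemma bendl_morE W Z Y (g : mor (W ⊗ Z) Y) A : merget (bendl_mor g) A = bendl g
  A.
Proof. by move: A; apply: of_tail2E; exact: bendl_strong. Qed.

Lemma bendr_morK Z Y X (g : mor (Z ⊗ Y) X) : unbendr (bendr_mor g) = g.
Proof.
apply: merget_inj; rewrite unbendrE bendr_morE; nest.
rewrite (comp2_rev (bendr_ev _ _)) (comp2_rev (merget_nat _ _)).
by rewrite (comp2_id (snake_r _ _)).
Qed.

Lemma bendl_morK W Z Y (g : mor (W ⊗ Z) Y) : unbendl (bendl_mor g) = g.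
Proof.
apply: merget_inj; rewrite unbendlE bendl_morE; nest.
rewrite (comp2_rev (whisk_sq (bendl_ev _ _))) (comp2_rev (cap_nat _ _)).
by rewrite (comp2_id (snake_l _ _)).
Qed.

Lemma unbendrK Z Y X (p : mor (Y ⊗ dual X) (dual Z)) : bendr_mor (unbendr p) =
  p.
Proof. by apply: merget_inj; rewrite bendr_morE bendr_unbendr. Qed.

End Rotations.

(** * Pivotality and traces *)

Section Pivotality.
Variables (k : fieldType) (C : pivotal_category k).
Implicit Types (A B P Q R W X Y Z T : C).

Lemma whiskr_tens X Y (f : mor X Y) A B :
  ass Y A B ∘ ((f ▷ A) ▷ B) = (f ▷ (A ⊗ B)) ∘ ass X A B.
Proof. by rewrite ass_nat tensm1. Qed.

Lemma piv_map_tail P Q (f : mor P Q) T :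
  evt Q (dual P ⊗ T) ∘ ((dual Q ◁ (f ▷ (dual P ⊗ T))) ∘ (dual Q ◁ coevt P T))
  = (dual P ◁ evr Q T) ∘ ((dual P ◁ (f ▷ (dual Q ⊗ T)))
     ∘ coevr P (dual Q ⊗ T)).
Proof.
have := congr1 (fun g => g ▷ T) (piv_map f).
rewrite !whiskr_comp -?compA => E; apply: etrans (etrans _ E) _.
  have e : cupt (ev Q) (dual P) ▷ T =
      (lu (dual P) ▷ T) ∘ (((ev Q ▷ dual P) ▷ T) ∘ (assi _ _ _ ▷ T)).
    by rewrite cuptE !whiskr_comp.
  rewrite (compA (_ ▷ T) (assi _ _ _ ▷ T)) (compA (lu _ ▷ T)) -e.
  rewrite -cup_strength -?compA; congr (_ ∘ _).
  rewrite (comp2_rev (ass_nat _ _ _)) (comp2_rev (whisk_sq (whiskr_tens _ _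
    _))).
  congr (_ ∘ _).
  by rewrite (comp2_rev (ass_nat _ _ _)) triangle_i -!whiskl_comp -captE.
rewrite cap_strength captE !whiskr_comp -triangle -?compA.
rewrite (comp2_rev (ass_nat _ _ _)) (comp2_rev (ass_nat _ _ _)).
rewrite (comp2_rev (whisk_sq (esym (whiskr_tens _ _ _)))).
by rewrite cuptE !whiskl_comp -?compA (comp2_id (whisk_id (assK _ _ _))).
Qed.

(** [Ldual g] and [Rdual g] are the left and the right transpose of [g]. *)
Definition Ldual A B X (g : mor (A ⊗ B) X) T :
    mor (dual X ⊗ T) (dual B ⊗ (dual A ⊗ T)) :=
  locked_with tail_key
   (evt X _ ∘ ((dual X ◁ merget g _) ∘
     ((dual X ◁ (A ◁ coevt B (dual A ⊗ T))) ∘ (dual X ◁ coevt A T)))).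

Lemma LdualE A B X (g : mor (A ⊗ B) X) T :
  Ldual g T = evt X _ ∘ ((dual X ◁ merget g _) ∘
     ((dual X ◁ (A ◁ coevt B (dual A ⊗ T))) ∘ (dual X ◁ coevt A T))).
Proof. by rewrite /Ldual unlock. Qed.

Definition Rdual A B X (g : mor (A ⊗ B) X) T :
    mor (dual X ⊗ T) (dual B ⊗ (dual A ⊗ T)) :=
  locked_with tail_key ((dual B ◁ bendr g T) ∘ coevr B (dual X ⊗ T)).

Lemma RdualE A B X (g : mor (A ⊗ B) X) T :
  Rdual g T = (dual B ◁ bendr g T) ∘ coevr B (dual X ⊗ T).
Proof. by rewrite /Rdual unlock. Qed.

Lemma Ldual_nat A B X (g : mor (A ⊗ B) X) T T' (h : mor T T') :
  (dual B ◁ (dual A ◁ h)) ∘ Ldual g T = Ldual g T' ∘ (dual X ◁ h).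
Proof.
rewrite !LdualE; nest.
rewrite -(comp2_rev (cup_nat _ _)) -(comp2_rev (whisk_sq (merget_nat _ _))).
rewrite (comp2_rev (whisk_sq (whisk_sq (cap_nat _ _)))).
by rewrite (comp2_rev (whisk_sq (cap_nat _ _))).
Qed.

Lemma Ldual_ev A B X (g : mor (A ⊗ B) X) T :
  evt B T ∘ ((dual B ◁ evt A (B ⊗ T)) ∘ Ldual g (A ⊗ (B ⊗ T)))
  = evt X T ∘ (dual X ◁ merget g T).
Proof.
rewrite LdualE; nest.
rewrite -!(comp2_rev (cup_nat _ _)) -!(comp2_rev (whisk_sq (merget_nat _ _))).
rewrite (comp2_rev (whisk_sq (whisk_sq (cap_nat _ _)))).
rewrite (comp2_id (whisk_id (snake_l _ _))).
by rewrite (comp2_id (whisk_id (whisk_id (snake_l _ _)))).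
Qed.

Lemma Rdual_ev A B X (g : mor (A ⊗ B) X) T :
  evr A T ∘ ((A ◁ evr B (dual A ⊗ T)) ∘ (A ◁ (B ◁ Rdual g T)))
  = evr X T ∘ merget g (dual X ⊗ T).
Proof.
rewrite RdualE; nest; rewrite !whiskl_comp -?compA.
rewrite (comp2_rev (whisk_sq (cup_nat _ _))).
by rewrite (comp2_id (whisk_id (snake_r _ _))) (comp2_rev (bendr_ev _ _)).
Qed.

(** Both sides become the two transposes of [g] into [dual (A ⊗ B)] after
    composition with the structure map [t : dual B ⊗ dual A -> dual (A ⊗ B)],
    which is a split monomorphism and is the same for left and for right
    duals; for these transposes the claim is [piv_map]. *)
Lemma Ldual_Rdual A B X (g : mor (A ⊗ B) X) T : Ldual g T = Rdual g T.
Proof.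
have [t [tl tr]] := piv_tens A B; set D := dual (A ⊗ B).
have P1 S : evt (A ⊗ B) S ∘ merget t ((A ⊗ B) ⊗ S) =
    evt B S ∘ ((dual B ◁ evt A (B ⊗ S)) ∘ (dual B ◁ (dual A ◁ ass A B S))).
  pose X1 := (dual B ◁ ass (dual A) (A ⊗ B) S)
    ∘ ass (dual B) (dual A ⊗ (A ⊗ B)) S.
  pose X2 := assi (dual B) (dual A ⊗ (A ⊗ B)) S
    ∘ (dual B ◁ assi (dual A) (A ⊗ B) S).
  have XK : X1 ∘ X2 = idmor _.
    rewrite /X1 /X2 -?compA (comp2_id (assiK _ _ _)) -whiskl_comp assiK.
    by rewrite tensm1.
  apply: (split_epi_cancel XK); rewrite /X1 mergetE -?compA pentagon_assi.
  rewrite cuptE -?compA.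
  have := assi_nat t (idmor (A ⊗ B)) (idmor S); rewrite tensm1 => E.
  rewrite (comp2_rev E) (comp2_id (assK _ _ _)).
  have cs h : (dual B ◁ evt A (B ⊗ S)) ∘ ((dual B ◁ (dual A ◁ ass A B S)) ∘
      ((dual B ◁ ass (dual A) (A ⊗ B) S) ∘ h)) = (dual B ◁ (evt A B ▷ S)) ∘ h.
    by rewrite !compA -!whiskl_comp -?compA cup_strength.
  rewrite cs (compA (ev (A ⊗ B) ▷ S)) -whiskr_comp tl -whiskr_comp -?compA.
  rewrite assiK compm1 -cuptE whiskr_comp (cuptE (ev B)) -?compA.
  by rewrite -ass_nat (comp2_id (assK _ _ _)).
have P2 S : evr (A ⊗ B) S ∘ ((A ⊗ B) ◁ merget t S) =
    evr A S ∘ ((A ◁ evr B (dual A ⊗ S)) ∘ ass A B (dual B ⊗ (dual A ⊗ S))).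
  pose X1 := ass (A ⊗ B) (dual B) (dual A ⊗ S)
    ∘ ass ((A ⊗ B) ⊗ dual B) (dual A) S.
  pose X2 := assi ((A ⊗ B) ⊗ dual B) (dual A) S
    ∘ assi (A ⊗ B) (dual B) (dual A ⊗ S).
  have XK : X1 ∘ X2 = idmor _.
    by rewrite /X1 /X2 -?compA (comp2_id (assiK _ _ _)) assiK.
  apply: (split_epi_cancel XK); rewrite /X1 mergetE whiskl_comp -?compA.
  have -> : ((A ⊗ B) ◁ assi (dual B) (dual A) S)
      ∘ (ass (A ⊗ B) (dual B) (dual A ⊗ S) ∘ ass ((A ⊗ B) ⊗ dual B) (dual A) S)
    = ass (A ⊗ B) (dual B ⊗ dual A) S ∘ (ass (A ⊗ B) (dual B) (dual A) ▷ S).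
    by rewrite -pentagon_ass (comp2_id (whisk_id (assK _ _ _))).
  rewrite -(comp2_rev (ass_nat _ _ _)) cuptE -?compA.
  rewrite (comp2_id (assK _ _ _)).
  rewrite (compA (ev' (A ⊗ B) ▷ S)) -whiskr_comp tr -whiskr_comp -?compA.
  rewrite assK compm1 -?compA.
  rewrite [in RHS](comp2_rev (esym (pentagon_ass _ _ _ _))).
  have cs h : (A ◁ evr B (dual A ⊗ S)) ∘
      ((A ◁ ass B (dual B) (dual A ⊗ S)) ∘ h)
    = (A ◁ lu (dual A ⊗ S)) ∘ ((A ◁ (ev' B ▷ (dual A ⊗ S))) ∘ h).
    by rewrite !compA -!whiskl_comp cuptE -?compA assK compm1.
  rewrite cs -[X in _ ∘ (_ ∘ (_ ∘ X))]compA.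
  rewrite (comp2_rev (esym (ass_nat _ _ _))) (comp2_cancel (triangle _ _)).
  rewrite (compA ((A ◁ ev' B) ▷ _)) -whiskr_comp (compA (ru A ▷ _)).
  rewrite -whiskr_comp -whiskr_tens cuptE -?compA (comp2_id (assK _ _ _)).
  by rewrite -whiskr_comp.
(* A left inverse of [t], bending [A] and [B] back one after the other. *)
pose s S : mor (D ⊗ S) (dual B ⊗ (dual A ⊗ S)) := evt (A ⊗ B) _ ∘
  ((D ◁ assi A B _) ∘ ((D ◁ (A ◁ coevt B _)) ∘ (D ◁ coevt A S))).
have st S : s S ∘ merget t S = idmor _.
  nest; rewrite /s -?compA.
  rewrite -!(comp2_rev (merget_nat _ _)) (comp2_cancel (P1 _)) -?compA.
  rewrite (comp2_id (whisk_id (whisk_id (assiK _ _ _)))).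
  rewrite (comp2_rev (whisk_sq (cup_nat _ _))).
  by rewrite (comp2_id (whisk_id (snake_l_dual _ _))) (comp2_id (snake_l_dual _
    _)) comp1m.
apply: (split_mono_cancel (st T)).
have tL : merget t T ∘ Ldual g T = evt X (D ⊗ T) ∘
    ((dual X ◁ (g ▷ (D ⊗ T))) ∘ (dual X ◁ coevt (A ⊗ B) T)).
  have n : merget t T ∘ Ldual g T = evt (A ⊗ B) (D ⊗ T) ∘
     ((merget t _ ∘ Ldual g _) ∘ (dual X ◁ coevt (A ⊗ B) T)).
    nest; rewrite -(comp2_rev (Ldual_nat _ _)) (comp2_rev (merget_nat _ _)).
    by rewrite (comp2_id (snake_l_dual _ _)).
  rewrite n; nest; rewrite (comp2_cancel (P1 _)) -?compA.
  rewrite (comp2_rev (Ldual_nat _ _)).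
  have e := Ldual_ev g (D ⊗ T); rewrite compA in e.
  rewrite (compA (evt B _)) (comp2_rev e) mergetE.
  rewrite whiskl_comp -?compA.
  by rewrite (comp2_id (whisk_id (assK _ _ _))).
have tR : merget t T ∘ Rdual g T = (D ◁ evr X T) ∘
    ((D ◁ (g ▷ (dual X ⊗ T))) ∘ coevr (A ⊗ B) (dual X ⊗ T)).
  have n (f : mor (dual X ⊗ T) (D ⊗ T)) :
      f = (D ◁ evr (A ⊗ B) T) ∘ ((D ◁ ((A ⊗ B) ◁ f)) ∘ coevr (A ⊗ B) _).
    by nest; rewrite (comp2_rev (cap_nat _ _)) (comp2_id (snake_r_dual _ _)).
  rewrite [LHS]n !compA -!whiskl_comp; congr ((D ◁ _) ∘ _).
  rewrite whiskl_comp; nest.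
  rewrite (comp2_cancel (P2 _)) -?compA.
  rewrite -tensm1 (comp2_rev (ass_nat _ _ _)).
  have e := Rdual_ev g T; rewrite !compA in e.
  rewrite !compA e -?compA mergetE -?compA.
  by rewrite (comp2_id (assK _ _ _)).
by rewrite tL tR piv_map_tail.
Qed.

(** The vertex [p] is pulled around the closed strand: it leaves on one side
    as [Rdual p] and comes back on the other as [Ldual p]. *)
Lemma trace_cyclic A B X (p : mor (A ⊗ B) X) (g : mor X (A ⊗ B)) T :
  evt B T ∘ ((dual B ◁ evt A (B ⊗ T)) ∘ ((dual B ◁ (dual A ◁ splitt g T)) ∘
    ((dual B ◁ (dual A ◁ merget p T)) ∘ ((dual B ◁ coevr A (B ⊗ T))
     ∘ coevr B T))))
  = evt X T ∘ ((dual X ◁ ((p ∘ g) ▷ T)) ∘ coevr X T).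
Proof.
have e : (dual B ◁ (dual A ◁ merget p T)) ∘ ((dual B ◁ coevr A (B ⊗ T))
     ∘ coevr B T) = Ldual p (X ⊗ T) ∘ coevr X T.
  rewrite Ldual_Rdual RdualE; nest.
  rewrite -(comp2_rev (cap_nat _ _)).
  by rewrite -(comp2_rev (whisk_sq (bendr_coev _ _))).
rewrite e; nest; rewrite (comp2_rev (Ldual_nat _ _)).
have e2 := Ldual_ev p T; rewrite compA in e2.
rewrite (compA (evt B _)) (comp2_rev e2).
congr (_ ∘ _); rewrite compA -whiskl_comp; congr ((_ ◁ _) ∘ _).
by rewrite mergetE splittE whiskr_comp -?compA (comp2_id (assK _ _ _)).
Qed.

End Pivotality.

(** * Building blocks of the half-braiding and of the [e_Y] *)

Section Components.
Variables (k : fieldType) (C : pivotal_category k).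
Implicit Types (A B P Q R W X Y Z T : C).

(** The summand of [e_Y] from [X ⊗ dual X] to [Z ⊗ dual Z] that belongs to
    one pair of dual basis vectors. *)
Definition e_block X Z Y (u : mor X (Z ⊗ Y)) (g : mor (Z ⊗ Y) X) A :
    mor (X ⊗ (dual X ⊗ A)) (Z ⊗ (dual Z ⊗ A)) :=
  locked_with tail_key ((Z ◁ bendr g A) ∘ splitt u (dual X ⊗ A)).

(** The corresponding summand of the half-braiding with [W]. *)
Definition hb_block Y W Z (u : mor Y (W ⊗ Z)) (g : mor (W ⊗ Z) Y) A :
    mor (Y ⊗ (dual Y ⊗ (W ⊗ A))) (W ⊗ (Z ⊗ (dual Z ⊗ A))) :=
  locked_with tail_key (splitt u (dual Z ⊗ A) ∘ (Y ◁ bendl g A)).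

Lemma e_blockE X Z Y (u : mor X (Z ⊗ Y)) (g : mor (Z ⊗ Y) X) A :
  e_block u g A = (Z ◁ bendr g A) ∘ splitt u (dual X ⊗ A).
Proof. by rewrite /e_block unlock. Qed.

Lemma hb_blockE Y W Z (u : mor Y (W ⊗ Z)) (g : mor (W ⊗ Z) Y) A :
  hb_block u g A = splitt u (dual Z ⊗ A) ∘ (Y ◁ bendl g A).
Proof. by rewrite /hb_block unlock. Qed.

Definition splitt3 X P Q R (u : mor X (P ⊗ (Q ⊗ R))) A :
    mor (X ⊗ A) (P ⊗ (Q ⊗ (R ⊗ A))) :=
  locked_with tail_key ((P ◁ ass Q R A) ∘ splitt u A).

Definition merget3 X P Q R (g : mor (P ⊗ (Q ⊗ R)) X) A :
    mor (P ⊗ (Q ⊗ (R ⊗ A))) (X ⊗ A) :=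
  locked_with tail_key (merget g A ∘ (P ◁ assi Q R A)).

Lemma splitt3E X P Q R (u : mor X (P ⊗ (Q ⊗ R))) A :
  splitt3 u A = (P ◁ ass Q R A) ∘ splitt u A.
Proof. by rewrite /splitt3 unlock. Qed.

Lemma merget3E X P Q R (g : mor (P ⊗ (Q ⊗ R)) X) A :
  merget3 g A = merget g A ∘ (P ◁ assi Q R A).
Proof. by rewrite /merget3 unlock. Qed.

Lemma splitt3_right X P Q R Z (i : mor X (P ⊗ Z)) (j : mor Z (Q ⊗ R)) A :
  splitt3 ((P ◁ j) ∘ i) A = (P ◁ splitt j A) ∘ splitt i A.
Proof.
rewrite splitt3E !splittE whiskr_comp whiskl_comp; nest.
by rewrite (comp2_rev (ass_nat _ _ _)).
Qed.

Lemma merget3_right X P Q R Z (i : mor (P ⊗ Z) X) (j : mor (Q ⊗ R) Z) A :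
  merget3 (i ∘ (P ◁ j)) A = merget i A ∘ (P ◁ merget j A).
Proof.
rewrite merget3E !mergetE whiskr_comp whiskl_comp; nest.
by rewrite -(comp2_rev (assi_nat _ _ _)).
Qed.

Lemma splitt3_ass X P Q R (u : mor X ((P ⊗ Q) ⊗ R)) A :
  splitt3 (ass P Q R ∘ u) A = ass P Q (R ⊗ A) ∘ splitt u A.
Proof.
rewrite splitt3E !splittE whiskr_comp -?compA.
by rewrite (compA (ass P (Q ⊗ R) A)) (compA (P ◁ _)) pentagon_ass -?compA.
Qed.

Lemma merget3_ass X P Q R (g : mor ((P ⊗ Q) ⊗ R) X) A :
  merget3 (g ∘ assi P Q R) A = merget g A ∘ assi P Q (R ⊗ A).
Proof.
have K : ((P ◁ ass Q R A) ∘ ass P (Q ⊗ R) A)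
    ∘ (assi P (Q ⊗ R) A ∘ (P ◁ assi Q R A)) = idmor _.
  by rewrite -?compA (comp2_id (assiK _ _ _)) -whiskl_comp assiK tensm1.
apply: (split_epi_cancel K).
rewrite merget3E !mergetE whiskr_comp -?compA pentagon_assi.
rewrite (comp2_id (whisk_id (assK _ _ _))) assK compm1.
by rewrite (comp2_id (assK _ _ _)).
Qed.

Lemma splitt3_left X P Q R Z (f : mor X (Z ⊗ R)) (g : mor Z (P ⊗ Q)) A :
  splitt3 (ass P Q R ∘ ((g ▷ R) ∘ f)) A = splitt g (R ⊗ A) ∘ splitt f A.
Proof.
rewrite splitt3_ass !splittE whiskr_comp; nest.
by rewrite (comp2_rev (whiskr_tens _ _ _)).
Qed.

Lemma merget3_left X P Q R Z (f : mor (Z ⊗ R) X) (g : mor (P ⊗ Q) Z) A :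
  merget3 (f ∘ ((g ▷ R) ∘ assi P Q R)) A = merget f A ∘ merget g (R ⊗ A).
Proof.
rewrite (compA f) merget3_ass !mergetE whiskr_comp -tensm1; nest.
by rewrite -(comp2_rev (assi_nat _ _ _)).
Qed.

Definition bendr3 X Z Y Y' (g : mor (Z ⊗ (Y ⊗ Y')) X) A :
    mor (Y ⊗ (Y' ⊗ (dual X ⊗ A))) (dual Z ⊗ A) :=
  locked_with tail_key
    ((dual Z ◁ evr X A) ∘ ((dual Z ◁ merget3 g (dual X ⊗ A)) ∘ coevr Z _)).

Definition bendl3 Y W W' Z (g : mor (W ⊗ (W' ⊗ Z)) Y) A :
    mor (dual Y ⊗ (W ⊗ (W' ⊗ A))) (dual Z ⊗ A) :=
  locked_with tail_key (evt Y _ ∘ ((dual Y ◁ merget3 g (dual Z ⊗ A))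
    ∘ (dual Y ◁ (W ◁ (W' ◁ coevt Z A))))).

Lemma bendr3E X Z Y Y' (g : mor (Z ⊗ (Y ⊗ Y')) X) A :
  bendr3 g A =
  (dual Z ◁ evr X A) ∘ ((dual Z ◁ merget3 g (dual X ⊗ A)) ∘ coevr Z _).
Proof. by rewrite /bendr3 unlock. Qed.

Lemma bendl3E Y W W' Z (g : mor (W ⊗ (W' ⊗ Z)) Y) A :
  bendl3 g A = evt Y _ ∘ ((dual Y ◁ merget3 g (dual Z ⊗ A))
    ∘ (dual Y ◁ (W ◁ (W' ◁ coevt Z A)))).
Proof. by rewrite /bendl3 unlock. Qed.

Lemma bendr3_assi X Z Y Y' (g : mor (Z ⊗ (Y ⊗ Y')) X) A :
  bendr3 g A = bendr g A ∘ assi Y Y' (dual X ⊗ A).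
Proof.
rewrite bendr3E bendrE merget3E whiskl_comp; nest.
by rewrite (comp2_rev (cap_nat _ _)).
Qed.

Lemma bendl3_assi Y W W' Z (g : mor ((W ⊗ W') ⊗ Z) Y) A :
  bendl3 (g ∘ assi W W' Z) A = bendl g A ∘ (dual Y ◁ assi W W' A).
Proof.
rewrite bendl3E bendlE merget3_ass whiskl_comp; nest.
do 2!congr (_ ∘ _).
have := assi_nat (idmor W) (idmor W') (coevt Z A); rewrite tensm1 => E.
by rewrite (comp2_rev (whisk_sq E)).
Qed.

Lemma bendr_bendr X X' Z Y Y' (f : mor (X' ⊗ Y') X) (g : mor (Z ⊗ Y) X') A :
  bendr g A ∘ (Y ◁ bendr f A) = bendr3 (f ∘ ((g ▷ Y') ∘ assi Z Y Y')) A.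
Proof.
rewrite bendr3E merget3_left whiskl_comp bendrE; nest.
rewrite -(comp2_rev (cap_nat _ _)).
rewrite (comp2_rev (whisk_sq (merget_nat _ _))).
by rewrite (comp2_rev (whisk_sq (bendr_ev _ _))).
Qed.

Lemma bendl_bendl Y Y' W W' Z (f : mor (W ⊗ Y') Y) (g : mor (W' ⊗ Z) Y') A :
  bendl g A ∘ bendl f (W' ⊗ A) = bendl3 (f ∘ (W ◁ g)) A.
Proof.
rewrite bendl3E merget3_right whiskl_comp (bendlE g); nest.
rewrite -!(comp2_rev (bendl_nat _ _)) (comp2_rev (bendl_ev _ _)).
by [].
Qed.

Definition e_block3 X Z Y Y' (u : mor X (Z ⊗ (Y ⊗ Y')))
    (g : mor (Z ⊗ (Y ⊗ Y')) X) A :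
    mor (X ⊗ (dual X ⊗ A)) (Z ⊗ (dual Z ⊗ A)) :=
  locked_with tail_key ((Z ◁ bendr3 g A) ∘ splitt3 u (dual X ⊗ A)).

Definition hb_block3 Y W W' Z (u : mor Y (W ⊗ (W' ⊗ Z)))
    (g : mor (W ⊗ (W' ⊗ Z)) Y) A :
    mor (Y ⊗ (dual Y ⊗ (W ⊗ (W' ⊗ A)))) (W ⊗ (W' ⊗ (Z ⊗ (dual Z ⊗ A)))) :=
  locked_with tail_key (splitt3 u (dual Z ⊗ A) ∘ (Y ◁ bendl3 g A)).

Lemma e_block3E X Z Y Y' (u : mor X (Z ⊗ (Y ⊗ Y'))) (g : mor (Z ⊗ (Y ⊗ Y')) X)
  A :
  e_block3 u g A = (Z ◁ bendr3 g A) ∘ splitt3 u (dual X ⊗ A).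
Proof. by rewrite /e_block3 unlock. Qed.

Lemma hb_block3E Y W W' Z (u : mor Y (W ⊗ (W' ⊗ Z)))
    (g : mor (W ⊗ (W' ⊗ Z)) Y) A :
  hb_block3 u g A = splitt3 u (dual Z ⊗ A) ∘ (Y ◁ bendl3 g A).
Proof. by rewrite /hb_block3 unlock. Qed.

Lemma e_block3_tens X Z Y Y' (u : mor X (Z ⊗ (Y ⊗ Y')))
    (g : mor (Z ⊗ (Y ⊗ Y')) X) A :
  e_block3 u g A = e_block u g A.
Proof.
rewrite e_block3E e_blockE bendr3_assi splitt3E whiskl_comp; nest.
by rewrite (comp2_id (whisk_id (assK _ _ _))).
Qed.

Lemma hb_block3_tens Y W W' Z (u : mor Y ((W ⊗ W') ⊗ Z)) (g : mor ((W ⊗ W') ⊗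
  Z) Y) A :
  hb_block3 (ass W W' Z ∘ u) (g ∘ assi W W' Z) A =
  ass W W' (Z ⊗ (dual Z ⊗ A)) ∘ (hb_block u g A ∘ (Y ◁ (dual Y ◁ assi W W' A))).
Proof. by rewrite hb_block3E hb_blockE splitt3_ass bendl3_assi whiskl_comp
  -?compA. Qed.

(** The strand of [X'] between the two vertices is straightened, so that the
    composite is a block for the composite vertices. *)
Lemma e_block_comp X X' Z Y Y' (f : mor X (X' ⊗ Y')) (f' : mor (X' ⊗ Y') X)
    (g : mor X' (Z ⊗ Y)) (g' : mor (Z ⊗ Y) X') A :
  e_block g g' A ∘ e_block f f' A =
  e_block3 (ass Z Y Y' ∘ ((g ▷ Y') ∘ f)) (f' ∘ ((g' ▷ Y') ∘ assi Z Y Y')) A.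
Proof.
rewrite e_block3E splitt3_left -bendr_bendr !e_blockE whiskl_comp; nest.
by rewrite -(comp2_rev (splitt_nat _ _)).
Qed.

Lemma hb_block_comp Y Y' W W' Z (f : mor Y (W ⊗ Y')) (f' : mor (W ⊗ Y') Y)
    (g : mor Y' (W' ⊗ Z)) (g' : mor (W' ⊗ Z) Y') A :
  (W ◁ hb_block g g' A) ∘ hb_block f f' (W' ⊗ A) = hb_block3 ((W ◁ g) ∘ f) (f'
    ∘ (W ◁ g')) A.
Proof.
rewrite hb_block3E splitt3_right -bendl_bendl !hb_blockE !whiskl_comp; nest.
by rewrite (comp2_rev (splitt_nat _ _)).
Qed.

Definition bendl2 X W Z Y (h : mor (W ⊗ (Z ⊗ Y)) X) A :
    mor (dual X ⊗ (W ⊗ A)) (dual Y ⊗ (dual Z ⊗ A)) :=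
  locked_with tail_key
    (evt X _ ∘ ((dual X ◁ merget3 h (dual Y ⊗ (dual Z ⊗ A))) ∘
      ((dual X ◁ (W ◁ (Z ◁ coevt Y (dual Z ⊗ A)))) ∘
       (dual X ◁ (W ◁ coevt Z A))))).

Lemma bendl2E X W Z Y (h : mor (W ⊗ (Z ⊗ Y)) X) A :
  bendl2 h A = evt X _ ∘ ((dual X ◁ merget3 h (dual Y ⊗ (dual Z ⊗ A))) ∘
      ((dual X ◁ (W ◁ (Z ◁ coevt Y (dual Z ⊗ A)))) ∘
       (dual X ◁ (W ◁ coevt Z A)))).
Proof. by rewrite /bendl2 unlock. Qed.

(** The vertex [h : W ⊗ (Z ⊗ Y) -> X] bent into [Y ⊗ (dual X ⊗ W) -> dual Z].
    In [crossing] this is the common form of both sides of the centrality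
    equation. *)
Definition leg X W Z Y (h : mor (W ⊗ (Z ⊗ Y)) X) A :
    mor (Y ⊗ (dual X ⊗ (W ⊗ A))) (dual Z ⊗ A) :=
  locked_with tail_key (evr Y _ ∘ (Y ◁ bendl2 h A)).

Lemma legE X W Z Y (h : mor (W ⊗ (Z ⊗ Y)) X) A :
  leg h A = evr Y _ ∘ (Y ◁ bendl2 h A).
Proof. by rewrite /leg unlock. Qed.

Lemma bendr_Ldual Z Y X (g : mor (Z ⊗ Y) X) A :
  bendr g A = evr Y (dual Z ⊗ A) ∘ (Y ◁ Ldual g A).
Proof.
rewrite Ldual_Rdual RdualE whiskl_comp; nest.
by rewrite (comp2_rev (cup_nat _ _)) (comp2_id (snake_r _ _)).
Qed.

(** Pivotality is what makes this hold: [g] is bent with right duals on the left side and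
    with left duals in [leg]. *)
Lemma leg_right X X' W Z Y (f : mor (W ⊗ X') X) (g : mor (Z ⊗ Y) X') A :
  bendr g A ∘ (Y ◁ bendl f A) = leg (f ∘ (W ◁ g)) A.
Proof.
rewrite legE bendr_Ldual -compA -whiskl_comp; congr (_ ∘ (_ ◁ _)).
rewrite bendl2E merget3_right whiskl_comp LdualE; nest.
rewrite -!(comp2_rev (bendl_nat _ _)) (comp2_rev (bendl_ev _ _)).
by [].
Qed.

(** As in [leg_right], but it is now [f] that is turned around. *)
Lemma leg_left X X' W Z Y (f : mor (X' ⊗ Y) X) (g : mor (W ⊗ Z) X') A :
  bendl g A ∘ bendr f (W ⊗ A) = leg (f ∘ ((g ▷ Y) ∘ assi W Z Y)) A.
Proof.
rewrite legE bendr_Ldual; nest.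
rewrite -(comp2_rev (cup_nat _ _)) !compA; congr (_ ∘ _).
rewrite -!compA -!whiskl_comp; congr (_ ∘ (_ ◁ _)).
rewrite bendl2E merget3_left LdualE whiskl_comp; nest.
rewrite -!(comp2_rev (cup_nat _ _)) -!(comp2_rev (whisk_sq (merget_nat _ _))).
rewrite !(comp2_rev (whisk_sq (whisk_sq (cap_nat _ _)))).
rewrite (comp2_rev (whisk_sq (bendl_coev _ _))).
by rewrite -!(comp2_rev (whisk_sq (merget_nat _ _))).
Qed.

Definition crossing X W Z Y (u : mor X (W ⊗ (Z ⊗ Y))) (h : mor (W ⊗ (Z ⊗ Y)) X)
  A :
    mor (X ⊗ (dual X ⊗ (W ⊗ A))) (W ⊗ (Z ⊗ (dual Z ⊗ A))) :=
  locked_with tail_key ((W ◁ (Z ◁ leg h A)) ∘ splitt3 u _).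

Lemma crossingE X W Z Y (u : mor X (W ⊗ (Z ⊗ Y))) (h : mor (W ⊗ (Z ⊗ Y)) X) A :
  crossing u h A = (W ◁ (Z ◁ leg h A)) ∘ splitt3 u _.
Proof. by rewrite /crossing unlock. Qed.

Lemma whisk_e_block_hb_block X X' W Z Y (f : mor X (W ⊗ X'))
    (f' : mor (W ⊗ X') X)
    (g : mor X' (Z ⊗ Y)) (g' : mor (Z ⊗ Y) X') A :
  (W ◁ e_block g g' A) ∘ hb_block f f' A = crossing ((W ◁ g) ∘ f) (f' ∘ (W ◁
    g')) A.
Proof.
rewrite crossingE splitt3_right -leg_right e_blockE hb_blockE !whiskl_comp;
  nest.
rewrite -(comp2_rev (splitt_nat _ _)).
by rewrite -(comp2_rev (whisk_sq (splitt_nat _ _))).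
Qed.

Lemma hb_block_e_block X X' W Z Y (f : mor X (X' ⊗ Y)) (f' : mor (X' ⊗ Y) X)
    (g : mor X' (W ⊗ Z)) (g' : mor (W ⊗ Z) X') A :
  hb_block g g' A ∘ e_block f f' (W ⊗ A) =
  crossing (ass W Z Y ∘ ((g ▷ Y) ∘ f)) (f' ∘ ((g' ▷ Y) ∘ assi W Z Y)) A.
Proof.
rewrite crossingE splitt3_left -leg_left e_blockE hb_blockE !whiskl_comp; nest.
by rewrite -!(comp2_rev (splitt_nat _ _)).
Qed.

(** The left partial trace over [Z] of the composite [Z ⊗ Y -> X -> Z ⊗ Y']. *)
Definition ptrace X Z Y Y' (f' : mor (Z ⊗ Y) X) (g : mor X (Z ⊗ Y')) B :
    mor (Y ⊗ B) (Y' ⊗ B) :=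
  locked_with tail_key (evt Z (Y' ⊗ B) ∘ ((dual Z ◁ splitt g B) ∘
    ((dual Z ◁ merget f' B) ∘ coevr Z (Y ⊗ B)))).

Lemma ptraceE X Z Y Y' (f' : mor (Z ⊗ Y) X) (g : mor X (Z ⊗ Y')) B :
  ptrace f' g B = evt Z (Y' ⊗ B) ∘ ((dual Z ◁ splitt g B) ∘
    ((dual Z ◁ merget f' B) ∘ coevr Z (Y ⊗ B))).
Proof. by rewrite /ptrace unlock. Qed.

Lemma ptrace_strong X Z Y Y' (f' : mor (Z ⊗ Y) X) (g : mor X (Z ⊗ Y')) :
  @strong k C [:: Y] [:: Y'] (ptrace f' g).
Proof.
apply: strong_ext => [A|]; first exact: ptraceE.
apply: (@strong_comp k C _ [:: dual Z; Z; Y']).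
  exact: (strong_cup _ [:: Y']).
apply: (@strong_comp k C _ [:: dual Z; X]).
  exact/(@strong_whisk _ _ (dual Z) [:: X] [:: Z; Y'])/(strong_splitt g [::]).
apply: (@strong_comp k C _ [:: dual Z; Z; Y]).
  exact/(@strong_whisk _ _ (dual Z) [:: Z; Y] [:: X])/(strong_merget f' [::]).
exact: (strong_cap _ [:: Y]).
Qed.

(** The diagram of a convolution product: the zigzag of [X] joins the two
    blocks and leaves a partial trace in the middle. *)
Lemma e_block_conv X Z Y Y' (f : mor X (Z ⊗ Y)) (f' : mor (Z ⊗ Y) X)
    (g : mor X (Z ⊗ Y')) (g' : mor (Z ⊗ Y') X) A :
  (Z ◁ evt Z (dual Z ⊗ A)) ∘ ((Z ◁ (dual Z ◁ e_block g g' A)) ∘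
    (e_block f f' (X ⊗ (dual X ⊗ A)) ∘ (X ◁ coevr X (dual X ⊗ A))))
  = (Z ◁ bendr g' A) ∘ ((Z ◁ ptrace f' g (dual X ⊗ A)) ∘ splitt f (dual X ⊗ A)).
Proof.
rewrite !e_blockE ptraceE !whiskl_comp; nest.
rewrite -(comp2_rev (splitt_nat _ _)) (comp2_rev (whisk_sq (bendr_coev _ _))).
by rewrite (comp2_rev (whisk_sq (cup_nat _ _))).
Qed.

Lemma ptrace_trace X Z Y (f' : mor (Z ⊗ Y) X) (g : mor X (Z ⊗ Y)) B :
  evt Y B ∘ ((dual Y ◁ ptrace f' g B) ∘ coevr Y B)
  = evt X B ∘ ((dual X ◁ ((f' ∘ g) ▷ B)) ∘ coevr X B).
Proof.
by rewrite -trace_cyclic ptraceE !whiskl_comp -?compA.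
Qed.

(** The closing of a block is a trace, which is used to see that the sum of
    the blocks over dual bases is nonzero. *)
Lemma e_block_closed X Z Y (u : mor X (Z ⊗ Y)) (g : mor (Z ⊗ Y) X) A :
  evr Z A ∘ (e_block u g A ∘ coevt X A) = evr X A ∘ (((g ∘ u) ▷ _) ∘ coevt X A).
Proof.
rewrite e_blockE; nest; rewrite (comp2_rev (bendr_ev _ _)) mergetE splittE
  whiskr_comp -?compA.
by rewrite (comp2_id (assK _ _ _)).
Qed.

Lemma hb_block_unit Y A :
  lu _ ∘ (hb_block (lui Y) (lu Y) A ∘ (Y ◁ (dual Y ◁ lui A))) = idmor _.
Proof.
have luiK' B : merget (lu Y) B ∘ lui (Y ⊗ B) = idmor _.
  by rewrite mergetE -compA lui_tens -whiskr_comp luiK tensm1.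
rewrite hb_blockE splittE -?compA (comp2_cancel (lu_tens _ _)).
rewrite (comp2_id (b := lui Y ▷ _)); last by rewrite -whiskr_comp luiK tensm1.
rewrite -whiskl_comp bendlE -?compA -whiskl_comp -lui_nat -whiskl_comp.
by rewrite (comp2_id (luiK' _)) snake_l_dual tensm1.
Qed.

End Components.

(** * Schur's lemma *)

Section Schur.
Variables (k : fieldType) (C : linear_category k).
Hypothesis kclosed : forall p : {poly k}, size p != 1%N -> exists x, root p x.
Hypothesis Cab : is_abelian C.
Implicit Types A X Y Z : C.

Lemma schur X Y (f : mor X Y) : simple_ob X -> simple_ob Y -> f = 0 \/ is_iso f.
Proof.
move=> [_ sX] [_ sY]; have [K [i [fi0 ker]]] := ab_kernel Cab f.
have imono : is_mono i.
  move=> A g h e; have := ker A (i ∘ g).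
  rewrite compA fi0 comp0m => /(_ erefl)[l [_ uniq]].
  by rewrite -(uniq g erefl) -(uniq h (esym e)).
case: (sX _ i imono) => [i0 | [j [_ ij]]]; last first.
  by left; rewrite -[f]compm1 -ij compA fi0 comp0m.
apply: sY => A g h e.
have := ker A (g - h); rewrite compmB e subrr.
move=> /(_ erefl)[l [el _]].
by apply/subr0_eq; rewrite -el i0 comp0m.
Qed.

(** An eigenvector of the operator of composition with [f] on the
    endomorphisms of [X]. *)
Lemma endo_eigen X (f : mor X X) : idmor X <> 0 ->
  exists a (w : mor X X), w <> 0 /\ f ∘ w = a *: w.
Proof.
move=> X0; set V := mor X X; set n := \dim (fullv : {vspace V}).
pose b := vbasis (fullv : {vspace V}).
have bb : basis_of fullv b by exact: vbasisP.
pose M := \matrix_(i < n, j < n) coord b j (f ∘ tnth b i).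
have n0 : (0 < n)%N.
  rewrite lt0n dimv_eq0; apply/eqP => V0; apply: X0.
  by apply/eqP; rewrite -memv0 -V0 memvf.
have [a] : exists a, root (char_poly M) a.
  by apply: kclosed; rewrite size_char_poly eqSS -lt0n.
rewrite -eigenvalue_root_char => /eigenvalueP[v vM v0].
exists a, (\sum_i v 0 i *: tnth b i); split.
  move=> e; case/eqP: v0; apply/rowP => i; rewrite mxE.
  have fb := basis_free bb; move/freeP: fb => /(_ (fun i => v 0 i)); apply.
  by rewrite -[RHS]e; apply: eq_bigr => j _; rewrite (tnth_nth 0).
rewrite comp_sumr scaler_sumr.
under eq_bigr => i _ do rewrite compmZ
  [f ∘ _](coord_basis bb (memvf _)) scaler_sumr.
rewrite exchange_big; apply: eq_bigr => j _ /=.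
have := congr1 (fun r : 'rV_n => r 0 j) vM; rewrite !mxE => e.
rewrite scalerA -e scaler_suml; apply: eq_bigr => i _.
by rewrite mxE scalerA; congr (_ *: _); rewrite (tnth_nth 0).
Qed.

Definition scal X (f : mor X X) : k := coord [tuple idmor X] ord0 f.

Lemma scal_linear X : linear (@scal X : mor X X -> k^o).
Proof. by move=> a u v; rewrite /scal linearP. Qed.

Lemma scal_id X : idmor X <> 0 -> scal (idmor X) = 1.
Proof.
move=> X0; rewrite /scal.
have fr : free [tuple idmor X] by rewrite (free_cons) /= nil_free span_nil memv0
  andbT; apply/eqP.
have := coord_free (X := [tuple idmor X]) ord0 ord0 fr.
by rewrite eqxx /= => ->.
Qed.

Lemma scalZ X a (f : mor X X) : scal (a *: f) = a * scal f.
Proof. by rewrite /scal linearZ. Qed.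

(** The eigenvector [w] of [endo_eigen] is annihilated by [f - a], which by
    Schur's lemma is zero or invertible. *)
Lemma scalK X (f : mor X X) : simple_ob X -> f = scal f *: idmor X.
Proof.
move=> sX; have X0 := proj1 sX.
suff [a e] : exists a, f = a *: idmor X.
  by rewrite {1}e; congr (_ *: _); rewrite e scalZ scal_id ?mulr1.
have [a [w [w0 e]]] := endo_eigen f X0; exists a.
have [/subr0_eq // | [g [gf _]]] := schur (f - a *: idmor X) sX sX.
case: w0; rewrite -[w]comp1m -gf -compA.
by rewrite compBm compZm comp1m e subrr compm0.
Qed.

End Schur.

(** * Dual families of morphisms *)

Section Resolutions.
Variables (k : fieldType) (C : linear_category k).
Hypothesis kclosed : forall p : {poly k}, size p != 1%N -> exists x, root p x.
Hypothesis Cab : is_abelian C.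
Hypothesis Css : is_semisimple C.
Implicit Types A B X Y Z : C.

(** The families [u] and [u'] represent the canonical element of the pairing
    of [Hom(X, A)] with [Hom(A, X)] by composition, without being bases. *)
Definition resolves X A (I : finType) (u : I -> mor X A) (u' : I -> mor A X) :=
  (forall v : mor X A, v = \sum_s u s ∘ (u' s ∘ v)) /\
  (forall w : mor A X, w = \sum_s (w ∘ u s) ∘ u' s).

(** Decompose [A] into simple objects; the summands isomorphic to [X] give
    dual families, and the others do not contribute by Schur's lemma. *)
Lemma resolves_exists X A : simple_ob X ->
  exists (I : finType) (u : I -> mor X A) (u' : I -> mor A X), resolves u u'.
Proof.
move=> sX; have [I [F [sF [b]]]] := Css A.
have H i : exists p : mor X (F i) * mor (F i) X,
    (forall v : mor X (F i), v = p.1 ∘ (p.2 ∘ v)) /\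
    (forall w : mor (F i) X, w = (w ∘ p.1) ∘ p.2).
  case: (EM (isomorphic X (F i))) => [[f [g [gf fg]]]|nis].
    exists (f, g); split=> /= v; first by rewrite compA fg comp1m.
    by rewrite -compA fg compm1.
  exists (0, 0); split=> /= v.
    case: (schur Cab v sX (sF i)) => [->|vi]; first by rewrite !comp0m.
    by case: nis; exists v.
  case: (schur Cab v (sF i) sX) => [->|[v' [e e']]]; first by rewrite !comp0m.
  by case: nis; exists v', v.
pose p i := projT1 (cid (H i)); have pP i := projT2 (cid (H i)).
exists I, (fun i => bp_inj b i ∘ (p i).1), (fun i => (p i).2 ∘ bp_proj b i).
split=> [v|w].
  rewrite -{1}[v]comp1m -(sum_inj_proj b) comp_suml; apply: eq_bigr => i _.
  by rewrite -!compA; congr (_ ∘ _); have [+ _] := pP i; exact.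
rewrite -{1}[w]compm1 -(sum_inj_proj b) comp_sumr; apply: eq_bigr => i _.
by rewrite !compA; congr (_ ∘ _); have [_ +] := pP i; exact.
Qed.

Lemma simple_detects_l X A (v : mor X A) : simple_ob X ->
  (forall w : mor A X, w ∘ v = 0) -> v = 0.
Proof.
move=> sX v0; have [I [u [u' [r _]]]] := resolves_exists A sX.
by rewrite (r v) big1 // => s _; rewrite v0 compm0.
Qed.

Lemma simple_detects_r X A (w : mor A X) : simple_ob X ->
  (forall v : mor X A, w ∘ v = 0) -> w = 0.
Proof.
move=> sX v0; have [I [u [u' [_ r]]]] := resolves_exists A sX.
by rewrite (r w) big1 // => s _; rewrite v0 comp0m.
Qed.

(** Either half of [resolves] implies the other, as morphisms [A -> X] are
    detected by composition with morphisms [X -> A], and conversely. *)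
Lemma resolves_l X A (I : finType) (u : I -> mor X A) (u' : I -> mor A X) :
  simple_ob X -> (forall v : mor X A, v = \sum_s u s ∘ (u' s ∘ v)) ->
  resolves u u'.
Proof.
move=> sX r; split=> // w; apply/subr0_eq/(simple_detects_r sX) => v.
rewrite compBm comp_suml; apply/eqP; rewrite subr_eq0; apply/eqP.
rewrite {1}(r v) comp_sumr; apply: eq_bigr => s _.
by rewrite !compA.
Qed.

Lemma resolves_r X A (I : finType) (u : I -> mor X A) (u' : I -> mor A X) :
  simple_ob X -> (forall w : mor A X, w = \sum_s (w ∘ u s) ∘ u' s) ->
  resolves u u'.
Proof.
move=> sX r; split=> // v; apply/subr0_eq/(simple_detects_l sX) => w.
rewrite compmB comp_sumr; apply/eqP; rewrite subr_eq0; apply/eqP.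
rewrite {1}(r w) comp_suml; apply: eq_bigr => s _.
by rewrite !compA.
Qed.

Lemma comp_scalr X B (u : mor X B) (f : mor X X) :
  simple_ob X -> u ∘ f = scal f *: u.
Proof. by move=> sX; rewrite {1}(scalK kclosed Cab f sX) compmZ compm1. Qed.

Lemma comp_scall X A (g : mor A X) (f : mor X X) :
  simple_ob X -> f ∘ g = scal f *: g.
Proof. by move=> sX; rewrite {1}(scalK kclosed Cab f sX) compZm comp1m. Qed.

Definition bilin X A B (V : lmodType k) (Q : mor X B -> mor A X -> V) :=
  (forall a u v w, Q (a *: u + v) w = a *: Q u w + Q v w) /\
  (forall a u v w, Q w (a *: u + v) = a *: Q w u + Q w v).

Section Bilinear.
Variables (X A B : C) (V : lmodType k) (Q : mor X B -> mor A X -> V).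
Hypothesis Qb : bilin Q.

Lemma bilin0l w : Q 0 w = 0.
Proof. exact: (linear_map0 (fun a u v => proj1 Qb a u v w)). Qed.

Lemma bilinZl a u w : Q (a *: u) w = a *: Q u w.
Proof. exact: (linear_mapZ (fun a u v => proj1 Qb a u v w) a u). Qed.

Lemma bilinZr a u w : Q w (a *: u) = a *: Q w u.
Proof. exact: (linear_mapZ (fun a u v => proj2 Qb a u v w) a u). Qed.

Lemma bilin_suml (I : finType) (u : I -> mor X B) w :
  Q (\sum_i u i) w = \sum_i Q (u i) w.
Proof. exact: (linear_map_sum (fun a u v => proj1 Qb a u v w)). Qed.

Lemma bilin_sumr (I : finType) (u : I -> mor A X) w :
  Q w (\sum_i u i) = \sum_i Q w (u i).
Proof. exact: (linear_map_sum (fun a u v => proj2 Qb a u v w)). Qed.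

(** Expanding [u'] in the [w' t] gives scalar coefficients, which move
    through [Q] to the other argument. *)
Lemma bilin_absorb (I : finType) (w : I -> mor X A) (w' : I -> mor A X) u u' :
  simple_ob X -> resolves w w' ->
  Q u u' = \sum_t Q (u ∘ (u' ∘ w t)) (w' t).
Proof.
move=> sX [_ r]; rewrite {1}(r u') bilin_sumr; apply: eq_bigr => t _.
by rewrite (comp_scalr _ _ sX) (comp_scall _ _ sX) bilinZl bilinZr.
Qed.

End Bilinear.

(** For [T] the identity this says that the sum is independent of the
    families. *)
Lemma resolves_nat X A B (V : lmodType k) (Q : mor X B -> mor A X -> V)
    (T : mor A B) (I J : finType)
    (w : I -> mor X A) (w' : I -> mor A X)
    (z : J -> mor X B) (z' : J -> mor B X) :
  simple_ob X -> bilin Q -> resolves w w' -> resolves z z' ->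
  \sum_t Q (T ∘ w t) (w' t) = \sum_r Q (z r) (z' r ∘ T).
Proof.
move=> sX Qb rw rz.
under [RHS]eq_bigr => r _ do rewrite (bilin_absorb Qb _ _ sX rw).
rewrite exchange_big; apply: eq_bigr => t _ /=.
rewrite -(bilin_suml Qb) {1}((proj1 rz) (T ∘ w t)).
by congr (Q _ _); apply: eq_bigr => r _; rewrite !compA.
Qed.

End Resolutions.

(** * Dual bases and canonical sums *)

Section DualBases.
Variables (k : fieldType) (C : linear_category k).
Hypothesis kclosed : forall p : {poly k}, size p != 1%N -> exists x, root p x.
Hypothesis Cab : is_abelian C.
Hypothesis Css : is_semisimple C.
Implicit Types A B : C.

Lemma scalE (X : C) a : simple_ob X -> scal (a *: idmor X) = a.
Proof. by move=> sX; rewrite scalZ (scal_id (proj1 sX)) mulr1. Qed.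

Lemma sum_delta (V : lmodType k) n (F : 'I_n -> V) i :
  \sum_j (i == j)%:R *: F j = F i.
Proof.
rewrite (bigD1 i) //= eqxx scale1r big1 ?addr0 // => j ji.
by rewrite eq_sym (negPf ji) scale0r.
Qed.

Lemma basis_expand (V : vectType k) (b : basis_of_space V) (v : V) :
  v = \sum_i coord (val b) i v *: tnth (val b) i.
Proof.
rewrite {1}(coord_basis (valP b) (memvf v)); apply: eq_bigr => i _.
by rewrite (tnth_nth 0).
Qed.

Lemma coord_tnth (V : vectType k) (b : basis_of_space V) i j :
  coord (val b) i (tnth (val b) j) = (i == j)%:R.
Proof.
rewrite (tnth_nth 0) -val_eqE eq_sym /= coord_free //.
exact: basis_free (valP b).
Qed.

Lemma biorthogonal_resolves_l (X A : C) (b : basis_of_space (mor X A)) u' :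
  simple_ob X ->
  (forall i j, u' i ∘ tnth (val b) j = (i == j)%:R *: idmor X) ->
  resolves (tnth (val b)) u'.
Proof.
move=> sX bi; apply: (resolves_l Cab Css) => // v.
rewrite {1}(basis_expand b v); apply: eq_bigr => i _.
rewrite {2}(basis_expand b v) comp_sumr.
under [in RHS]eq_bigr => j _ do rewrite compmZ bi scalerA mulrC -scalerA.
by rewrite sum_delta compmZ compm1.
Qed.

Lemma biorthogonal_resolves_r (X A : C) (b : basis_of_space (mor A X)) u :
  simple_ob X ->
  (forall i j, tnth (val b) j ∘ u i = (i == j)%:R *: idmor X) ->
  resolves u (tnth (val b)).
Proof.
move=> sX bi; apply: (resolves_r Cab Css) => // v.
rewrite {1}(basis_expand b v); apply: eq_bigr => i _.
rewrite {2}(basis_expand b v) comp_suml.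
under [in RHS]eq_bigr => j _ do rewrite compZm bi scalerA mulrC -scalerA.
by rewrite sum_delta compZm comp1m.
Qed.

(** The dual basis is read off from any resolving families by taking
    coordinates. *)
Lemma dual_basis_l (X A : C) (b : basis_of_space (mor X A)) : simple_ob X ->
  exists u', (forall i j, u' i ∘ tnth (val b) j = (i == j)%:R *: idmor X).
Proof.
move=> sX; have [I [w [w' r]]] := resolves_exists Cab Css A sX.
exists (fun i => \sum_s coord (val b) i (w s) *: w' s) => i j.
rewrite comp_suml -(coord_tnth b) {2}((proj1 r) (tnth (val b) j)) linear_sum.
rewrite scaler_suml; apply: eq_bigr => s _ /=.
rewrite compZm (comp_scalr kclosed Cab _ _ sX) linearZ /= mulrC -scalerA.
by rewrite -(scalK kclosed Cab _ sX).
Qed.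

Lemma dual_basis_r (X A : C) (b : basis_of_space (mor A X)) : simple_ob X ->
  exists u, (forall i j, tnth (val b) j ∘ u i = (i == j)%:R *: idmor X).
Proof.
move=> sX; have [I [w [w' r]]] := resolves_exists Cab Css A sX.
exists (fun i => \sum_s coord (val b) i (w' s) *: w s) => i j.
rewrite comp_sumr -(coord_tnth b) {2}((proj2 r) (tnth (val b) j)) linear_sum.
rewrite scaler_suml; apply: eq_bigr => s _ /=.
rewrite compmZ (comp_scall kclosed Cab _ _ sX) linearZ /= mulrC -scalerA.
by rewrite -(scalK kclosed Cab _ sX).
Qed.

Definition std_basis (V : vectType k) : basis_of_space V :=
  exist _ (vbasis fullv) (vbasisP fullv).

Section Simples.
Variables (Irr : finType) (S : Irr -> C).
Hypothesis hS : simple_representatives S.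

Let sS X : simple_ob (S X) := sr_simple hS X.

Lemma hom_simple_neq X Y (f : mor (S X) (S Y)) : X != Y -> f = 0.
Proof.
move=> ne; case: (schur Cab f (sS X) (sS Y)) => // fi.
by case/eqP: ne; apply: (sr_inj hS); exists f.
Qed.

Definition cdual X A : 'I__ -> mor A (S X) :=
  projT1 (cid (dual_basis_l (std_basis (mor (S X) A)) (sS X))).

Lemma cdualP X A i j :
  cdual i ∘ tnth (val (std_basis (mor (S X) A))) j = (i == j)%:R *: idmor _.
Proof.
exact: (projT2 (cid (dual_basis_l (std_basis (mor (S X) A)) (sS X)))).
Qed.

(** The value of [Q] on the canonical element, by [csumE] the same for all dual
    families. *)
Definition canonical_sum X A (V : lmodType k)
    (Q : mor (S X) A -> mor A (S X) -> V) : V :=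
  \sum_i Q (tnth (val (std_basis (mor (S X) A))) i) (cdual i).

Lemma csum_resolves X A :
  resolves (tnth (val (std_basis (mor (S X) A)))) (@cdual X A).
Proof. exact/biorthogonal_resolves_l/cdualP/sS. Qed.

Lemma csumE X A (V : lmodType k) (Q : mor (S X) A -> mor A (S X) -> V)
    (I : finType) (u : I -> mor (S X) A) (u' : I -> mor A (S X)) :
  bilin Q -> resolves u u' -> \sum_s Q (u s) (u' s) = canonical_sum Q.
Proof.
move=> Qb r.
have := resolves_nat kclosed Cab (idmor A) (sS X) Qb r (csum_resolves X A).
under eq_bigr => s _ do rewrite comp1m.
by move=> ->; apply: eq_bigr => s _; rewrite compm1.
Qed.

Lemma csum_nat X A B (V : lmodType k) (Q : mor (S X) B -> mor A (S X) -> V)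
    (T : mor A B) :
  bilin Q -> canonical_sum (fun u u' => Q (T ∘ u) u') = canonical_sum (fun z z'
    => Q z (z' ∘ T)).
Proof.
move=> Qb.
exact: (resolves_nat kclosed Cab T (sS X) Qb (csum_resolves _ _)
  (csum_resolves _ _)).
Qed.

Lemma eq_csum X A (V : lmodType k) (Q Q' : mor (S X) A -> mor A (S X) -> V) :
  (forall u u', Q u u' = Q' u u') -> canonical_sum Q = canonical_sum Q'.
Proof. by move=> e; apply: eq_bigr => i _; rewrite e. Qed.

(** This is tested on each simple summand of [A], where Schur's lemma leaves
    the terms of one [X]. *)
Lemma csum_total A : \sum_X canonical_sum (fun (u : mor (S X) A) u' => u ∘ u')
  = idmor A.
Proof.
have [I [F [sF [b]]]] := Css A.
rewrite -[LHS]compm1 -(sum_inj_proj b) comp_sumr; apply: eq_bigr => i _.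
rewrite compA; congr (_ ∘ _); rewrite comp_suml.
have [X [f [g [gf fg]]]] := sr_complete hS (sF i).
rewrite (bigD1 X) //= big1 ?addr0 => [|Y YX]; last first.
  rewrite comp_suml big1 // => s _.
  rewrite -compA -[_ ∘ bp_inj _ _]compm1 -gf (compA _ g)
    (hom_simple_neq (_ ∘ g)).
    by rewrite comp0m compm0.
  by rewrite eq_sym.
apply: (split_epi_cancel gf).
by rewrite comp_suml [RHS](proj1 (csum_resolves X A)) comp_suml; apply: eq_bigr
  => s _;
  rewrite -!compA.
Qed.

(** By naturality both vertices [gm j] and [gm j'] move into the second
    argument of [Q], where the sum over [j] is the identity by
    [csum_total]. *)
Lemma csum_decomp (G : C -> C)
    (gm : forall A B : C, mor A B -> mor (G A) (G B)) X B (V : lmodType k)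
    (Q : mor (S X) (G B) -> mor (G B) (S X) -> V) :
  (forall A D, linear (@gm A D)) ->
  (forall A D E (g : mor D E) (f : mor A D),
    gm _ _ (g ∘ f) = gm _ _ g ∘ gm _ _ f) ->
  (forall A, gm _ _ (idmor A) = idmor (G A)) ->
  bilin Q ->
  \sum_Z canonical_sum (fun (j : mor (S Z) B) j' =>
     canonical_sum (fun (u : mor (S X) (G (S Z))) u' => Q (gm _ _ j ∘ u) (u' ∘
       gm _ _ j')))
  = canonical_sum Q.
Proof.
move=> glin gcomp gid Qb.
have gsum A D (I : finType) (F : I -> mor A D) :
    gm _ _ (\sum_i F i) = \sum_i gm _ _ (F i).
  apply: (big_morph (@gm A D)) => [u v|].
    by have := glin A D 1 u v; rewrite !scale1r.
  by have := glin A D (-1) 0 0; rewrite scaleN1r oppr0 add0r scaleN1r addNr.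
have step Z (j : mor (S Z) B) j' :
    canonical_sum (fun (u : mor (S X) (G (S Z))) u' => Q (gm _ _ j ∘ u) (u' ∘
      gm _ _ j'))
    = canonical_sum (fun z z' => Q z (z' ∘ gm _ _ (j ∘ j'))).
  rewrite (csum_nat (gm _ _ j) (Q := fun z u' => Q z (u' ∘ gm _ _ j'))).
    by apply: eq_csum => z z'; rewrite gcomp !compA.
  split=> a u v w; first by rewrite (proj1 Qb).
  by rewrite comp_linear_l (proj2 Qb).
under eq_bigr => Z _ do rewrite (eq_csum (step Z)).
rewrite /canonical_sum; under eq_bigr => Z _ do rewrite exchange_big /=.
rewrite exchange_big /=; apply: eq_bigr => t _.
under eq_bigr => Z _ do rewrite -(bilin_sumr Qb) -comp_sumr -gsum.
rewrite -(bilin_sumr Qb) -comp_sumr -gsum.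
by have := csum_total B; rewrite /canonical_sum => ->; rewrite gid compm1.
Qed.

(** With a dual basis of [Hom(A, S X)] each term of the sum is [v]. *)
Lemma csum_scal X A (V : lmodType k) (v : V) :
  canonical_sum (fun (u : mor (S X) A) u' => scal (u' ∘ u) *: v)
  = (\dim (fullv : {vspace mor A (S X)}))%:R *: v.
Proof.
pose b := std_basis (mor A (S X)).
have [u bi] := dual_basis_r b (sS X).
have r := biorthogonal_resolves_r (sS X) bi.
rewrite -(csumE _ r) => [|].
  under eq_bigr => s _ do rewrite bi eqxx scale1r (scal_id (proj1 (sS X)))
    scale1r.
  by rewrite sumr_const card_ord scaler_nat.
split=> a f g h; rewrite ?comp_linear_l ?comp_linear_r.
  by rewrite (scal_linear a) scalerDl -scalerA.
by rewrite (scal_linear a) scalerDl -scalerA.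
Qed.

End Simples.
End DualBases.

(** * Linearity of the building blocks *)

Section TailLinearity.
Variables (k : fieldType) (C : pivotal_category k).
Implicit Types (A B P Q R W X Y Z T : C) (a : k).

Lemma splitt_lin Y W Z A : linear (fun u : mor Y (W ⊗ Z) => splitt u A).
Proof. by move=> a u v; rewrite !splittE !(tensm_linear_l, comp_linear_r). Qed.

Lemma merget_lin P Q R A : linear (fun p : mor (P ⊗ Q) R => merget p A).
Proof. by move=> a u v; rewrite !mergetE !(tensm_linear_l, comp_linear_l). Qed.

Lemma bendr_lin Z Y X A : linear (fun g : mor (Z ⊗ Y) X => bendr g A).
Proof. by move=> a u v; rewrite !bendrE merget_lin tensm_linear_r comp_linear_l
  comp_linear_r. Qed.

Lemma bendl_lin W Z Y A : linear (fun g : mor (W ⊗ Z) Y => bendl g A).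
Proof. by move=> a u v; rewrite !bendlE merget_lin tensm_linear_r comp_linear_l
  comp_linear_r. Qed.

Lemma unbendr_lin Z Y X : linear (@unbendr k C Z Y X).
Proof.
move=> a u v; apply: merget_inj; rewrite merget_lin !unbendrE merget_lin.
by rewrite tensm_linear_r comp_linear_l comp_linear_r.
Qed.

Lemma bendr_mor_lin Z Y X : linear (@bendr_mor k C Z Y X).
Proof. by move=> a u v; apply: merget_inj; rewrite merget_lin !bendr_morE
  bendr_lin. Qed.

Lemma e_block_bilin X Z Y A :
  bilin (fun (u : mor X (Z ⊗ Y)) (g : mor (Z ⊗ Y) X) => e_block u g A).
Proof.
split=> a u v w; rewrite !e_blockE; first by rewrite splitt_lin comp_linear_r.
by rewrite bendr_lin tensm_linear_r comp_linear_l.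
Qed.

Lemma hb_block_bilin Y W Z A :
  bilin (fun (u : mor Y (W ⊗ Z)) (g : mor (W ⊗ Z) Y) => hb_block u g A).
Proof.
split=> a u v w; rewrite !hb_blockE; first by rewrite splitt_lin comp_linear_l.
by rewrite bendl_lin tensm_linear_r comp_linear_r.
Qed.

Lemma splitt3_lin X P Q R A :
  linear (fun u : mor X (P ⊗ (Q ⊗ R)) => splitt3 u A).
Proof. by move=> a u v; rewrite !splitt3E splitt_lin comp_linear_r. Qed.

Lemma merget3_lin X P Q R A :
  linear (fun g : mor (P ⊗ (Q ⊗ R)) X => merget3 g A).
Proof. by move=> a u v; rewrite !merget3E merget_lin comp_linear_l. Qed.

Lemma e_block3_bilin X Z Y Y' A :
  bilin (fun (u : mor X (Z ⊗ (Y ⊗ Y'))) (g : mor (Z ⊗ (Y ⊗ Y')) X) => e_block3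
    u g A).
Proof. by split=> a u v w; rewrite !e_block3_tens (proj1 (e_block_bilin _ _ _
  _), proj2 (e_block_bilin _ _ _ _)). Qed.

Lemma hb_block3_bilin Y W W' Z A :
  bilin (fun (u : mor Y (W ⊗ (W' ⊗ Z))) (g : mor (W ⊗ (W' ⊗ Z)) Y) => hb_block3
    u g A).
Proof.
split=> a u v w; rewrite !hb_block3E; first by rewrite splitt3_lin
  comp_linear_l.
rewrite !bendl3E merget3_lin tensm_linear_r comp_linear_l comp_linear_r.
by rewrite tensm_linear_r comp_linear_r.
Qed.

Lemma crossing_bilin X W Z Y A :
  bilin (fun (u : mor X (W ⊗ (Z ⊗ Y))) (g : mor (W ⊗ (Z ⊗ Y)) X) => crossing u
    g A).
Proof.
split=> a u v w; rewrite !crossingE; first by rewrite splitt3_lin comp_linear_r.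
rewrite !legE !bendl2E merget3_lin tensm_linear_r comp_linear_l comp_linear_r.
by rewrite tensm_linear_r comp_linear_r !tensm_linear_r comp_linear_l.
Qed.

End TailLinearity.

(** * Dimensions and the pairings of the definitions *)

Section Pairings.
Variables (k : fieldType) (C : spherical_fusion_category k).
Hypothesis kclosed : forall p : {poly k}, size p != 1%N -> exists x, root p x.
Implicit Types (A B P Q R W T : C) (a : k).

Let Cab := sph_abelian C.
Let Css : is_semisimple C := @sph_semisimple k C.

Lemma unit_scal (f : mor (unit_ob : C) unit_ob) :
  f = scalar_of f *: idmor unit_ob.
Proof. exact: (scalK kclosed Cab f (sph_simple_one C)). Qed.

Lemma scalar_idP A a : simple_ob A -> a *: idmor A = 0 -> a = 0.
Proof. by move=> sA /eqP; rewrite scaler_eq0 => /orP[/eqP //|/eqP/(proj1 sA)].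
  Qed.

Lemma qdim_r (X : C) A : evr X A ∘ coevt X A = qdim X *: idmor A.
Proof. by apply: cup_cap; rewrite [LHS]unit_scal. Qed.

Lemma qdim_l (X : C) A : evt X A ∘ coevr X A = qdim X *: idmor A.
Proof.
apply: cup_cap; rewrite [LHS]unit_scal /qdim; congr (scalar_of _ *: _).
have := sph_spherical (idmor X).
by rewrite !tensm1 !compm1.
Qed.

(** If the dimension were zero, every [w : X ⊗ dual X -> 1] would vanish on
    [coev X], because by Schur's lemma it is a multiple of [ev' X]. As the
    unit object is simple, [coev X] would be zero. *)
Lemma qdim_neq0 (X : C) : simple_ob X -> qdim X != 0.
Proof.
move=> sX; apply/eqP => d0; have s1 := sph_simple_one C.
have c0 : coev X = 0.
  apply: (simple_detects_l Cab Css s1) => w.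
  pose t A : mor (X ⊗ A) (X ⊗ A) := cupt w (X ⊗ A) ∘ (X ◁ coevr X A).
  have ts : @strong k C [:: X] [:: X] t.
    apply: (@strong_comp k C _ [:: X; dual X; X]).
      exact: (strong_cup _ [:: X]).
    exact/(@strong_whisk _ _ X [::] [:: dual X; X])/(strong_cap _ [::]).
  have tE := of_tailE ts.
  set m := of_tail _ in tE.
  have wE A : cupt w A = scal m *: evr X A.
    have : evr X A ∘ (m ▷ (dual X ⊗ A)) = cupt w A.
      rewrite tE; rewrite /t (compA (evr _ _)) -cup_nat -compA.
      by rewrite -!whiskl_comp snake_r_dual !tensm1 compm1.
    rewrite {1}(scalK kclosed Cab m sX) => <-.
    by rewrite tensZm tensm1 compmZ compm1.
  have : cupt w unit_ob ∘ coevt X unit_ob = scalar_of (w ∘ coev X) *: idmor _.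
    by apply: cup_cap; exact: unit_scal.
  rewrite wE compZm qdim_r d0 scale0r scaler0 => e.
  by rewrite [LHS]unit_scal -e.
apply: (proj1 sX); rewrite -(zigzag X) c0 tens0m.
by rewrite compm0 comp0m.
Qed.

Lemma assi_pentagon (W X Y Z : C) :
  (assi W X Y ▷ Z) ∘ (assi W (X ⊗ Y) Z ∘ (W ◁ assi X Y Z))
  = assi (W ⊗ X) Y Z ∘ assi W X (Y ⊗ Z).
Proof.
have K : ((W ◁ ass X Y Z) ∘ ass W (X ⊗ Y) Z)
    ∘ (assi W (X ⊗ Y) Z ∘ (W ◁ assi X Y Z)) = idmor _.
  by rewrite -!compA (comp2_id (assiK _ _ _)) -whiskl_comp assiK tensm1.
have e := pentagon_assi W X Y Z.
rewrite -[RHS]compm1 -K -!compA.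
rewrite (compA (W ◁ _)) (compA (assi W X _)) e -!compA.
by rewrite (comp2_id (assK _ _ _)).
Qed.

Lemma scalar_id_inj A a b : simple_ob A ->
  a *: idmor A = b *: idmor A -> a = b.
Proof.
move=> sA e; apply/subr0_eq/(scalar_idP sA).
by rewrite scalerBl e subrr.
Qed.

Lemma scal_tail (X : C) (f : mor X X) A : simple_ob X ->
  f ▷ A = scal f *: idmor (X ⊗ A).
Proof. by move=> sX; rewrite {1}(scalK kclosed Cab f sX) tensZm tensm1. Qed.

(** The diagram of the pairing is the left trace of an endomorphism of [Y]. *)
Lemma left_pairing (W Y Z : C) (j : mor (dual Y ⊗ W) (dual Z))
    (i : mor Y (W ⊗ Z)) : simple_ob Y ->
  scalar_of (ev Z ∘ (j ▷ Z) ∘ assi (dual Y) W Z ∘ (dual Y ◁ i) ∘ coev' Y)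
  = scal (unbendl j ∘ i) * qdim Y.
Proof.
move=> sY; apply: (scalar_id_inj (sph_simple_one C)); set A := unit_ob.
pose p := ev Z ∘ ((j ▷ Z) ∘ assi (dual Y) W Z).
pose c := (dual Y ◁ i) ∘ coev' Y.
have pc : p ∘ c = scalar_of (ev Z ∘ (j ▷ Z) ∘ assi (dual Y) W Z
    ∘ (dual Y ◁ i) ∘ coev' Y) *: idmor A.
  by rewrite -unit_scal /p /c !compA.
rewrite -(cup_cap pc).
have -> : cupt p A = evt Z A ∘ (merget j (Z ⊗ A) ∘ (dual Y ◁ ass W Z A)).
  have K : (dual Y ◁ assi W Z A) ∘ (dual Y ◁ ass W Z A) = idmor _.
    by rewrite -whiskl_comp assK tensm1.
  rewrite -[LHS]compm1 -K !compA; congr (_ ∘ _).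
  rewrite !cuptE mergetE /p !whiskr_comp -!compA assi_pentagon; congr (_ ∘ (_ ∘
    _)).
  by rewrite !compA -assi_nat tensm1.
have -> : capt c A = (dual Y ◁ (i ▷ A)) ∘ coevr Y A.
  rewrite !captE /c whiskr_comp -!compA.
  by rewrite (comp2_rev (ass_nat _ _ _)).
nest; rewrite (compA (dual Y ◁ _)) -whiskl_comp -splittE -bendl_unbendl.
rewrite (comp2_rev (bendl_ev _ _)) (compA (dual Y ◁ _)) -whiskl_comp.
rewrite mergetE splittE -!compA (comp2_id (assK _ _ _)) -whiskr_comp (scal_tail
  _ _ sY).
by rewrite tensmZ tensm1 compZm comp1m compmZ (compA (evt Y A)) qdim_l
  compm1 scalerA compm1.
Qed.

(** The diagram of the pairing is the right trace of an endomorphism of [X]. *)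
Lemma right_pairing (X Y Z : C) (j : mor X (Z ⊗ Y))
    (i : mor (Y ⊗ dual X) (dual Z)) : simple_ob X ->
  scalar_of (ev' Z ∘ (Z ◁ i) ∘ ass Z Y (dual X) ∘ (j ▷ dual X) ∘ coev X)
  = scal (unbendr i ∘ j) * qdim X.
Proof.
move=> sX; apply: (scalar_id_inj (sph_simple_one C)); set A := unit_ob.
pose p := ev' Z ∘ ((Z ◁ i) ∘ ass Z Y (dual X)).
pose c := (j ▷ dual X) ∘ coev X.
have pc : p ∘ c = scalar_of (ev' Z ∘ (Z ◁ i) ∘ ass Z Y (dual X)
    ∘ (j ▷ dual X) ∘ coev X) *: idmor A.
  by rewrite -unit_scal /p /c !compA.
rewrite -(cup_cap pc).
have -> : cupt p A = evr Z A ∘ ((Z ◁ merget i A) ∘ ass Z Y (dual X ⊗ A)).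
  apply: (split_epi_cancel (assiK _ _ _)).
  rewrite !cuptE mergetE /p !whiskr_comp whiskl_comp -!compA.
  rewrite assK compm1 -pentagon_ass (comp2_id (whisk_id (assK _ _ _))).
  by rewrite -(comp2_rev (ass_nat _ _ _)) (comp2_id (assK _ _ _)).
have -> : capt c A = (j ▷ (dual X ⊗ A)) ∘ coevt X A.
  rewrite !captE /c whiskr_comp -!compA.
  by rewrite (comp2_rev (whiskr_tens _ _ _)).
nest; rewrite (compA (ass Z Y _)) -splittE -bendr_unbendr.
rewrite (comp2_rev (bendr_ev _ _)) mergetE splittE -!compA (comp2_id (assK _ _
  _)).
rewrite (compA (_ ▷ _)) -whiskr_comp (scal_tail _ _ sX).
by rewrite !compm1 compZm comp1m compmZ qdim_r scalerA.
Qed.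

Section Bases.
Variables (Irr : finType) (S : Irr -> C).
Hypothesis hS : simple_representatives S.
Let sS X : simple_ob (S X) := sr_simple hS X.

(** By [left_pairing] a dual vector for the pairing is the bent composition
    dual divided by the dimension of [Y]; such a vector exists, so that the
    choice in [dual_vector] is not the default value. *)
Lemma hb_dual_resolves (W : C) (Y Z : Irr)
    (b : basis_of_space (mor (S Y) (W ⊗ S Z))) :
  resolves (tnth (val b))
    (fun i => qdim (S Y) *: unbendl (dual_vector (@hb_pairing k C Irr S W Y Z)
      b i)).
Proof.
have d0 := qdim_neq0 (sS Y).
have [g bi] := dual_basis_l kclosed Cab Css b (sS Y).
apply: (biorthogonal_resolves_l Cab Css) => // i j.
rewrite /dual_vector; case: xgetP => [v _ H | /(_ (bendl_mor ((qdim (S Y))^-1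
  *: g i)))].
  rewrite compZm (scalK kclosed Cab (_ ∘ _) (sS Y)) scalerA; congr (_ *: _).
  by rewrite mulrC -left_pairing //; exact: H.
case=> j'; rewrite /hb_pairing left_pairing // bendl_morK compZm bi scalerA.
by rewrite scalE // mulrAC mulVf // mul1r.
Qed.

(** Here the basis is on the side of the bent vertices, and the chosen dual
    vectors are the unbent ones; the witness for the choice is built as in
    [dual_basis_r]. *)
Lemma e_dual_resolves (Y X Z : Irr)
    (b : basis_of_space (mor (S Y ⊗ dual (S X)) (dual (S Z)))) :
  resolves (fun i => dual_vector (@e_pairing k C Irr S Y X Z) b i)
    (fun i => qdim (S X) *: unbendr (tnth (val b) i)).
Proof.
have d0 := qdim_neq0 (sS X).
have [I [w [w' rw]]] := resolves_exists Cab Css (S Z ⊗ S Y) (sS X).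
set u := fun i => dual_vector _ b i.
have bi i j : scal (unbendr (tnth (val b) j) ∘ u i) * qdim (S X) = (i == j)%:R.
  rewrite /u /dual_vector; case: xgetP => [v _ H|].
    by rewrite -right_pairing //; exact: H.
  move=> /(_ ((qdim (S X))^-1 *:
     \sum_t coord (val b) i (bendr_mor (w' t)) *: w t)).
  case=> j'; rewrite /e_pairing right_pairing // compmZ scalZ mulrAC.
  rewrite mulVf // mul1r -(coord_tnth b).
  have key (p : mor (S Y ⊗ dual (S X)) (dual (S Z))) :
      scal (unbendr p ∘ (\sum_t coord (val b) i (bendr_mor (w' t)) *: w t))
      = coord (val b) i p; last exact: key.
  rewrite -[X in coord _ _ X]unbendrK; set r := unbendr p.
  have -> : bendr_mor r = \sum_t scal (r ∘ w t) *: bendr_mor (w' t).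
    rewrite {1}((proj2 rw) r).
    rewrite (linear_map_sum (@bendr_mor_lin _ _ _ _ _)); apply: eq_bigr => t _.
    by rewrite (comp_scall kclosed Cab) // (linear_mapZ (@bendr_mor_lin _ _ _ _
      _)).
  rewrite comp_sumr (linear_map_sum (@scal_linear _ _ _)) linear_sum.
  apply: eq_bigr => t _ /=.
  by rewrite compmZ scalZ linearZ /= mulrC.
apply: (resolves_r Cab Css) => // v.
rewrite -[v]bendr_morK; set p := bendr_mor v.
rewrite {1}(basis_expand b p) (linear_map_sum (@unbendr_lin _ _ _ _ _)).
apply: eq_bigr => i _; rewrite (linear_mapZ (@unbendr_lin _ _ _ _ _)).
rewrite (comp_scall kclosed Cab) // scalerA; congr (_ *: _).
rewrite {2}(basis_expand b p) (linear_map_sum (@unbendr_lin _ _ _ _ _))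
  comp_suml.
rewrite (linear_map_sum (@scal_linear _ _ _)) mulr_suml.
rewrite (bigD1 i) //= big1 ?addr0 => [|j ji].
  rewrite (linear_mapZ (@unbendr_lin _ _ _ _ _)) compZm scalZ -mulrA bi eqxx.
  by rewrite mulr1.
rewrite (linear_mapZ (@unbendr_lin _ _ _ _ _)) compZm scalZ -mulrA bi eq_sym.
by rewrite (negPf ji) mulr0.
Qed.

End Bases.

End Pairings.

(** * The object I(1) *)

Section Induced.
Variables (k : fieldType) (C : spherical_fusion_category k).
Hypothesis kclosed : forall p : {poly k}, size p != 1%N -> exists x, root p x.
Variables (Irr : finType) (S : Irr -> C).
Hypothesis hS : simple_representatives S.
Variable sq : Irr -> k.
Hypothesis hsq : forall X, sq X ^+ 2 = qdim (S X).
Variables (I1 : C) (B : biproduct (XXdual S) I1).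
Implicit Types (A D W O : C).

Let Cab := sph_abelian C.
Let Css : is_semisimple C := @sph_semisimple k C.
Let sS X : simple_ob (S X) := sr_simple hS X.

Local Notation csum := (canonical_sum kclosed Cab Css hS).

Lemma sq_neq0 X : sq X != 0.
Proof.
by apply/eqP => e; have := qdim_neq0 kclosed (sS X); rewrite -hsq e expr0n eqxx.
Qed.

Lemma csum_iso X (A D : C) (V : lmodType k)
    (Q : mor (S X) D -> mor D (S X) -> V) (T : mor A D) (T' : mor D A) :
  bilin Q -> T ∘ T' = idmor D ->
  csum (fun (u : mor (S X) A) u' => Q (T ∘ u) (u' ∘ T')) = csum Q.
Proof.
move=> Qb TT.
rewrite (csum_nat kclosed Cab Css hS T (Q := fun z u' => Q z (u' ∘ T'))).
  by apply: (eq_csum kclosed Cab Css hS) => z z'; rewrite -compA TT compm1.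
split=> a u v w; first by rewrite (proj1 Qb).
by rewrite comp_linear_l (proj2 Qb).
Qed.

Lemma comp_csum X A (P D E : C) (Q : mor (S X) A -> mor A (S X) -> mor P D)
    (g : mor D E) : g ∘ csum Q = csum (fun u u' => g ∘ Q u u').
Proof. by rewrite /canonical_sum comp_sumr. Qed.

Lemma csum_comp X A (P D E : C) (Q : mor (S X) A -> mor A (S X) -> mor P D)
    (g : mor E P) : csum Q ∘ g = csum (fun u u' => Q u u' ∘ g).
Proof. by rewrite /canonical_sum comp_suml. Qed.

Lemma whisk_csum X A (P D W : C) (Q : mor (S X) A -> mor A (S X) -> mor P D) :
  W ◁ csum Q = csum (fun u u' => W ◁ Q u u').
Proof. by rewrite /canonical_sum tens_sumr. Qed.

Lemma csum_whiskl W X D (V : lmodType k)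
    (Q : mor (S X) (W ⊗ D) -> mor (W ⊗ D) (S X) -> V) : bilin Q ->
  \sum_Y csum (fun (j : mor (S Y) D) j' =>
    csum (fun (u : mor (S X) (W ⊗ S Y)) u' =>
      Q ((W ◁ j) ∘ u) (u' ∘ (W ◁ j')))) = csum Q.
Proof.
apply: (csum_decomp kclosed Cab Css hS (G := tens W)
  (gm := fun (A D : C) (f : mor A D) => W ◁ f)).
- by move=> *; exact: tensm_linear_r.
- by move=> *; exact: whiskl_comp.
- by move=> *; exact: tensm1.
Qed.

Lemma csum_whiskr O X D (V : lmodType k)
    (Q : mor (S X) (D ⊗ O) -> mor (D ⊗ O) (S X) -> V) : bilin Q ->
  \sum_Y csum (fun (j : mor (S Y) D) j' =>
    csum (fun (u : mor (S X) (S Y ⊗ O)) u' =>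
      Q ((j ▷ O) ∘ u) (u' ∘ (j' ▷ O)))) = csum Q.
Proof.
apply: (csum_decomp kclosed Cab Css hS (G := fun A => tens A O)
  (gm := fun (A D : C) (f : mor A D) => f ▷ O)).
- by move=> *; exact: tensm_linear_l.
- by move=> *; exact: whiskr_comp.
- by move=> *; exact: tensm1.
Qed.

Definition injt X A : mor (S X ⊗ (dual (S X) ⊗ A)) (I1 ⊗ A) :=
  merget (bp_inj B X : mor (S X ⊗ dual (S X)) I1) A.

Definition projt X A : mor (I1 ⊗ A) (S X ⊗ (dual (S X) ⊗ A)) :=
  splitt (bp_proj B X : mor I1 (S X ⊗ dual (S X))) A.

Lemma projt_injt X A : projt X A ∘ injt X A = idmor _.
Proof.
rewrite /projt /injt splittE mergetE -?compA (compA (_ ▷ A)) -whiskr_comp.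
by rewrite proj_inj tensm1 comp1m assiK.
Qed.

Lemma projt_injt0 X Z A : X != Z -> projt Z A ∘ injt X A = 0.
Proof.
move=> XZ; rewrite /projt /injt splittE mergetE -?compA (compA (_ ▷ A))
  -whiskr_comp.
by rewrite proj_inj0 // tens0m comp0m compm0.
Qed.

Lemma sum_injt_projt A : \sum_X injt X A ∘ projt X A = idmor (I1 ⊗ A).
Proof.
rewrite -tensm1 -(sum_inj_proj B) tens_suml; apply: eq_bigr => X _.
rewrite /projt /injt splittE mergetE -?compA (comp2_id (assK _ _ _)).
by rewrite -whiskr_comp.
Qed.

Lemma tail_ext A D (F G : mor (I1 ⊗ A) D) :
  (forall X, F ∘ injt X A = G ∘ injt X A) -> F = G.
Proof.
move=> e; rewrite -[F]compm1 -[G]compm1 -sum_injt_projt !comp_sumr.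
by apply: eq_bigr => X _; rewrite !compA e.
Qed.

Lemma block_injt A D (M : forall X (Z : Irr), mor (S X ⊗ (dual (S X) ⊗ A)) D) X
  :
  (\sum_Y \sum_Z M Y Z ∘ projt Y A) ∘ injt X A = \sum_Z M X Z.
Proof.
rewrite comp_suml (bigD1 X) //= [T in _ + T]big1 ?addr0 => [|Y YX].
  rewrite comp_suml; apply: eq_bigr => Z _.
  by rewrite -compA projt_injt compm1.
rewrite comp_suml big1 // => Z _.
by rewrite -compA projt_injt0 ?compm0 // eq_sym.
Qed.

Lemma injt_nat X A D (h : mor A D) :
  (I1 ◁ h) ∘ injt X A = injt X D ∘ (S X ◁ (dual (S X) ◁ h)).
Proof. by rewrite /injt merget_nat. Qed.

Definition e_entry X Z O A := csum (fun (u : mor (S X) (S Z ⊗ O)) g => e_block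
  u g A).
Definition hb_entry X W Z A := csum (fun (u : mor (S X) (W ⊗ S Z)) g =>
  hb_block u g A).

(** For [O = S Y] this is [e_Y] divided by the dimension of [Y], see
    [e_mor_tail]. *)
Definition encircle O A : mor (I1 ⊗ A) (I1 ⊗ A) :=
  locked_with tail_key
  (\sum_X \sum_Z ((sq Z / sq X) *: (injt Z A ∘ e_entry X Z O A)) ∘ projt X A).

Definition braid W A : mor (I1 ⊗ (W ⊗ A)) (W ⊗ (I1 ⊗ A)) :=
  locked_with tail_key
  (\sum_X \sum_Z ((sq Z / sq X) *: ((W ◁ injt Z A) ∘ hb_entry X W Z A))
     ∘ projt X (W ⊗ A)).

Lemma encircle_injt O A X :
  encircle O A ∘ injt X A
  = \sum_Z (sq Z / sq X) *: (injt Z A ∘ e_entry X Z O A).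
Proof. by rewrite /encircle unlock block_injt. Qed.

Lemma braid_injt W A X :
  braid W A ∘ injt X (W ⊗ A)
  = \sum_Z (sq Z / sq X) *: ((W ◁ injt Z A) ∘ hb_entry X W Z A).
Proof. by rewrite /braid unlock block_injt. Qed.

Lemma e_component_tail (Y X Z : Irr)
    (b : basis_of_space (mor (S Y ⊗ dual (S X)) (dual (S Z)))) A :
  ass (S Z) (dual (S Z)) A ∘ ((e_component sq b ▷ A)
    ∘ assi (S X) (dual (S X)) A)
  = (qdim (S Y) * (sq Z / sq X)) *: e_entry X Z (S Y) A.
Proof.
have term i j : ass (S Z) (dual (S Z)) A ∘ (((((S Z ◁ i) ∘
      ass (S Z) (S Y) (dual (S X))) ∘ (j ▷ dual (S X))) ▷ A)
    ∘ assi (S X) (dual (S X)) A) = e_block j (unbendr i) A.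
  rewrite !whiskr_comp -!compA (comp2_rev (ass_nat _ _ _)).
  rewrite e_blockE bendr_unbendr splittE mergetE whiskl_comp -!compA; congr (_
    ∘ _).
  have e := pentagon_ass (S Z) (S Y) (dual (S X)) A.
  apply: (split_mono_cancel (a := S Z ◁ ass (S Y) (dual (S X)) A)
      (b := S Z ◁ assi (S Y) (dual (S X)) A)).
    by rewrite -whiskl_comp assK tensm1.
  rewrite (comp2_id (whisk_id (assiK _ _ _))).
  rewrite (compA (ass _ (_ ⊗ _) A)) (compA (S Z ◁ _)) e -!compA.
  congr (_ ∘ _).
  by rewrite (comp2_rev (whiskr_tens _ _ _)) assiK compm1.
rewrite /e_component /e_entry.
rewrite -(csumE kclosed Cab Css hS (e_block_bilin _ _ _ A) (e_dual_resolves
  kclosed hS b)).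
rewrite tensZm compZm compmZ tens_suml comp_suml comp_sumr !scaler_sumr.
apply: eq_bigr => i _; rewrite term (bilinZr (e_block_bilin _ _ _ A)) scalerA.
congr (_ *: _); rewrite -(hsq X) -!mulrA; congr (_ * _).
by rewrite expr2 mulKf ?sq_neq0 // mulrC.
Qed.

Lemma hb_component_tail (W : C) (Y Z : Irr)
    (b : basis_of_space (mor (S Y) (W ⊗ S Z))) A :
  (W ◁ ass (S Z) (dual (S Z)) A) ∘ (ass W (S Z ⊗ dual (S Z)) A ∘
    ((hb_component sq b ▷ A) ∘ (assi (S Y ⊗ dual (S Y)) W A
      ∘ assi (S Y) (dual (S Y)) (W ⊗ A))))
  = (sq Z / sq Y) *: hb_entry Y W Z A.
Proof.
have term i j : (W ◁ ass (S Z) (dual (S Z)) A) ∘ (ass W (S Z ⊗ dual (S Z)) A ∘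
    (((ass W (S Z) (dual (S Z)) ∘ (i ⊠ j) ∘ ass (S Y) (dual (S Y)) W) ▷ A)
     ∘ (assi (S Y ⊗ dual (S Y)) W A ∘ assi (S Y) (dual (S Y)) (W ⊗ A))))
   = hb_block i (unbendl j) A.
  rewrite !whiskr_comp -!compA -assi_pentagon.
  rewrite (comp2_id (b := assi _ _ _ ▷ A)); last first.
    by rewrite -whiskr_comp assiK tensm1.
  rewrite (compA (ass W _ A)) (compA (W ◁ _)) pentagon_ass -!compA.
  rewrite (comp2_rev (ass_nat _ _ _)) (comp2_id (assiK _ _ _)).
  rewrite hb_blockE splittE bendl_unbendl mergetE whiskl_comp -!compA; congr (_
    ∘ _).
  by rewrite !compA; congr (_ ∘ _); rewrite tensm_lr -whisk_exchange.
rewrite /hb_component /hb_entry.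
rewrite -(csumE kclosed Cab Css hS (hb_block_bilin _ _ _ A) (hb_dual_resolves
  kclosed hS b)).
rewrite tensZm compZm !compmZ tens_suml comp_suml !comp_sumr !scaler_sumr.
apply: eq_bigr => i _; rewrite term (bilinZr (hb_block_bilin _ _ _ A)) scalerA.
congr (_ *: _); rewrite -(hsq Y) expr2.
by rewrite mulrA divfK ?sq_neq0 // mulrC.
Qed.

Lemma e_mor_tail (bas : forall Y X Z : Irr,
    basis_of_space (mor (S Y ⊗ dual (S X)) (dual (S Z)))) Y A :
  e_mor sq B bas Y ▷ A = qdim (S Y) *: encircle (S Y) A.
Proof.
apply: tail_ext => X; rewrite compZm encircle_injt /e_mor.
rewrite tens_suml; under eq_bigr => X' _ do rewrite tens_suml.
have e X' Z : ((bp_inj B Z ∘ e_component sq (bas Y X' Z)) ∘ bp_proj B X') ▷ A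
   = ((qdim (S Y) * (sq Z / sq X')) *: (injt Z A ∘ e_entry X' Z (S Y) A))
      ∘ projt X' A.
  rewrite -compmZ -(e_component_tail (bas Y X' Z)) /injt /projt mergetE splittE.
  rewrite !whiskr_comp -!compA (comp2_id (assK _ _ _)).
  by rewrite (comp2_id (assK _ _ _)).
under eq_bigr => X' _ do under eq_bigr => Z _ do rewrite e.
rewrite block_injt scaler_sumr; apply: eq_bigr => Z _.
by rewrite scalerA.
Qed.

(** * The half-braiding *)

Variable bas_hb : forall (W : C) (Y Z : Irr),
  basis_of_space (mor (S Y) (W ⊗ S Z)).
Let phi W := I1_braiding sq B bas_hb W.

Lemma braiding_tail W A :
  ass W I1 A ∘ ((phi W ▷ A) ∘ assi I1 W A) = braid W A.
Proof.
apply: tail_ext => X; rewrite braid_injt /phi /I1_braiding.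
rewrite tens_suml comp_suml comp_sumr.
have e Y Z : ass W I1 A ∘ (((((W ◁ bp_inj B Z) ∘ hb_component sq (bas_hb W Y Z))
      ∘ (bp_proj B Y ▷ W)) ▷ A) ∘ assi I1 W A)
   = ((sq Z / sq Y) *: ((W ◁ injt Z A) ∘ hb_entry Y W Z A)) ∘ projt Y (W ⊗ A).
  rewrite -compmZ -(hb_component_tail (bas_hb W Y Z)) /injt /projt mergetE
    splittE.
  rewrite !whiskr_comp whiskl_comp -!compA (comp2_rev (ass_nat _ _ _)).
  rewrite (comp2_id (whisk_id (assK _ _ _))).
  rewrite (comp2_id (assK _ _ _)); congr (_ ∘ (_ ∘ (_ ∘ _))).
  by rewrite -assi_nat tensm1.
under eq_bigr => Y _ do rewrite tens_suml comp_suml comp_sumr.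
under eq_bigr => Y _ do under eq_bigr => Z _ do rewrite e.
by rewrite block_injt.
Qed.

Lemma tail_faithful W W' (F G : mor (I1 ⊗ W) (W' ⊗ I1)) :
  (forall A, ass W' I1 A ∘ ((F ▷ A) ∘ assi I1 W A)
     = ass W' I1 A ∘ ((G ▷ A) ∘ assi I1 W A)) -> F = G.
Proof.
move=> e; apply/whiskr_unit_inj/(split_epi_cancel (assK _ _ _)).
exact: (split_mono_cancel (assK _ _ _) (e unit_ob)).
Qed.

Lemma merget_whiskr (W W' Z Y : C) (f : mor W W') (g : mor (W' ⊗ Z) Y) A :
  merget g A ∘ (f ▷ (Z ⊗ A)) = merget (g ∘ (f ▷ Z)) A.
Proof.
rewrite !mergetE whiskr_comp -!compA; congr (_ ∘ _).
by rewrite -tensm1 assi_nat.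
Qed.

Lemma splitt_whiskr_post (W W' Z Y : C) (f : mor W W') (u : mor Y (W ⊗ Z)) A :
  (f ▷ (Z ⊗ A)) ∘ splitt u A = splitt ((f ▷ Z) ∘ u) A.
Proof. by rewrite !splittE whiskr_comp; nest; rewrite (comp2_rev (whiskr_tens _
  _ _)). Qed.

Lemma bendl_whiskr (W W' Z Y : C) (f : mor W W') (g : mor (W' ⊗ Z) Y) A :
  bendl g A ∘ (dual Y ◁ (f ▷ A)) = bendl (g ∘ (f ▷ Z)) A.
Proof.
rewrite !bendlE -merget_whiskr whiskl_comp; nest.
by rewrite (comp2_rev (whisk_sq (esym (whisk_exchange _ _)))).
Qed.

Lemma braid_nat W A D (h : mor A D) :
  braid W D ∘ (I1 ◁ (W ◁ h)) = (W ◁ (I1 ◁ h)) ∘ braid W A.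
Proof.
rewrite -!braiding_tail; nest.
rewrite (comp2_rev (assi_nat _ _ _)) tensm1.
by rewrite (comp2_rev (whisk_exchange _ _)) -(comp2_rev (ass_nat _ _ _)) tensm1.
Qed.

Lemma hb_entry_nat X Z W W' (f : mor W W') A :
  hb_entry X W' Z A ∘ (S X ◁ (dual (S X) ◁ (f ▷ A)))
  = (f ▷ (S Z ⊗ (dual (S Z) ⊗ A))) ∘ hb_entry X W Z A.
Proof.
rewrite /hb_entry csum_comp comp_csum.
pose Q (z : mor (S X) (W' ⊗ S Z)) (g : mor (W ⊗ S Z) (S X)) :=
  splitt z (dual (S Z) ⊗ A) ∘ (S X ◁ bendl g A).
have Qb : bilin Q.
  split=> a u v w; rewrite /Q; first by rewrite splitt_lin comp_linear_l.
  by rewrite bendl_lin tensm_linear_r comp_linear_r.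
have := csum_nat kclosed Cab Css hS (f ▷ S Z) Qb.
rewrite /Q => e; apply: etrans (etrans _ (esym e)) _; apply: (eq_csum kclosed
  Cab Css hS) => u g.
  by rewrite hb_blockE -compA -whiskl_comp bendl_whiskr.
by rewrite hb_blockE compA splitt_whiskr_post.
Qed.

Lemma braid_nat_left W W' (f : mor W W') A :
  braid W' A ∘ (I1 ◁ (f ▷ A)) = (f ▷ (I1 ⊗ A)) ∘ braid W A.
Proof.
apply: tail_ext => X; rewrite -!compA injt_nat compA !braid_injt.
rewrite comp_suml comp_sumr; apply: eq_bigr => Z _.
rewrite compZm compmZ -compA hb_entry_nat !compA; congr (_ *: (_ ∘ _)).
by rewrite whisk_exchange.
Qed.

(** Both sides are canonical sums for [W ⊗ (W' ⊗ S Z)], on the right computed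
    through the simple summands of [W' ⊗ S Z]. *)
Lemma hb_entry_tens X W W' Z A :
  ass W W' (S Z ⊗ (dual (S Z) ⊗ A)) ∘ (hb_entry X (W ⊗ W') Z A
     ∘ (S X ◁ (dual (S X) ◁ assi W W' A)))
  = \sum_Y (W ◁ hb_entry Y W' Z A) ∘ hb_entry X W Y (W' ⊗ A).
Proof.
have Qb := @hb_block3_bilin k C (S X) W W' (S Z) A.
rewrite /hb_entry csum_comp comp_csum.
rewrite (eq_csum kclosed Cab Css hS (Q' := fun u g => hb_block3 (ass W W' (S Z)
  ∘ u)
  (g ∘ assi W W' (S Z)) A)); last by move=> u g; rewrite hb_block3_tens.
rewrite (csum_iso Qb (assiK _ _ _)).
rewrite -(csum_whiskl Qb); apply: eq_bigr => Y _; rewrite whisk_csum csum_comp.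
apply: (eq_csum kclosed Cab Css hS) => j j'; rewrite comp_csum.
by apply: (eq_csum kclosed Cab Css hS) => u u'; rewrite hb_block_comp.
Qed.

Lemma braid_tens W W' A :
  ass W W' (I1 ⊗ A) ∘ (braid (W ⊗ W') A ∘ (I1 ◁ assi W W' A))
  = (W ◁ braid W' A) ∘ braid W (W' ⊗ A).
Proof.
apply: tail_ext => X; rewrite -!compA injt_nat (compA (braid _ _)) !braid_injt.
rewrite comp_suml comp_sumr [RHS]comp_sumr.
under [RHS]eq_bigr => Y _ do
  rewrite compmZ compA -whiskl_comp braid_injt tens_sumr comp_suml scaler_sumr.
rewrite [RHS]exchange_big; apply: eq_bigr => Z _ /=.
rewrite compZm compmZ -compA.
have e : ass W W' (I1 ⊗ A) ∘ ((W ⊗ W') ◁ injt Z A)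
    = (W ◁ (W' ◁ injt Z A)) ∘ ass W W' _.
  by rewrite -tensm1 ass_nat.
rewrite (comp2_rev e) hb_entry_tens comp_sumr scaler_sumr; apply: eq_bigr => Y
  _.
rewrite tensmZ compZm scalerA whiskl_comp -!compA; congr (_ *: _).
by rewrite [RHS]mulrC mulrA divfK ?sq_neq0.
Qed.

(** The inverse left unitor spans [Hom(X, 1 ⊗ X)], and its dual is the left
    unitor. *)
Lemma hb_entry_unit X A :
  lu _ ∘ (hb_entry X unit_ob X A ∘ (S X ◁ (dual (S X) ◁ lui A))) = idmor _.
Proof.
have r : resolves (fun _ : unit => lui (S X)) (fun _ => lu (S X)).
  apply: (resolves_l Cab Css) => // v; rewrite big_const card_unit /= addr0.
  by rewrite compA luK comp1m.
rewrite /hb_entry -(csumE kclosed Cab Css hS (hb_block_bilin _ _ _ A) r).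
by rewrite big_const card_unit /= addr0 hb_block_unit.
Qed.

Lemma hb_entry_unit0 X Z A : X != Z -> hb_entry X unit_ob Z A = 0.
Proof.
move=> XZ; rewrite /hb_entry /canonical_sum big1 // => i _.
set u := tnth _ i; rewrite -[u]comp1m -luK -compA (hom_simple_neq Cab hS (lu _
  ∘ u) XZ).
by rewrite compm0 (bilin0l (hb_block_bilin _ _ _ A)).
Qed.

Lemma braid_unit A : lu (I1 ⊗ A) ∘ braid unit_ob A = I1 ◁ lu A.
Proof.
apply: (split_epi_cancel (a := I1 ◁ lui A) (b := I1 ◁ lu A)).
  by rewrite -whiskl_comp luK tensm1.
rewrite -[RHS]whiskl_comp luiK tensm1.
apply: tail_ext => X; rewrite -!compA injt_nat comp1m (compA (braid _ _))
  braid_injt.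
rewrite comp_suml comp_sumr (bigD1 X) //= [T in _ + T]big1 ?addr0 => [|Z ZX].
  rewrite divff ?sq_neq0 // scale1r -compA.
  by rewrite (comp2_rev (lu_nat _)) hb_entry_unit compm1.
by rewrite hb_entry_unit0 ?compm0 ?scaler0 ?comp0m ?compm0 // eq_sym.
Qed.

(** The braiding with the dual of [W], turned by the duality of [W]. It
    inverts [braid W] because the braiding with [W ⊗ dual W] and with [dual W
    ⊗ W] slides past evaluation and coevaluation. *)
Definition braid_inv W A : mor (W ⊗ (I1 ⊗ A)) (I1 ⊗ (W ⊗ A)) :=
  locked_with tail_key
  (evr W (I1 ⊗ (W ⊗ A)) ∘ ((W ◁ braid (dual W) (W ⊗ A)) ∘
    (W ◁ (I1 ◁ coevr W A)))).

Lemma braid_invK W A : braid_inv W A ∘ braid W A = idmor _.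
Proof.
rewrite /braid_inv unlock; nest.
rewrite -(comp2_rev (braid_nat _ _)) -(comp2_rev (braid_tens _ _ _)).
have e : evr W (I1 ⊗ (W ⊗ A)) ∘ (ass W (dual W) (I1 ⊗ (W ⊗ A))
    ∘ (braid (W ⊗ dual W) (W ⊗ A) ∘ (I1 ◁ assi W (dual W) (W ⊗ A))))
    = I1 ◁ evr W (W ⊗ A).
  rewrite !cuptE -!compA (comp2_id (assK _ _ _)).
  rewrite -(comp2_rev (braid_nat_left _ _)) (comp2_cancel (braid_unit _)).
  by rewrite -!whiskl_comp.
rewrite -!compA (compA (braid (W ⊗ dual W) _)) (compA (ass W _ _)).
rewrite (compA (evr W _)) e.
by rewrite (comp2_id (whisk_id (snake_r _ _))) comp1m.
Qed.

Lemma braid_invKr W A : braid W A ∘ braid_inv W A = idmor _.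
Proof.
rewrite /braid_inv unlock; nest.
rewrite -(comp2_rev (cup_nat _ _)).
rewrite -(comp2_rev (whisk_sq (braid_tens _ _ _))).
have e : ass (dual W) W (I1 ⊗ A) ∘ (braid (dual W ⊗ W) A ∘
     ((I1 ◁ assi (dual W) W A) ∘ (I1 ◁ coevr W A))) = coevr W (I1 ⊗ A).
  rewrite -whiskl_comp !captE (comp2_id (assK _ _ _)) whiskl_comp.
  rewrite (comp2_rev (braid_nat_left _ _)); congr (_ ∘ (_ ∘ _)).
  apply: (split_mono_cancel (luK _)); rewrite compA braid_unit -whiskl_comp.
  by rewrite !luiK tensm1.
rewrite (compA (W ◁ (_ ∘ _))) -whiskl_comp (compA (W ◁ ass _ _ _)) -whiskl_comp.
by rewrite -(compA (braid _ _)) e (comp2_id (snake_r _ _)) comp1m.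
Qed.

Lemma I1_braiding_iso W : is_iso (phi W).
Proof.
have K := braid_invK W unit_ob; have K' := braid_invKr W unit_ob.
rewrite -braiding_tail in K K'.
apply: is_iso_whiskr_unit.
exists (assi I1 W unit_ob ∘ (braid_inv W unit_ob ∘ ass W I1 unit_ob)); split.
  apply: (split_epi_cancel (assK _ _ _)); rewrite -!compA K.
  by rewrite compm1 comp1m.
apply: (split_mono_cancel (assK _ _ _)).
by move: K'; rewrite !compA => ->; rewrite comp1m compm1.
Qed.

Lemma I1_half_braiding : is_half_braiding phi.
Proof.
split=> [W W' f||W W']; [|exact: I1_braiding_iso|]; apply: tail_faithful => A.
  have := braid_nat_left f A; rewrite -!braiding_tail -!compA => e.
  rewrite !whiskr_comp -!compA -assi_nat e.
  by rewrite (comp2_rev (whiskr_tens _ _ _)).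
rewrite braiding_tail.
have K : (I1 ◁ assi W W' A) ∘ (I1 ◁ ass W W' A) = idmor _.
  by rewrite -whiskl_comp assK tensm1.
rewrite -[LHS]compm1 -[RHS]compm1 -K !compA; congr (_ ∘ _).
apply: (split_mono_cancel (assK _ _ _)).
rewrite braid_tens -!braiding_tail !whiskr_comp !whiskl_comp -!compA.
rewrite assi_pentagon.
have n1 := assi_nat (phi W) (idmor W') (idmor A); rewrite tensm1 in n1.
rewrite -(comp2_rev n1).
have p1 : (ass W I1 W' ▷ A) ∘ assi (W ⊗ I1) W' A
    = assi W (I1 ⊗ W') A ∘ ((W ◁ assi I1 W' A) ∘ ass W I1 (W' ⊗ A)).
  apply: (split_mono_cancel (a := assi W I1 W' ▷ A) (b := ass W I1 W' ▷ A)).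
    by rewrite -whiskr_comp assiK tensm1.
  rewrite compA -whiskr_comp assK tensm1 comp1m.
  have := assi_pentagon W I1 W' A; rewrite !compA => ->.
  by rewrite -compA assK compm1.
rewrite (comp2_rev p1) -!compA -(comp2_rev (assi_nat _ _ _)).
have p2 : ass (W ⊗ W') I1 A ∘ ((assi W W' I1 ▷ A) ∘ assi W (W' ⊗ I1) A)
    = assi W W' (I1 ⊗ A) ∘ (W ◁ ass W' I1 A).
  apply: (split_epi_cancel (a := W ◁ assi W' I1 A) (b := W ◁ ass W' I1 A)).
    by rewrite -whiskl_comp assK tensm1.
  rewrite -!compA assi_pentagon compA assiK comp1m -whiskl_comp assiK.
  by rewrite tensm1 compm1.
rewrite (compA (_ ▷ A) (assi W _ A)) (compA (ass (W ⊗ W') _ _)) p2 -!compA.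
by rewrite (comp2_id (assiK _ _ _)).
Qed.

(** * The endomorphisms [e_Y] *)

(** Both sides are the canonical sum for [W ⊗ (S Z ⊗ O)], computed through the
    simple summands of [W ⊗ S Z] on the left and of [S Z ⊗ O] on the right. *)
Lemma hb_entry_e_entry X Z W O A :
  \sum_Y hb_entry Y W Z A ∘ e_entry X Y O (W ⊗ A)
  = \sum_Y (W ◁ e_entry Y Z O A) ∘ hb_entry X W Y A.
Proof.
have Qb := @crossing_bilin k C (S X) W (S Z) O A.
transitivity (csum (fun (u : mor (S X) (W ⊗ (S Z ⊗ O))) h => crossing u h A)).
  rewrite -(csum_iso Qb (assiK _ _ _)) -csum_whiskr; last first.
    split=> a u v w; first by rewrite comp_linear_r (proj1 Qb).
    by rewrite comp_linear_l (proj2 Qb).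
  apply: eq_bigr => Y _; rewrite /hb_entry csum_comp.
  apply: (eq_csum kclosed Cab Css hS) => j j'; rewrite /e_entry comp_csum.
  apply: (eq_csum kclosed Cab Css hS) => u u'.
  by rewrite hb_block_e_block !compA.
rewrite -(csum_whiskl Qb); apply: eq_bigr => Y _; rewrite whisk_csum csum_comp.
apply: (eq_csum kclosed Cab Css hS) => j j'; rewrite comp_csum.
by apply: (eq_csum kclosed Cab Css hS) => u u'; rewrite whisk_e_block_hb_block.
Qed.

Lemma sq_ratio X Y Z : (sq Y / sq X) * (sq Z / sq Y) = sq Z / sq X.
Proof. by rewrite mulrC mulrA divfK ?sq_neq0. Qed.

Lemma encircle_central O W A : braid W A ∘ encircle O (W ⊗ A) = (W ◁ encircle O
  A) ∘ braid W A.
Proof.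
apply: tail_ext => X; rewrite -!compA encircle_injt braid_injt !comp_sumr.
under eq_bigr => Y _ do rewrite compmZ compA braid_injt comp_suml scaler_sumr.
under [RHS]eq_bigr => Y _ do
  rewrite compmZ compA -whiskl_comp encircle_injt tens_sumr comp_suml
    scaler_sumr.
rewrite exchange_big [RHS]exchange_big; apply: eq_bigr => Z _ /=.
under eq_bigr => Y _ do rewrite compZm scalerA sq_ratio -compA.
under [RHS]eq_bigr => Y _ do
  rewrite tensmZ compZm scalerA sq_ratio whiskl_comp -compA.
by rewrite -!scaler_sumr -!comp_sumr hb_entry_e_entry.
Qed.

(** The canonical sum for [S Z ⊗ (O ⊗ O')], computed through the simple
    summands of [S Z ⊗ O]. *)
Lemma e_entry_comp X Z O O' A :
  \sum_Y e_entry Y Z O A ∘ e_entry X Y O' A = e_entry X Z (O ⊗ O') A.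
Proof.
have Qb := @e_block3_bilin k C (S X) (S Z) O O' A.
have -> : e_entry X Z (O ⊗ O') A =
    csum (fun (u : mor (S X) (S Z ⊗ (O ⊗ O'))) h => e_block3 u h A).
  by apply: (eq_csum kclosed Cab Css hS) => u h; rewrite e_block3_tens.
rewrite -(csum_iso Qb (assiK _ _ _)) -csum_whiskr; last first.
  split=> a u v w; first by rewrite comp_linear_r (proj1 Qb).
  by rewrite comp_linear_l (proj2 Qb).
apply: eq_bigr => Y _; rewrite {1}/e_entry csum_comp.
apply: (eq_csum kclosed Cab Css hS) => j j'; rewrite /e_entry comp_csum.
apply: (eq_csum kclosed Cab Css hS) => u u'.
by rewrite e_block_comp !compA.
Qed.

Lemma encircle_comp O O' A : encircle O A ∘ encircle O' A = encircle (O ⊗ O') A.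
Proof.
apply: tail_ext => X; rewrite -compA !encircle_injt comp_sumr.
under eq_bigr => Y _ do rewrite compmZ compA encircle_injt comp_suml
  scaler_sumr.
rewrite exchange_big; apply: eq_bigr => Z _ /=.
under eq_bigr => Y _ do rewrite compZm scalerA sq_ratio -compA.
by rewrite -scaler_sumr -comp_sumr e_entry_comp.
Qed.

Lemma bendr_whiskl (Z Y Y' X : C) (f : mor Y' Y) (g : mor (Z ⊗ Y) X) A :
  bendr (g ∘ (Z ◁ f)) A = bendr g A ∘ (f ▷ (dual X ⊗ A)).
Proof.
have e T : merget (g ∘ (Z ◁ f)) T = merget g T ∘ (Z ◁ (f ▷ T)).
  by rewrite !mergetE whiskr_comp -!compA assi_nat.
by rewrite !bendrE e whiskl_comp -!compA cap_nat.
Qed.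

Lemma splitt_whiskl_post (Z Y Y' X : C) (f : mor Y' Y) (u : mor X (Z ⊗ Y')) A :
  splitt ((Z ◁ f) ∘ u) A = (Z ◁ (f ▷ A)) ∘ splitt u A.
Proof. by rewrite !splittE whiskr_comp !compA ass_nat. Qed.

(** The pieces [j : S Y -> O] of a decomposition of [O] meet in [j' ∘ j], a
    scalar. *)
Lemma e_entry_decomp X Z O A :
  e_entry X Z O A
  = \sum_Y (\dim (fullv : {vspace mor O (S Y)}))%:R *: e_entry X Z (S Y) A.
Proof.
rewrite {1}/e_entry -(csum_whiskl (@e_block_bilin k C (S X) (S Z) O A)).
apply: eq_bigr => Y _; rewrite -(csum_scal kclosed Cab Css hS).
apply: (eq_csum kclosed Cab Css hS) => j j'; rewrite /e_entry /canonical_sum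
  scaler_sumr.
apply: eq_bigr => i _.
rewrite !e_blockE bendr_whiskl splitt_whiskl_post whiskl_comp -!compA.
rewrite (compA (_ ◁ (j' ▷ _))) -whiskl_comp -whiskr_comp.
by rewrite (scal_tail kclosed _ _ (sS Y)) tensmZ tensm1 compZm comp1m compmZ.
Qed.

Lemma encircle_decomp O A :
  encircle O A
  = \sum_Y (\dim (fullv : {vspace mor O (S Y)}))%:R *: encircle (S Y) A.
Proof.
apply: tail_ext => X; rewrite comp_suml encircle_injt.
under [RHS]eq_bigr => Y _ do rewrite compZm encircle_injt scaler_sumr.
rewrite exchange_big; apply: eq_bigr => Z _ /=.
rewrite e_entry_decomp comp_sumr scaler_sumr; apply: eq_bigr => Y _.
by rewrite compmZ !scalerA mulrC.
Qed.

(** * Convolution *)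

Lemma mul_tail A : merget (I1_mul sq B) A =
  \sum_X (sq X)^-1 *: (injt X A ∘ ((S X ◁ evt (S X) (dual (S X) ⊗ A)) ∘
    ((S X ◁ (dual (S X) ◁ projt X A)) ∘ projt X (I1 ⊗ A)))).
Proof.
rewrite mergetE /I1_mul tens_suml comp_suml; apply: eq_bigr => X _.
rewrite tensZm compZm; congr (_ *: _).
have -> : lu (dual (S X)) ∘ (ev (S X) ▷ dual (S X))
   ∘ assi (dual (S X)) (S X) (dual (S X)) = evt (S X) (dual (S X)).
  by rewrite cuptE !compA.
rewrite !whiskr_comp /injt /projt mergetE !splittE !whiskl_comp -!compA.
congr (_ ∘ _); set V := dual (S X).
have -> : (S X ◁ (V ◁ (bp_proj B X ▷ A))) ∘ (ass (S X) V (I1 ⊗ A) ∘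
    (bp_proj B X ▷ (I1 ⊗ A)))
  = ass (S X) V ((S X ⊗ V) ⊗ A) ∘ (bp_proj B X ⊠ (bp_proj B X ▷ A)).
  by rewrite -(comp2_rev (ass_nat _ _ _)) tensm1 -tensm_lr.
rewrite -?compA.
have -> : (S X ◁ evt (S X) (V ⊗ A)) ∘ ((S X ◁ (V ◁ ass (S X) V A)) ∘
    (ass (S X) V ((S X ⊗ V) ⊗ A) ∘ (bp_proj B X ⊠ (bp_proj B X ▷ A))))
  = (S X ◁ (evt (S X) V ▷ A)) ∘ ((S X ◁ assi V (S X ⊗ V) A) ∘
    (ass (S X) V ((S X ⊗ V) ⊗ A) ∘ (bp_proj B X ⊠ (bp_proj B X ▷ A)))).
  rewrite -cup_strength !whiskl_comp -!compA.
  by rewrite (comp2_id (whisk_id (assiK _ _ _))).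
rewrite (comp2_rev (assi_nat _ _ _)); congr (_ ∘ _).
have -> : ((bp_proj B X ⊠ bp_proj B X) ▷ A) ∘ assi I1 I1 A
    = assi (S X ⊗ V) (S X ⊗ V) A ∘ (bp_proj B X ⊠ (bp_proj B X ▷ A)).
  by rewrite -assi_nat.
rewrite !compA; congr (_ ∘ _); rewrite -!compA.
apply: (split_mono_cancel (a := assi (S X) V (S X ⊗ V) ▷ A)
   (b := ass (S X) V (S X ⊗ V) ▷ A)).
  by rewrite -whiskr_comp assiK tensm1.
rewrite compA -whiskr_comp assK tensm1 comp1m.
rewrite (compA (assi (S X) _ A)) (compA (_ ▷ A)) assi_pentagon -!compA.
by rewrite assK compm1.
Qed.

Lemma comul_tail A : splitt (I1_comul sq B) A =
  \sum_X (sq X)^-1 *: (injt X (I1 ⊗ A) ∘ ((S X ◁ (dual (S X) ◁ injt X A)) ∘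
    ((S X ◁ coevr (S X) (dual (S X) ⊗ A)) ∘ projt X A))).
Proof.
rewrite splittE /I1_comul tens_suml comp_sumr; apply: eq_bigr => X _.
rewrite tensZm compmZ; congr (_ *: _).
have -> : ass (dual (S X)) (S X) (dual (S X)) ∘ (coev' (S X) ▷ dual (S X))
   ∘ lui (dual (S X)) = coevr (S X) (dual (S X)).
  by rewrite captE !compA.
set V := dual (S X).
rewrite !whiskr_comp /injt /projt !mergetE !splittE (cap_strength _ V A).
rewrite !whiskl_comp -!compA (comp2_id (whisk_id (whisk_id (assK _ _ _)))).
rewrite -(comp2_rev (ass_nat _ _ _)) (comp2_rev (ass_nat _ _ _)).
rewrite (comp2_rev (assi_nat _ _ _)) tensm1.
rewrite (compA (bp_inj B X ▷ _)) whisk_exchange -tensm_lr; congr (_ ∘ _).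
rewrite -/V (compA (S X ◁ _)) (compA (assi _ _ _)) pentagon_assi -!compA.
by [].
Qed.

Lemma conv_tail (a b : mor I1 I1) A : I1_conv sq B a b ▷ A =
  merget (I1_mul sq B) A ∘ ((I1 ◁ (b ▷ A)) ∘ ((a ▷ (I1 ⊗ A)) ∘ splitt (I1_comul
    sq B) A)).
Proof.
rewrite /I1_conv mergetE splittE !whiskr_comp; nest; congr (_ ∘ _).
rewrite -(comp2_rev (whiskr_tens _ _ _)) -(comp2_rev (ass_nat _ _ _)).
by rewrite (comp2_id (assK _ _ _)) (tensm_lr a b) whiskr_comp -!compA.
Qed.

Lemma projt_nat X A D (h : mor A D) :
  (S X ◁ (dual (S X) ◁ h)) ∘ projt X A = projt X D ∘ (I1 ◁ h).
Proof. by rewrite /projt splitt_nat. Qed.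

Lemma e_entry_nat X Z O A D (h : mor A D) :
  e_entry X Z O D ∘ (S X ◁ (dual (S X) ◁ h))
  = (S Z ◁ (dual (S Z) ◁ h)) ∘ e_entry X Z O A.
Proof.
rewrite /e_entry csum_comp comp_csum; apply: (eq_csum kclosed Cab Css hS) => u
  u'.
rewrite !e_blockE; nest; rewrite -(comp2_rev (splitt_nat _ _)).
by rewrite (comp2_rev (whisk_sq (bendr_nat _ _))).
Qed.

Lemma ptrace_neq X Z Y Y' (f' : mor (S Z ⊗ S Y) (S X)) (g : mor (S X) (S Z ⊗ S
  Y')) A :
  Y != Y' -> ptrace f' g A = 0.
Proof.
move=> YY; rewrite -(of_tailE (ptrace_strong f' g)).
by rewrite (hom_simple_neq Cab hS (of_tail _) YY) tens0m.
Qed.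

(** Schur's lemma makes the partial trace a scalar; closing it off with the
    trace of [Y] gives the trace of [f' ∘ g] on [X]. *)
Lemma ptrace_scalar X Z Y (f' : mor (S Z ⊗ S Y) (S X))
    (g : mor (S X) (S Z ⊗ S Y)) A :
  ptrace f' g A = (scal (f' ∘ g) * (qdim (S X) / qdim (S Y))) *: idmor _.
Proof.
have tE := of_tailE (ptrace_strong f' g); set m := of_tail _ in tE.
rewrite -tE (scal_tail kclosed _ _ (sS Y)); congr (_ *: _).
have := ptrace_trace f' g unit_ob.
rewrite -tE !(scal_tail kclosed) // !tensmZ !tensm1 !compZm !comp1m !compmZ.
rewrite !(qdim_l kclosed) !scalerA => /(scalar_id_inj (sph_simple_one C)) e.
by rewrite mulrA -e mulfK // (qdim_neq0 kclosed (sS Y)).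
Qed.

Lemma e_entry_conv X Z Y Y' A :
  (S Z ◁ evt (S Z) (dual (S Z) ⊗ A)) ∘ ((S Z ◁ (dual (S Z) ◁ e_entry X Z (S Y')
    A)) ∘
    (e_entry X Z (S Y) (S X ⊗ (dual (S X) ⊗ A)) ∘
      (S X ◁ coevr (S X) (dual (S X) ⊗ A))))
  = if Y == Y' then (qdim (S X) / qdim (S Y)) *: e_entry X Z (S Y) A else 0.
Proof.
rewrite {1}/e_entry whisk_csum whisk_csum csum_comp comp_csum.
under (eq_csum kclosed Cab Css hS) => g g'.
  rewrite {1}/e_entry csum_comp !comp_csum.
  under (eq_csum kclosed Cab Css hS) => f f' do rewrite e_block_conv.
  over.
rewrite /=.
case: eqP => [<-|/eqP ne]; last first.
  rewrite /canonical_sum big1 // => i _; rewrite big1 // => j _.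
  by rewrite ptrace_neq // tensm0 comp0m compm0.
rewrite /e_entry /canonical_sum scaler_sumr; apply: eq_bigr => i _.
rewrite (bigD1 i) //= [T in _ + T]big1 ?addr0 => [|j ji].
  rewrite ptrace_scalar cdualP eqxx scale1r scal_id ?mul1r; last exact: (proj1
    (sS X)).
  by rewrite tensmZ tensm1 compZm comp1m compmZ e_blockE.
rewrite ptrace_scalar cdualP (negPf ji) scale0r.
by rewrite /scal linear0 mul0r scale0r tensm0 comp0m compm0.
Qed.

Lemma projt_encircle_injt X Z O A :
  projt Z A ∘ (encircle O A ∘ injt X A) = (sq Z / sq X) *: e_entry X Z O A.
Proof.
rewrite encircle_injt comp_sumr (bigD1 Z) //= [T in _ + T]big1 ?addr0 => [|Z'
  ZZ].
  by rewrite compmZ compA projt_injt comp1m.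
by rewrite compmZ compA projt_injt0 // comp0m scaler0.
Qed.

Lemma encircle_conv Y Y' A :
  merget (I1_mul sq B) A ∘ ((I1 ◁ encircle (S Y') A) ∘ (encircle (S Y) (I1 ⊗ A)
    ∘ splitt (I1_comul sq B) A))
  = if Y == Y' then (qdim (S Y))^-1 *: encircle (S Y) A else 0.
Proof.
apply: tail_ext => X; rewrite -!compA comul_tail comp_suml.
rewrite (bigD1 X) //= [T in _ + T]big1 ?addr0 => [|X' XX]; last first.
  by rewrite compZm -!compA projt_injt0 ?compm0 ?scaler0 // eq_sym.
rewrite compZm -!compA projt_injt compm1 !compmZ.
rewrite (compA (encircle _ _)) encircle_injt comp_suml !comp_sumr scaler_sumr.
transitivity (\sum_Z (if Y == Y' then (qdim (S Y))^-1 *: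
   ((sq Z / sq X) *: (injt Z A ∘ e_entry X Z (S Y) A)) else 0)); last first.
  case: eqP => _; last by rewrite big1 // comp0m.
  by rewrite -scaler_sumr -encircle_injt compZm.
apply: eq_bigr => Z _.
rewrite compZm -!compA !compmZ scalerA (comp2_rev (e_entry_nat _ _ _ _)).
rewrite (comp2_rev (injt_nat _ _)) mul_tail comp_suml.
rewrite (bigD1 Z) //= [T in _ + T]big1 ?addr0 => [|X' XX]; last first.
  rewrite compZm -!compA (compA (projt X' _)) projt_injt0 1?eq_sym //.
  by rewrite comp0m !compm0 scaler0.
rewrite compZm scalerA -!compA (comp2_id (projt_injt _ _)).
rewrite (compA (_ ◁ (_ ◁ encircle _ _))) -!whiskl_comp (compA (_ ◁ (_ ◁ projt _
  _))).
rewrite -!whiskl_comp projt_encircle_injt !tensmZ compZm !compmZ scalerA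
  e_entry_conv.
case: eqP => [_|_]; last by rewrite compm0 scaler0.
rewrite compmZ !scalerA; congr (_ *: _); rewrite -(hsq X).
have X0 := sq_neq0 X; have Z0 := sq_neq0 Z.
have Y0 := qdim_neq0 kclosed (sS Y).
by field; rewrite X0 Y0 Z0.
Qed.

Lemma central_of_tail (f : mor I1 I1) :
  (forall W A, braid W A ∘ (f ▷ (W ⊗ A)) = (W ◁ (f ▷ A)) ∘ braid W A) <->
  (forall W, phi W ∘ (f ▷ W) = (W ◁ f) ∘ phi W).
Proof.
have tl W A : ass W I1 A ∘ (((phi W ∘ (f ▷ W)) ▷ A) ∘ assi I1 W A)
    = braid W A ∘ (f ▷ (W ⊗ A)).
  rewrite -braiding_tail whiskr_comp -!compA -assi_nat tensm1.
  by [].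
have tr W A : ass W I1 A ∘ ((((W ◁ f) ∘ phi W) ▷ A) ∘ assi I1 W A)
    = (W ◁ (f ▷ A)) ∘ braid W A.
  by rewrite -braiding_tail whiskr_comp -!compA (comp2_rev (ass_nat _ _ _)).
split=> e W => [|A]; last by rewrite -tl -tr e.
by apply: tail_faithful => A; rewrite tl tr e.
Qed.

Variable bas_e : forall Y X Z : Irr,
  basis_of_space (mor (S Y ⊗ dual (S X)) (dual (S Z))).
Let e_ Y := e_mor sq B bas_e Y.

Lemma e_central W Y : phi W ∘ (e_ Y ▷ W) = (W ◁ e_ Y) ∘ phi W.
Proof.
move: W; apply/central_of_tail => W A.
by rewrite !e_mor_tail compmZ encircle_central tensmZ compZm.
Qed.

Lemma e_comp Y Y' : e_ Y ∘ e_ Y' = \sum_Z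
  (qdim (S Y) * qdim (S Y') * ((fusion_coef S Y Y' Z)%:R / qdim (S Z))) *: e_ Z.
Proof.
apply: whiskr_unit_inj; rewrite whiskr_comp !e_mor_tail compZm compmZ
  encircle_comp.
rewrite encircle_decomp tens_suml !scaler_sumr; apply: eq_bigr => Z _.
rewrite tensZm e_mor_tail !scalerA; congr (_ *: _).
by rewrite /fusion_coef -!mulrA mulVf ?mulr1 // (qdim_neq0 kclosed (sS Z)).
Qed.

Lemma e_conv Y Y' : I1_conv sq B (e_ Y) (e_ Y') = if Y == Y' then e_ Y else 0.
Proof.
apply: whiskr_unit_inj.
rewrite conv_tail !e_mor_tail tensmZ !(compZm, compmZ) encircle_conv.
case: eqP => [<-|_]; last by rewrite !scaler0 tens0m.
rewrite e_mor_tail !scalerA; congr (_ *: _).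
by rewrite mulfK // (qdim_neq0 kclosed (sS Y)).
Qed.

(** * The [e_Y] are independent and span *)

Hypothesis char0 : forall n, n.+1%:R != 0 :> k.

Lemma unit_index : exists X0 (i : mor unit_ob (S X0)) (i' : mor (S X0) unit_ob),
  i' ∘ i = idmor _ /\ i ∘ i' = idmor _.
Proof.
have [X0 [i [i' [ii' i'i]]]] := sr_complete hS (sph_simple_one C).
by exists X0, i, i'.
Qed.

(** The entry from [Y ⊗ dual Y] to [1 ⊗ dual 1] closes to a positive multiple
    of the dimension of [Y], the multiplicity being the dimension of [Hom(Y,
    1 ⊗ Y)]. *)
Lemma encircle_neq0 Y : encircle (S Y) unit_ob <> 0.
Proof.
have [X0 [i [i' [ii' _]]]] := unit_index; set A := unit_ob => EI0.
have := projt_encircle_injt Y X0 (S Y) A; rewrite EI0 comp0m compm0 =>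
  /esym/eqP.
rewrite scaler_eq0 mulf_eq0 invr_eq0 !(negPf (sq_neq0 _)) /= => /eqP cEt0.
set V := mor (S Y) (S X0 ⊗ S Y); set n := \dim (fullv : {vspace V}).
have n0 : (0 < n)%N.
  rewrite lt0n; apply/eqP => n0; apply: (proj1 (sS Y)).
  have v0 (v : V) : v = 0.
    apply/eqP; rewrite -memv0; have /eqP <- : fullv == 0%VS :> {vspace V}.
      by rewrite -dimv_eq0 -/n n0.
    exact: memvf.
  have -> : idmor (S Y) = lu (S Y) ∘ ((i' ▷ S Y) ∘ ((i ▷ S Y) ∘ lui (S Y))).
    by rewrite (compA (i' ▷ _)) -whiskr_comp ii' tensm1 comp1m luiK.
  by rewrite (v0 (_ ∘ lui _)) !compm0.
have := congr1 (fun f => evr (S X0) A ∘ (f ∘ coevt (S Y) A)) cEt0.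
rewrite comp0m compm0 /e_entry csum_comp comp_csum.
rewrite /canonical_sum (eq_bigr (fun=> qdim (S Y) *: idmor A)) => [|j _]; last
  first.
  rewrite e_block_closed cdualP eqxx scale1r tensm1 comp1m.
  exact: (qdim_r kclosed).
rewrite sumr_const card_ord -scaler_nat scalerA
  => /(scalar_idP (sph_simple_one C)).
move/eqP; rewrite mulf_eq0 (negPf (qdim_neq0 kclosed (sS Y))) orbF.
by rewrite -/V -/n -(prednK n0) (negPf (char0 _)).
Qed.

Lemma e_neq0 Y : e_ Y <> 0.
Proof.
move=> e0; apply: (@encircle_neq0 Y).
have := e_mor_tail bas_e Y unit_ob; rewrite -/(e_ Y) e0 tens0m => /esym/eqP.
by rewrite scaler_eq0 (negPf (qdim_neq0 kclosed (sS Y))) => /eqP.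
Qed.

Lemma I1_conv_bilin : bilin (I1_conv sq B).
Proof.
split=> a u v w; rewrite /I1_conv.
  by rewrite tensm_linear_l comp_linear_r comp_linear_l.
by rewrite tensm_linear_r comp_linear_r comp_linear_l.
Qed.

(** Convolution with [e_Y] isolates the coefficient of [e_Y]. *)
Lemma e_free (c : Irr -> k) : \sum_Y c Y *: e_ Y = 0 -> forall Y, c Y = 0.
Proof.
move=> c0 Y; have := congr1 (fun f => I1_conv sq B f (e_ Y)) c0.
rewrite (bilin0l I1_conv_bilin) (bilin_suml I1_conv_bilin).
rewrite (bigD1 Y) //= [T in _ + T]big1 ?addr0 => [|Y' YY].
  rewrite (bilinZl I1_conv_bilin) e_conv eqxx => /eqP.
  by rewrite scaler_eq0 => /orP[/eqP //|/eqP/e_neq0].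
by rewrite (bilinZl I1_conv_bilin) e_conv (negPf YY) scaler0.
Qed.

(** The vertex [m] is [w] with the leg [dual X] bent back. *)
Lemma hom_unit_tail X Z (w : mor unit_ob (dual (S X) ⊗ S Z)) :
  exists m : mor (S X) (S Z), forall A,
    capt w A = (dual (S X) ◁ (m ▷ A)) ∘ coevr (S X) A.
Proof.
pose t A := evr (S X) (S Z ⊗ A) ∘ (S X ◁ capt w A).
have ts : @strong k C [:: S X] [:: S Z] t.
  apply: (@strong_comp k C _ [:: S X; dual (S X); S Z]).
    exact: (strong_cup _ [:: S Z]).
  exact/(@strong_whisk _ _ (S X) [::] [:: dual (S X); S Z])/(strong_cap _ [::]).
exists (of_tail (t unit_ob)) => A; rewrite (of_tailE ts) /t; nest.
rewrite whiskl_comp -!compA (comp2_rev (cap_nat _ _)).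
by rewrite (comp2_id (snake_r_dual _ _)).
Qed.

Lemma capt_inj (P Q : C) (c d : mor unit_ob (P ⊗ Q)) :
  capt c unit_ob = capt d unit_ob -> c = d.
Proof.
rewrite !captE => /(split_mono_cancel (assK _ _ _)).
by move=> e; apply/whiskr_unit_inj/(split_epi_cancel (luK _)).
Qed.

Section Determined.
Variables (X0 : Irr) (i : mor unit_ob (S X0)) (i' : mor (S X0) unit_ob).
Hypotheses (i'i : i' ∘ i = idmor _) (ii' : i ∘ i' = idmor _).

Lemma hom_unit_neq X Z (u : mor (S X0) (dual (S X) ⊗ S Z)) : X != Z -> u = 0.
Proof.
move=> XZ; apply: (split_epi_cancel ii'); rewrite comp0m.
have [m e] := hom_unit_tail (u ∘ i); apply: capt_inj.
rewrite e (hom_simple_neq Cab hS m XZ) tens0m tensm0 comp0m.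
by rewrite captE tens0m comp0m compm0.
Qed.

Lemma hom_unit_eq X (u : mor (S X0) (dual (S X) ⊗ S X)) :
  exists a, u ∘ i = a *: coev' (S X).
Proof.
have [m e] := hom_unit_tail (u ∘ i); exists (scal m); apply: capt_inj.
rewrite e (scal_tail kclosed _ _ (sS X)) tensmZ tensm1 compZm comp1m.
by rewrite !captE tensZm compZm compmZ.
Qed.

Lemma hb_entry_coevt0 X Z A : X != Z -> hb_entry X0 (dual (S X)) Z A = 0.
Proof.
move=> XZ; rewrite /hb_entry /canonical_sum big1 // => s _.
by rewrite (hom_unit_neq (tnth _ s) XZ) (bilin0l (hb_block_bilin _ _ _ A)).
Qed.

(** The canonical element for [Hom(1, dual X ⊗ X)] is [coev'] with [ev]
    divided by the dimension. *)
Lemma hb_entry_coevt X A :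
  hb_entry X0 (dual (S X)) X A ∘ coevt (S X0) (dual (S X) ⊗ A)
  = (qdim (S X))^-1 *: coevr (S X) (dual (S X) ⊗ A).
Proof.
have d0 := qdim_neq0 kclosed (sS X).
pose u (_ : unit) := coev' (S X) ∘ i'.
pose u' (_ : unit) := (qdim (S X))^-1 *: (i ∘ ev (S X)).
have r : resolves u u'.
  apply: (resolves_l Cab Css) => // v.
  rewrite /u /u' big_const card_unit /= addr0.
  apply: (split_epi_cancel ii'); have [a e] := hom_unit_eq v.
  rewrite -!compA e compZm !compmZ -!compA.
  have -> : ev (S X) ∘ coev' (S X) = qdim (S X) *: idmor unit_ob.
    rewrite [LHS](unit_scal kclosed) /qdim; congr (scalar_of _ *: _).
    by have := sph_spherical (idmor (S X)); rewrite !tensm1 !compm1.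
  by rewrite (comp2_id i'i) compmZ compm1 !scalerA mulrAC mulVf // mul1r.
rewrite /hb_entry -(csumE kclosed Cab Css hS (hb_block_bilin _ _ _ A) r).
rewrite /u /u' big_const card_unit /= addr0 hb_blockE -compA bendl_coev.
set T := dual (S X) ⊗ A.
have e : ((ev (S X) ▷ T) ∘ assi _ _ _) ∘ (dual (S X) ◁ coevt (S X) A)
    = lui T.
  apply: (split_mono_cancel (luK T)); rewrite luiK -[RHS](snake_l_dual (S X) A).
  by rewrite cuptE !compA.
rewrite mergetE splittE tensZm !whiskr_comp !(compZm, compmZ) (captE (coev' _))
  -!compA.
congr (_ *: (_ ∘ (_ ∘ _))).
rewrite (comp2_id (b := i ▷ T)); last by rewrite -whiskr_comp i'i tensm1.
by rewrite -e -!compA.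
Qed.

(** The half-braiding with [dual X], applied to the unit summand and closed
    off with [ev'], is an invertible multiple of the inclusion of the summand
    of [X]. *)
Lemma central_determined (f : mor I1 I1) :
  (forall W, phi W ∘ (f ▷ W) = (W ◁ f) ∘ phi W) ->
  (forall A, (f ▷ A) ∘ (injt X0 A ∘ coevt (S X0) A) = 0) -> f = 0.
Proof.
move=> /central_of_tail fc f0; apply: whiskr_unit_inj; rewrite tens0m.
apply: tail_ext => X; rewrite comp0m; set A := unit_ob; set V := dual (S X).
have : (V ◁ (f ▷ A)) ∘ (braid V A ∘ (injt X0 (V ⊗ A) ∘ coevt (S X0) (V ⊗ A))) =
  0.
  by rewrite compA -fc -compA f0 compm0.
rewrite (compA (braid V A)) braid_injt comp_suml.
rewrite (bigD1 X) //= [T in _ + T]big1 ?addr0 => [|Z ZX]; last first.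
  by rewrite hb_entry_coevt0 1?eq_sym // compm0 scaler0 comp0m.
rewrite compZm -compA hb_entry_coevt !compmZ scalerA => /eqP.
rewrite scaler_eq0 !mulf_eq0 !invr_eq0 !(negPf (sq_neq0 _)).
rewrite (negPf (qdim_neq0 kclosed (sS X))) /= => /eqP.
move=> /(congr1 (fun g => evr (S X) (I1 ⊗ A) ∘ (S X ◁ g))).
rewrite tensm0 compm0 !whiskl_comp !(comp2_rev (cup_nat _ _)).
by rewrite snake_r compm1.
Qed.

(** The component at [Z] of [1 -> I(1) -> I(1)], as an endomorphism of [S Z]. *)
Definition unit_coord_tail f Z A : mor (S Z ⊗ A) (S Z ⊗ A) :=
  (S Z ◁ evt (S Z) A) ∘ (projt Z (S Z ⊗ A) ∘ ((f ▷ (S Z ⊗ A)) ∘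
    (injt X0 (S Z ⊗ A) ∘ coevt (S X0) (S Z ⊗ A)))).

Lemma unit_coord_tail_strong f Z : @strong k C [:: S Z] [:: S Z]
  (unit_coord_tail f Z).
Proof.
apply: (@strong_comp k C _ [:: S Z; dual (S Z); S Z]).
  exact/(@strong_whisk _ _ (S Z) [:: dual (S Z); S Z] [::])/(strong_cup _ [::]).
apply: (@strong_comp k C _ [:: I1; S Z]); first exact: (strong_splitt _ [:: S
  Z]).
apply: (@strong_comp k C _ [:: I1; S Z]); first exact: (strong_whiskr _ [:: S
  Z]).
apply: (@strong_comp k C _ [:: S X0; dual (S X0); S Z]).
  exact: (strong_merget _ [:: S Z]).
exact: (strong_cap _ [:: S Z]).
Qed.

Definition unit_coords f : K0 k Irr := [ffun Z => scal (of_tail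
  (unit_coord_tail f Z unit_ob))].

Lemma unit_coords_linear : linear unit_coords.
Proof.
move=> a f g; apply/ffunP => Z; rewrite !ffunE.
have -> : of_tail (unit_coord_tail (a *: f + g) Z unit_ob)
   = a *: of_tail (unit_coord_tail f Z unit_ob) + of_tail (unit_coord_tail g Z
     unit_ob).
  apply: whiskr_unit_inj; rewrite tensm_linear_l !(of_tailE
    (unit_coord_tail_strong _ _)).
  by rewrite /unit_coord_tail tensm_linear_l comp_linear_l !comp_linear_r.
exact: scal_linear.
Qed.

Lemma unit_coords_injective (f : mor I1 I1) :
  (forall W, phi W ∘ (f ▷ W) = (W ◁ f) ∘ phi W) -> unit_coords f = 0 -> f = 0.
Proof.
move=> fc J0; apply: central_determined => // A.
have Jt0 Z D : unit_coord_tail f Z D = 0.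
  rewrite -(of_tailE (unit_coord_tail_strong f Z))
    (scal_tail kclosed _ _ (sS Z)).
  by have := congr1 (fun h : K0 k Irr => h Z) J0; rewrite !ffunE => ->; rewrite
    scale0r.
rewrite -[LHS]comp1m -sum_injt_projt comp_suml big1 // => Z _.
rewrite -compA.
pose n D := projt Z D ∘ ((f ▷ D) ∘ (injt X0 D ∘ coevt (S X0) D)).
have nn D E (h : mor D E) : (S Z ◁ (dual (S Z) ◁ h)) ∘ n D = n E ∘ h.
  rewrite /n (compA (_ ◁ _)) projt_nat -!compA.
  rewrite -(comp2_rev (whisk_exchange _ _)) (comp2_rev (injt_nat _ _)).
  by rewrite cap_nat.
suff n0 : n A = 0 by move: n0; rewrite /n => ->; rewrite compm0.
have -> : n A = (S Z ◁ evt (S Z) (dual (S Z) ⊗ A)) ∘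
    (n (S Z ⊗ (dual (S Z) ⊗ A)) ∘ coevt (S Z) A).
  rewrite -nn compA -whiskl_comp snake_l_dual tensm1 comp1m.
  by [].
have J' : (S Z ◁ evt (S Z) (dual (S Z) ⊗ A)) ∘ n (S Z ⊗ (dual (S Z) ⊗ A)) = 0.
  exact: Jt0.
by rewrite compA J' comp0m.
Qed.

End Determined.

End Induced.

(** * The isomorphism *)

(** The composite [T \o P] is an injective endomorphism of a finite
    dimensional space, hence surjective, and [T] is injective. *)
Lemma injective_sandwich (k : fieldType) (U : vectType k) (V : lmodType k)
    (P : U -> V) (T : V -> U) :
  linear P -> linear T -> (forall u, P u = 0 -> u = 0) ->
  (forall v, T v = 0 -> v = 0) -> forall v, exists u, P u = v.
Proof.
move=> Plin Tlin P0 J0 v.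
pose h := T \o P.
have hl : linear h by move=> a x y; rewrite /h /= Plin Tlin.
pose hM := GRing.isLinear.Build k U U _ h hl.
pose hL : {linear U -> U} := HB.pack h hM.
pose F := linfun hL.
have FE x : F x = T (P x) by rewrite lfunE.
have kF : lker F == 0%VS.
  apply/lker0P => x y; rewrite !FE => e; apply/subr0_eq/P0/J0.
  have -> : x - y = (-1) *: y + x by rewrite scaleN1r addrC.
  by rewrite Plin Tlin e scaleN1r addNr.
exists (F^-1%VF (T v)); apply/subr0_eq/J0.
have -> : P (F^-1%VF (T v)) - v = (-1) *: v + P (F^-1%VF (T v)).
  by rewrite scaleN1r addrC.
by rewrite Tlin -FE lker0_lfunVK // scaleN1r addNr.
Qed.

Section Main.
Variables (k : fieldType) (C : spherical_fusion_category k).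
Hypothesis kclosed : forall p : {poly k}, size p != 1%N -> exists x, root p x.
Hypothesis char0 : forall n, n.+1%:R != 0 :> k.
Variables (Irr : finType) (S : Irr -> C).
Hypothesis hS : simple_representatives S.
Variable sq : Irr -> k.
Hypothesis hsq : forall X, sq X ^+ 2 = qdim (S X).
Variables (I1 : C) (B : biproduct (XXdual S) I1).
Variable bas_hb : forall (W : C) (Y Z : Irr),
  basis_of_space (mor (S Y) (W ⊗ S Z)).
Variable bas_e : forall Y X Z : Irr,
  basis_of_space (mor (S Y ⊗ dual (S X)) (dual (S Z))).

Let I1Z : drinfeld_center C :=
  Center (I1_half_braiding kclosed hS hsq B bas_hb).
Local Notation End1 := (center_hom I1Z I1Z).
Local Notation e_ := (e_mor sq B bas_e).

Let d0 X : qdim (S X) != 0 := qdim_neq0 kclosed (sr_simple hS X).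

Lemma e_is_central X : e_ X \in @central _ _ I1Z I1Z.
Proof. by apply/asboolP => W; exact: e_central. Qed.

Definition e_hom X : End1 := CenterHom (e_is_central X).

Lemma chom_linear : linear (fun f : End1 => chom f).
Proof. by move=> a f g. Qed.

Lemma chom_inj (f g : End1) : chom f = chom g -> f = g.
Proof. by move=> e; apply: val_inj. Qed.

(** The inverse of the isomorphism of the theorem; it is injective because
    the [e_Y] are independent. *)
Definition of_K0 (v : K0 k Irr) : End1 :=
  \sum_X (v X / qdim (S X) : k) *: e_hom X.

Lemma chom_of_K0 v :
  chom (of_K0 v) = \sum_X (v X / qdim (S X) : k) *: e_ X.
Proof.
rewrite /of_K0 (linear_map_sum chom_linear); apply: eq_bigr => X _.
by rewrite (linear_mapZ chom_linear).
Qed.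

Lemma of_K0_linear : linear of_K0.
Proof.
move=> a u v; apply: chom_inj; rewrite chom_linear !chom_of_K0 scaler_sumr.
rewrite -big_split; apply: eq_bigr => X _ /=.
by rewrite !ffunE mulrDl scalerDl scalerA -mulrA.
Qed.

Lemma of_K0_eq0 v : of_K0 v = 0 -> v = 0.
Proof.
move=> /(congr1 (fun f : End1 => chom f)); rewrite chom_of_K0.
rewrite (linear_map0 chom_linear) => /(e_free kclosed hS hsq char0) v0.
apply/ffunP => X; rewrite ffunE; have /eqP := v0 X.
by rewrite mulf_eq0 invr_eq0 (negPf (d0 X)) orbF => /eqP.
Qed.

Lemma of_K0_surj f : exists v, of_K0 v = f.
Proof.
have [X0 [i [i' [i'i ii']]]] := unit_index hS.
apply: (@injective_sandwich k _ _ of_K0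
  (fun f : End1 => unit_coords B X0 (chom f))).
- exact: of_K0_linear.
- by move=> a g h; rewrite chom_linear unit_coords_linear.
- exact: of_K0_eq0.
move=> g J0; apply: chom_inj; apply: (unit_coords_injective kclosed hS hsq i'i
  ii' _ J0).
by have /asboolP gc := chomP g; exact: gc.
Qed.

Lemma of_K0_class X : of_K0 (K0_class k X) = (qdim (S X))^-1 *: e_hom X.
Proof.
rewrite /of_K0 (bigD1 X) //= [T in _ + T]big1 ?addr0 => [|Y YX].
  by rewrite ffunE eqxx mul1r.
by rewrite ffunE (negPf YX) mul0r scale0r.
Qed.

Lemma of_K0_mul u v : center_comp (of_K0 u) (of_K0 v) = of_K0 (K0_mul S u v).
Proof.
apply: chom_inj; rewrite /= 2!chom_of_K0 /K0_mul (linear_map_sum of_K0_linear)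
  (linear_map_sum chom_linear) comp_suml.
apply: eq_bigr => X _.
rewrite (linear_map_sum of_K0_linear) (linear_map_sum chom_linear) comp_sumr.
apply: eq_bigr => Y _.
rewrite (linear_mapZ of_K0_linear) (linear_mapZ chom_linear).
rewrite (linear_map_sum of_K0_linear) (linear_map_sum chom_linear).
rewrite compZm compmZ scalerA (e_comp kclosed hS hsq) !scaler_sumr.
apply: eq_bigr => Z _.
rewrite (linear_mapZ of_K0_linear) (linear_mapZ chom_linear) of_K0_class.
rewrite (linear_mapZ chom_linear) /= !scalerA; congr (_ *: _).
by field; rewrite !d0.
Qed.

Lemma of_K0_conv u v :
  I1_conv sq B (chom (of_K0 u)) (chom (of_K0 v)) = chom (of_K0 (K0_conv S u v)).
Proof.
have cb := I1_conv_bilin sq B.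
rewrite 2!chom_of_K0 (bilin_suml cb) /K0_conv.
rewrite (linear_map_sum of_K0_linear) (linear_map_sum chom_linear).
apply: eq_bigr => X _.
rewrite (bilin_sumr cb) (linear_map_sum of_K0_linear) (linear_map_sum
  chom_linear).
apply: eq_bigr => Y _.
rewrite (bilinZl cb) (bilinZr cb) (e_conv kclosed hS hsq).
rewrite (linear_mapZ of_K0_linear) (linear_mapZ chom_linear).
case: eqP => [<-|_]; last first.
  by rewrite (linear_map0 of_K0_linear) (linear_map0 chom_linear) !scaler0.
rewrite (linear_mapZ of_K0_linear) of_K0_class !(linear_mapZ chom_linear) /=
  !scalerA.
congr (_ *: _); rewrite /=; by field; rewrite d0.
Qed.

Lemma End_I1_iso_K0 :
  exists Phi : {linear End1 -> K0 k Irr},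
    [/\ bijective Phi,
        forall X : Irr, exists2 eX : End1,
          chom eX = e_ X & Phi eX = qdim (S X) *: K0_class _ X,
        forall a b : End1,
          Phi (center_comp a b) = K0_mul S (Phi a) (Phi b)
      & forall a b : End1,
          exists2 c : End1,
            chom c = I1_conv sq B (chom a) (chom b)
            & Phi c = K0_conv S (Phi a) (Phi b)].
Proof.
have [F FP] := choice of_K0_surj.
have of_K0_inj u v : of_K0 u = of_K0 v -> u = v.
  move=> e; apply/subr0_eq/of_K0_eq0.
  have -> : u - v = (-1) *: v + u by rewrite scaleN1r addrC.
  by rewrite of_K0_linear e scaleN1r addNr.
have FK v : F (of_K0 v) = v by apply: of_K0_inj; rewrite FP.
have Fl : linear F.
  by move=> a f g; apply: of_K0_inj; rewrite of_K0_linear !FP.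
pose FM := GRing.isLinear.Build k End1 (K0 k Irr) _ F Fl.
exists (HB.pack F FM : {linear End1 -> K0 k Irr}); split=> /=.
- by exists of_K0.
- move=> X; exists (e_hom X) => //; apply: of_K0_inj.
  by rewrite FP (linear_mapZ of_K0_linear) of_K0_class scalerA divff ?scale1r.
- by move=> a b; apply: of_K0_inj; rewrite -of_K0_mul !FP.
move=> a b; exists (of_K0 (K0_conv S (F a) (F b))); last by rewrite FK.
by rewrite -of_K0_conv !FP.
Qed.

End Main.

Theorem corollary3p4 (R : realType)
  (C : spherical_fusion_category R[i])
  (Irr : finType) (S : Irr -> C) (hS : simple_representatives S)
  (sq : Irr -> R[i]) (hsq : forall X, sq X ^+ 2 = qdim (S X))
  (I1 : C) (B : biproduct (XXdual S) I1)
  (bas_hb : forall (W : C) (Y Z : Irr), basis_of_space (mor (S Y) (W ⊗ S Z)))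
  (bas_e : forall Y X Z : Irr,
     basis_of_space (mor (S Y ⊗ dual (S X)) (dual (S Z)))) :
  exists hb : is_half_braiding (I1_braiding sq B bas_hb),
  let I1Z : drinfeld_center C := Center hb in
  exists Phi : {linear center_hom I1Z I1Z -> K0 R[i] Irr},
    [/\ bijective Phi,
        forall X : Irr, exists2 eX : center_hom I1Z I1Z,
          chom eX = e_mor sq B bas_e X & Phi eX = qdim (S X) *: K0_class _ X,
        forall a b : center_hom I1Z I1Z,
          Phi (center_comp a b) = K0_mul S (Phi a) (Phi b)
      & forall a b : center_hom I1Z I1Z,
          exists2 c : center_hom I1Z I1Z,
            chom c = I1_conv sq B (chom a) (chom b)
            & Phi c = K0_conv S (Phi a) (Phi b)].
Proof.
have closed (p : {poly R[i]}) : size p != 1%N -> exists x, root p x.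
  exact/closed_rootP.
have char0 n : n.+1%:R != 0 :> R[i].
  by rewrite Num.Theory.pnatr_eq0.
exists (I1_half_braiding closed hS hsq B bas_hb) => I1Z.
exact: (End_I1_iso_K0 closed char0 hS hsq B bas_hb bas_e).
Qed.
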